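(* Let $(M,\omega)$ be a symplectic manifold of dimension $2n$. All maps below are Lefschetz maps $L^r:H_d^j(M)\to H_d^{j+2r}(M)$, $[A]\mapsto[\omega^r\wedge A]$. There are the following isomorphisms of vector spaces. For $k\le n$ (with $k\geq 0$): $$PH_{dd^\Lambda}^k(M)\cong\ker\big(L^{n-k+1}:H_d^{k-1}\to H_d^{2n-k+1}\big)\oplus\operatorname{coker}\big(L^{n-k+1}:H_d^{k-2}\to H_d^{2n-k}\big),$$ $$PH_{d+d^\Lambda}^k(M)\cong\ker\big(L^{n-k+1}:H_d^{k}\to H_d^{2n-k+2}\big)\oplus\operatorname{coker}\big(L^{n-k+1}:H_d^{k-1}\to H_d^{2n-k+1}\big).$$ For $0\le p\le n$ and $2p<k<n+p$: $$F^pH_+^k(M)\cong\ker\big(L^{p+1}:H_d^{k-2p-1}\to H_d^{k+1}\big)\oplus\operatorname{coker}\big(L^{p+1}:H_d^{k-2p-2}\to H_d^k\big),$$ $$F^pH_-^k(M)\cong\ker\big(L^{p+1}:H_d^{2n-k}\to H_d^{2n-k+2p+2}\big)\oplus\operatorname{coker}\big(L^{p+1}:H_d^{2n-k-1}\to H_d^{2n+2p-k+1}\big).$$ In particular, for $p=0$ and $0<k<n$: $$PH_{\partial_+}^k(M)\cong\ker\big(L:H_d^{k-1}\to H_d^{k+1}\big)\oplus\operatorname{coker}\big(L:H_d^{k-2}\to H_d^k\big),$$ $$PH_{\partial_-}^k(M)\cong\ker\big(L:H_d^{2n-k}\to H_d^{2n-k+2}\big)\oplus\operatorname{coker}\big(L:H_d^{2n-k-1}\to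 H_d^{2n-k+1}\big).$$
   Context: $H_d^k=H_d^k(M)$ is de Rham cohomology (zero for $k<0$ or $k>2n$). $\Omega^k$ denotes the smooth real $k$-forms on $M$, and $L(A)=\omega\wedge A$. For $0\le s\le n$, $\mathcal P^s=\{B\in\Omega^s: L^{n+1-s}B=0\}$ is the space of primitive $s$-forms; set $\mathcal P^s=0$ for other $s$. Every $A_k\in\Omega^k$ has a unique Lefschetz decomposition $A_k=\sum_{\max(0,k-n)\le r\le\lfloor k/2\rfloor}L^rB_{k-2r}$ with $B_{k-2r}\in\mathcal P^{k-2r}$. $*_r$ is the linear operator with $*_r(L^rB_s)=L^{n-r-s}B_s$ for $B_s\in\mathcal P^s$. $\Pi^p A_k=\sum_{r\le p}L^rB_{k-2r}$ and $F^p\Omega^k=\Pi^p\Omega^k$ (nonzero only for $0\le k\le n+p$). For $B_s\in\mathcal P^s$ write uniquely $dB_s=\partial_+B_s+\omega\wedge\partial_-B_s$ with $\partial_\pm B_s\in\mathcal P^{s\pm1}$. $d_+=\Pi^p\circ d:F^p\Omega^k\to F^p\Omega^{k+1}$ and $d_-=*_r\,d\,*_r:F^p\Omega^k\to F^p\Omega^{k-1}$. Filtered cohomologies: for $0\le k\le n+p-1$, $$F^pH_+^k=\frac{\ker d_+\cap F^p\Omega^k}{d_+(F^p\Omega^{k-1})},\qquad F^pH_-^k=\frac{\ker d_-\cap F^p\Omega^k}{d_-(F^p\Omega^{k+1})}.$$ Primitive cohomologies: for $0\le k\le n$, $$PH_{dd^\Lambda}^k=\frac{\ker(\partial_+\partial_-)\cap\mathcal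 P^k}{\partial_+\mathcal P^{k-1}+\partial_-\mathcal P^{k+1}},\qquad PH_{d+d^\Lambda}^k=\frac{\ker(\partial_++\partial_-)\cap\mathcal P^k}{\partial_+\partial_-\mathcal P^k},$$ and for $0\le k<n$, $PH_{\partial_\pm}^k=(\ker\partial_\pm\cap\mathcal P^k)/\partial_\pm\mathcal P^{k\mp1}$, which equals $F^0H_\pm^k$. *)

(* Defs.v *)
From HB Require Import structures.
From mathcomp Require Import all_boot all_order all_algebra.
From mathcomp Require Import generic_quotient ring_quotient.
From mathcomp Require Import all_classical all_reals all_analysis.
Import Order.TTheory GRing.Theory Num.Theory.
Import numFieldNormedType.Exports.

Set Implicit Arguments.
Unset Strict Implicit.
Unset Printing Implicit Defensive.

Local Open Scope classical_set_scope.
Local Open Scope ring_scope.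

(** * Subspaces, quotients and subquotients of a vector space

    Subspaces are presented by sets, through the subspace they generate. Every
    set to which [lspan], [subspace], [quotient] or [subquotient] is applied
    below is itself a subspace and thus equal to its span ([lspan_id]); the
    span only serves to form the vector spaces without proving this first. *)

Section Spans.
Context (R : pzRingType) (V : lmodType R).

Definition is_subspace (S : set V) : Prop :=
  S 0 /\ forall (a : R) (u v : V), S u -> S v -> S (a *: u + v).

Definition lspan (S : set V) : {pred V} := mem (smallest is_subspace S).

Lemma lspanP (S : set V) (x : V) :
  reflect (smallest is_subspace S x) (x \in lspan S).
Proof. exact: (iffP idP (@set_mem _ _ _) (@mem_set _ _ _)). Qed.

Lemma lspan_id (S : set V) : is_subspace S -> [set` lspan S] = S.
Proof.
move=> HS; rewrite -[RHS](smallest_id HS).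
by apply/seteqP; split=> x /= /lspanP.
Qed.

Lemma lspan_submod_closed (S : set V) : submod_closed (lspan S).
Proof.
split=> [|a u v /lspanP Su /lspanP Sv]; apply/lspanP => T TS.
  exact: TS.1.1.
by apply: TS.1.2; [exact: Su | exact: Sv].
Qed.

HB.instance Definition _ (S : set V) :=
  GRing.isSubmodClosed.Build R V (lspan S)
    (GRing.submod_closed_semi (lspan_submod_closed S)).

Record subspace (S : set V) := Subspace {
  subspace_val : V;
  subspace_valP : subspace_val \in lspan S
}.

HB.instance Definition _ (S : set V) := [isSub for @subspace_val S].
HB.instance Definition _ (S : set V) := [Choice of subspace S by <:].
HB.instance Definition _ (S : set V) :=
  [SubChoice_isSubLmodule of subspace S by <:].

End Spans.

Section Quotients.
Context (R : pzRingType) (V : lmodType R) (S : set V).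
Local Open Scope quotient_scope.

Definition quotient := Quotient.quot (lspan S : zmodClosed V).

HB.instance Definition _ := GRing.Zmodule.on quotient.
HB.instance Definition _ := EqQuotient.on quotient.

Definition quotient_scale (a : R) (c : quotient) : quotient :=
  \pi_quotient (a *: repr c).

Lemma quotient_pi (c : quotient) : exists x, c = \pi_quotient x.
Proof. by exists (repr c); rewrite reprK. Qed.

Lemma pi_quotient_scale (a : R) (x : V) :
  quotient_scale a (\pi_quotient x) = \pi_quotient (a *: x).
Proof.
apply/eqP; rewrite /quotient_scale -Quotient.idealrBE -scalerBr rpredZ //.
by rewrite Quotient.idealrBE reprK.
Qed.

Lemma pi_quotientD (x y : V) :
  \pi_quotient x + \pi_quotient y = \pi_quotient (x + y).
Proof. by rewrite !piE. Qed.

Fact quotient_scaleA (a b : R) (c : quotient) :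
  quotient_scale a (quotient_scale b c) = quotient_scale (a * b) c.
Proof. by have [x ->] := quotient_pi c; rewrite !pi_quotient_scale scalerA. Qed.

Fact quotient_scale1 : left_id 1 quotient_scale.
Proof.
by move=> c; have [x ->] := quotient_pi c; rewrite pi_quotient_scale scale1r.
Qed.

Fact quotient_scaleDr : right_distributive quotient_scale +%R.
Proof.
move=> a c e; have [x ->] := quotient_pi c; have [y ->] := quotient_pi e.
rewrite pi_quotientD !pi_quotient_scale.
by rewrite pi_quotientD scalerDr.
Qed.

Fact quotient_scaleDl (c : quotient) :
  {morph quotient_scale^~ c : a b / a + b}.
Proof.
move=> a b; have [x ->] := quotient_pi c.
by rewrite !pi_quotient_scale pi_quotientD scalerDl.
Qed.

HB.instance Definition _ := GRing.Zmodule_isLmodule.Build R quotient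
  quotient_scaleA quotient_scale1 quotient_scaleDr quotient_scaleDl.

End Quotients.

Section Subquotients.
Context (R : pzRingType) (V : lmodType R) (Z B : set V).

(* Z / B, or more precisely Z / (Z `&` B) if B is not contained in Z *)
Definition subquotient : lmodType R :=
  quotient [set z : subspace Z | B (val z)].

(* the class of x : V, assumed to belong to Z, is c *)
Definition class_is (x : V) (c : subquotient) : Prop :=
  exists2 z : subspace Z, val z = x & \pi_(quotient _)%qT z = c.

End Subquotients.

Definition direct_sum (R : pzRingType) (U V : lmodType R) : lmodType R :=
  (U * V)%type.

Definition isomorphic (R : pzRingType) (U V : lmodType R) : Prop :=
  exists f : {linear U -> V}, bijective f.

(** * Smooth maps and smooth manifolds *)

Fixpoint Ck_on (R : realType) (V W : normedModType R) (k : nat) (U : set V)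
    (f : V -> W) : Prop :=
  if k is k'.+1 then
    (forall x, U x -> differentiable f x) /\
    (forall v, Ck_on k' U ('D_v f))
  else forall x, U x -> {for x, continuous f}.

(* to be used for an open set U *)
Definition smooth_on (R : realType) (V W : normedModType R) (U : set V)
    (f : V -> W) : Prop := forall k, Ck_on k U f.

(* A chart i is the homeomorphism [coord i] from the open set [dom i] onto an
   open set of R^m, with inverse [param i]; the values of these functions
   elsewhere are irrelevant. *)
Record manifold (R : realType) (m : nat) := Manifold {
  points :> topologicalType;
  points_hausdorff : hausdorff_space points;
  points_second_countable : @second_countable points;
  chart : Type;
  dom : chart -> set points;
  coord : chart -> points -> 'rV[R]_m;
  param : chart -> 'rV[R]_m -> points;
  dom_cover : forall p, exists i, dom i p;
  dom_open : forall i, open (dom i);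
  coord_open : forall i, open (coord i @` dom i);
  coordK : forall i p, dom i p -> param i (coord i p) = p;
  coord_continuous : forall i p, dom i p -> {for p, continuous (coord i)};
  param_continuous : forall i x, (coord i @` dom i) x ->
    {for x, continuous (param i)};
  transition_smooth : forall i j,
    smooth_on (coord i @` (dom i `&` dom j)) (coord j \o param i)
}.

(** * Differential forms

    A tangent vector at p is represented in each chart around p by an element
    of R^m. A form A is given by its expression in each chart i: a function
    [A i p] of lists of tangent vectors, whose restriction to the lists of size
    k is the component of degree k of A. This puts forms of all degrees in a
    single vector space and makes forms of degree k < 0 vanish. *)

Section Forms.
Context (R : realType) (m : nat) (M : manifold R m).

Definition cochain := chart M -> M -> seq 'rV[R]_m -> R^o.
HB.instance Definition _ := GRing.Lmodule.on cochain.

(* Omega^k: smooth k-forms, the last clause being compatibility with the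
   pullback by changes of charts. *)
Definition forms (k : int) : set cochain := [set A |
  [/\ forall i p s, ~ dom i p \/ (size s)%:Z <> k -> A i p s = 0,
      forall i p s1 s2 (a : R) (u v : 'rV[R]_m),
        A i p (s1 ++ (a *: u + v) :: s2) =
        a *: A i p (s1 ++ u :: s2) + A i p (s1 ++ v :: s2),
      forall i p s1 s2 s3 v, A i p (s1 ++ v :: s2 ++ v :: s3) = 0,
      forall i s, smooth_on (coord i @` dom i) (fun x => A i (param i x) s)
    & forall i j p s, dom i p -> dom j p ->
        A i p s = A j p [seq 'd (coord j \o param i) (coord i p) v | v <- s]]].

Definition ext_d (A : cochain) : cochain := fun i p s =>
  if p \in dom i then
    \sum_(a < size s) (-1) ^+ a *
      'D_(s`_a) (fun x => A i (param i x) (take a s ++ drop a.+1 s)) (coord i p)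
  else 0.

(* number of inversions of the shuffle which brings the positions selected by b
   to the front *)
Definition inversions (b : seq bool) : nat :=
  (\sum_(j < size b | nth false b j) count negb (take j b))%N.

(* (A ^ B)(s) is the sum over all (k, l)-shuffles: no factor 1 / (k! l!) *)
Definition wedge (A B : cochain) : cochain := fun i p s =>
  \sum_(b : (size s).-tuple bool)
    (-1) ^+ inversions b * (A i p (mask b s) * B i p (mask (map negb b) s)).

Definition closed_forms (k : int) : set cochain :=
  [set A | forms k A /\ ext_d A = 0].
Definition exact_forms (k : int) : set cochain :=
  [set ext_d A | A in forms (k - 1)].

Definition HdR (k : int) : lmodType R :=
  subquotient (closed_forms k) (exact_forms k).

End Forms.

Arguments forms {R m} M k.

Record symplectic_manifold (R : realType) (n : nat) := SymplecticManifold {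
  underlying :> manifold R (2 * n);
  omega : cochain underlying;
  omega_form : forms underlying 2 omega;
  omega_closed : ext_d omega = 0;
  omega_nondegenerate : forall i p, dom i p ->
    forall u, (forall v, omega i p [:: u; v] = 0) -> u = 0
}.

Arguments omega {R n} _.

(** * Lefschetz maps, Lefschetz decomposition and the induced cohomologies *)

Section Symplectic.
Context (R : realType) (n : nat) (M : symplectic_manifold R n).
Local Notation cochain := (cochain M).

Definition Lop (A : cochain) : cochain := wedge (omega M) A.
Definition Lpow (r : nat) (A : cochain) : cochain := iter r Lop A.

(* the graph of L^r : H^j -> H^l, [A] |-> [omega^r ^ A], for l = j + 2 r *)
Definition Lefschetz_graph (r : nat) (j l : int) (c : HdR M j) (c' : HdR M l) :
    Prop :=
  exists A : cochain, class_is A c /\ class_is (Lpow r A) c'.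

Definition kerL (r : nat) (j l : int) : lmodType R :=
  subspace [set c : HdR M j | @Lefschetz_graph r j l c 0].

Definition cokerL (r : nat) (j l : int) : lmodType R :=
  quotient [set c' : HdR M l | exists c : HdR M j, Lefschetz_graph r c c'].

(* P^s *)
Definition primitive (s : int) : set cochain :=
  if 0 <= s <= n%:Z then
    [set B | forms M s B /\ Lpow (absz (n%:Z + 1 - s)%R) B = 0]
  else [set 0].

(* B r is the component B_{k-2r} of A_k, set to 0 when r is outside of
   max(0, k-n) <= r <= k/2 *)
Definition is_Lefschetz_decomposition (k : int) (A : cochain)
    (B : nat -> cochain) : Prop :=
  [/\ forall r : nat, k - n%:Z <= r%:Z -> 2 * r%:Z <= k ->
        primitive (k - 2 * r%:Z) (B r),
      forall r : nat, ~ (k - n%:Z <= r%:Z /\ 2 * r%:Z <= k) -> B r = 0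
    & A = \sum_(r < n.+1) Lpow r (B r)].

Definition Lefschetz_part (k : int) (A : cochain) : nat -> cochain :=
  xget (fun=> 0) [set B | is_Lefschetz_decomposition k A B].

(* The operators below act on forms of degree k (of degree s for del); this
   degree is an explicit argument. They are meant for such forms only, on which
   the decompositions exist and are unique. *)

(* Pi^p *)
Definition Pi (p : nat) (k : int) (A : cochain) : cochain :=
  \sum_(r < p.+1) Lpow r (Lefschetz_part k A r).

(* *_r : L^r B_s |-> L^(n-r-s) B_s with s = k - 2 r; it maps Omega^k to
   Omega^(2n-k) *)
Definition star_r (k : int) (A : cochain) : cochain :=
  \sum_(r < n.+1)
    Lpow (absz (n%:Z - r%:Z - (k - 2 * r%:Z))%R) (Lefschetz_part k A r).

(* F^p Omega^k *)
Definition filtered (p : nat) (k : int) : set cochain :=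
  [set Pi p k A | A in forms M k].

(* d_+ on F^p Omega^k *)
Definition d_plus (p : nat) (k : int) (A : cochain) : cochain :=
  Pi p (k + 1) (ext_d A).

(* d_- on F^p Omega^k *)
Definition d_minus (k : int) (A : cochain) : cochain :=
  star_r (2 * n%:Z - k + 1) (ext_d (star_r k A)).

(* (del_+ B, del_- B) for B in P^s; for s outside of [0, n], where P^s = 0, this
   is set to 0, because C.2 would not be unique for s = n + 1. *)
Definition del (s : int) (B : cochain) : cochain * cochain :=
  if 0 <= s <= n%:Z then
    xget (0, 0) [set C | [/\ primitive (s + 1) C.1, primitive (s - 1) C.2
                           & ext_d B = C.1 + Lop C.2]]
  else (0, 0).
Definition del_plus (s : int) (B : cochain) : cochain := (del s B).1.
Definition del_minus (s : int) (B : cochain) : cochain := (del s B).2.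

(* for 0 <= k <= n + p - 1 *)
Definition FH_plus (p : nat) (k : int) : lmodType R :=
  subquotient [set A | filtered p k A /\ d_plus p k A = 0]
              [set d_plus p (k - 1) A | A in filtered p (k - 1)].
Definition FH_minus (p : nat) (k : int) : lmodType R :=
  subquotient [set A | filtered p k A /\ d_minus k A = 0]
              [set d_minus (k + 1) A | A in filtered p (k + 1)].

(* for 0 <= k <= n *)
Definition PH_ddLambda (k : int) : lmodType R :=
  subquotient [set B | primitive k B /\ del_plus (k - 1) (del_minus k B) = 0]
    [set C | exists B1 B2, [/\ primitive (k - 1) B1, primitive (k + 1) B2
               & C = del_plus (k - 1) B1 + del_minus (k + 1) B2]].
Definition PH_d_plus_dLambda (k : int) : lmodType R :=
  subquotient [set B | primitive k B /\ del_plus k B + del_minus k B = 0]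
    [set del_plus (k - 1) (del_minus k B) | B in primitive k].

(* for 0 <= k < n *)
Definition PH_del_plus (k : int) : lmodType R :=
  subquotient [set B | primitive k B /\ del_plus k B = 0]
              [set del_plus (k - 1) B | B in primitive (k - 1)].
Definition PH_del_minus (k : int) : lmodType R :=
  subquotient [set B | primitive k B /\ del_minus k B = 0]
              [set del_minus (k + 1) B | B in primitive (k + 1)].

End Symplectic.

Notation "U ≅ V" := (isomorphic U V) (at level 70, no associativity).
Notation "U ⊕ V" := (direct_sum U V) (at level 50, left associativity).

(* Main.v *)
Require Import Defs.
From HB Require Import structures.
From mathcomp Require Import all_boot all_order all_algebra.
From mathcomp Require Import generic_quotient ring_quotient.
From mathcomp Require Import all_classical all_reals all_analysis.
From mathcomp Require Import ring zify.
Import Order.TTheory GRing.Theory Num.Theory.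
Import numFieldNormedType.Exports.
Import Defs.

(** Contraction with the inverse of the symplectic form is an operator Lambda
    with [Lambda, L] = n - k on k-forms. This relation alone makes
    L^(n-k) : Omega^k -> Omega^(2n-k) bijective for k <= n, and hence
    F^p Omega^k = ker L^(n+p+1-k) for k <= n + p + 1, a complement of
    L^(p+1) Omega^(k-2p-2). In the relevant degrees (F^p Omega, d_+) is
    therefore the cokernel of the injective chain map L^(p+1), while *_r
    identifies (F^p Omega, d_-) with the kernel of the surjective L^(p+1). The
    long exact sequences yield 0 -> coker -> H -> ker -> 0, and every short
    exact sequence of vector spaces splits, subspaces having complements by
    Zorn's lemma. For the two remaining cohomologies, the link with the de Rham
    complex is L^(n-k+1) del_- B = d L^(n-k) B for B primitive of degree k. *)

Set Implicit Arguments.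
Unset Strict Implicit.
Unset Printing Implicit Defensive.
Local Open Scope classical_set_scope.
Local Open Scope ring_scope.

(** * Linear relations and split exact sequences *)

Section LinearRelations.
Context (K : fieldType).

(** The maps of the exact sequences depend on choices: a lift through L^r, a primitive of an exact
    form, a representative of a class. They are therefore given as linear relations between forms,
    and [cohomology_split] turns elementwise exactness of such relations into a direct sum, once for
    all the cohomologies. The cohomologies of dd^Lambda and d + d^Lambda sit where L^(n-k+1) passes
    from injective to surjective. It is bijective from Omega^(k-1) to Omega^(2n-k+1); one degree
    lower its cokernel is L^(n-k) P^k, one degree higher its kernel is P^k. So the cokernel complex
    ends and the kernel complex starts with a copy of P^k, and lifting d through the bijection in
    between yields the second-order operator del_+ del_- that joins them. Lambda is built in charts,
    so it must be shown smooth and independent of the chart, and its commutator with L must be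
    computed. Forms being functions of lists of vectors, contraction with the head of a list gives
    recursions for the wedge product and for d, and most identities become inductions on lists
    rather than manipulations of shuffles. *)

Definition linear_rel (U V : lmodType K) (r : U -> V -> Prop) : Prop :=
  forall a u u' v v', r u v -> r u' v' -> r (a *: u + u') (a *: v + v').

Lemma linear_relB (U V : lmodType K) (r : U -> V -> Prop) u u' v v' :
  linear_rel r -> r u v -> r u' v' -> r (u - u') (v - v').
Proof.
by move=> lr uv uv'; rewrite addrC [v - _]addrC -!scaleN1r; exact: lr.
Qed.

(** The trivial kernel makes [r] single-valued, so any choice of values is automatically linear. *)
Lemma isomorphic_rel (U V : lmodType K) (r : U -> V -> Prop) :
  linear_rel r ->
  (forall u, exists v, r u v) -> (forall v, r 0 v -> v = 0) ->
  (forall v, exists u, r u v) -> (forall u, r u 0 -> u = 0) ->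
  U ≅ V.
Proof.
move=> lr /choice[f rf] r0 /choice[g rg] r0'.
have funr u v v' : r u v -> r u v' -> v = v'.
  move=> uv uv'; apply/subr0_eq/r0; rewrite -(subrr u); exact: linear_relB.
have injr u u' v : r u v -> r u' v -> u = u'.
  move=> uv uv'; apply/subr0_eq/r0'; rewrite -(subrr v); exact: linear_relB.
have linf : linear f.
  by move=> a u v; apply: funr (rf _) _; exact: lr.
pose F : {linear U -> V} := HB.pack f (GRing.isLinear.Build _ _ _ _ f linf).
exists F; exists g => [u|v] /=; first exact: injr (rg _) (rf _).
exact: funr (rf _) (rg _).
Qed.

Lemma is_subspaceD (V : lmodType K) (S : set V) u v :
  is_subspace S -> S u -> S v -> S (u + v).
Proof. by move=> [_ HS] Su Sv; rewrite -[u]scale1r; exact: HS. Qed.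

Lemma is_subspaceZ (V : lmodType K) (S : set V) (a : K) u :
  is_subspace S -> S u -> S (a *: u).
Proof. by move=> [S0 HS] Su; rewrite -[_ *: _]addr0; exact: HS. Qed.

Lemma is_subspaceN (V : lmodType K) (S : set V) u :
  is_subspace S -> S u -> S (- u).
Proof. by move=> ? Su; rewrite -scaleN1r; exact: is_subspaceZ. Qed.

Lemma is_subspaceB (V : lmodType K) (S : set V) u v :
  is_subspace S -> S u -> S v -> S (u - v).
Proof. by move=> ? Su Sv; apply: is_subspaceD => //; exact: is_subspaceN. Qed.

Lemma is_subspace_sum (V : lmodType K) (S : set V) I (r : seq I) (P : pred I)
  (F : I -> V) : is_subspace S -> (forall i, P i -> S (F i)) ->
  S (\sum_(i <- r | P i) F i).
Proof.
move=> SS SF; elim/big_ind : _ => //; first by case: SS.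
by move=> *; exact: is_subspaceD.
Qed.

Lemma subspace_complement (V : lmodType K) (S : set V) : is_subspace S ->
  exists T : set V, [/\ is_subspace T, forall x, S x -> T x -> x = 0
    & forall x, exists s t, [/\ S s, T t & x = s + t]].
Proof.
move=> SS.
(* [P] does not ask for 0, because the union of the empty chain is empty. Maximality puts 0 into T
   afterwards. *)
pose P (T : set V) := (forall a u v, T u -> T v -> T (a *: u + v)) /\
  (forall x, S x -> T x -> x = 0).
have [F FP Ftot|T [[linT disjT] maxT]] := @Zorn_bigcup V P.
  split=> [a u v [X FX Xu] [Y FY Yv]|x Sx [X FX Xx]]; last exact: (FP _ FX).2.
  have [XY|YX] := Ftot _ _ FX FY.
    by exists Y => //; apply: (FP _ FY).1 => //; exact: XY.
  by exists X => //; apply: (FP _ FX).1 => //; exact: YX.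
have T0 : T 0.
  apply: contrapT => nT0; apply: (maxT (T `|` [set 0])).
    by split; [left|move=> /(_ 0)/=; apply: contra_not nT0; apply; right].
  split=> [a u v|x Sx].
    move=> [Tu|->] [Tv|->]; rewrite ?scaler0 ?addr0 ?add0r.
    - by left; exact: linT.
    - left; suff : T (a *: u + (-1) *: u + u) by rewrite scaleN1r addrNK.
      by rewrite -scalerDl; exact: linT.
    - by left.
    - by right.
  by move=> [|]; [exact: disjT|].
have sT : is_subspace T by split.
exists T; split=> // x; apply: contrapT => nx.
(* If x is not in S + T, the span of x and T still meets S only in 0, since a nonzero coefficient of
   x could be inverted. This contradicts maximality. *)
apply: (maxT [set y | exists a t, T t /\ y = a *: x + t]).
  split=> [t Tt|/(_ x)]; first by exists 0, t; rewrite scale0r add0r.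
  have Tx : exists a t, T t /\ x = a *: x + t.
    by exists 1, 0; rewrite scale1r addr0.
  move=> /(_ Tx) {}Tx; apply: nx; exists 0, x; rewrite add0r; split=> //.
  by case: SS.
split=> [a _ _ [b [t [Tt ->]]] [c [t' [Tt' ->]]]|y Sy [a [t [Tt yE]]]].
  exists (a * b + c), (a *: t + t'); split; first exact: linT.
  by rewrite scalerDr scalerA addrACA scalerDl.
have [a0|a0] := eqVneq a 0.
  by move: yE; rewrite a0 scale0r add0r => yE; apply: disjT; rewrite // yE.
exfalso; apply: nx; exists (a^-1 *: y), (- (a^-1 *: t)); split.
- exact: is_subspaceZ.
- by apply: is_subspaceN => //; exact: is_subspaceZ.
- by rewrite -scalerBr yE -addrA subrr addr0 scalerA mulVf// scale1r.
Qed.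

(** Here [f] is the projection X -> U and [g] the inclusion C -> X, both as relations. A complement
    of the kernel of [f] plays the role of a section. *)
Lemma split_exact (U X C : lmodType K) (f : X -> U -> Prop)
    (g : C -> X -> Prop) :
  linear_rel f -> (forall x, exists u, f x u) -> (forall u, f 0 u -> u = 0) ->
  (forall u, exists x, f x u) ->
  linear_rel g -> (forall c, exists x, g c x) -> (forall x, g 0 x -> x = 0) ->
  (forall c, g c 0 -> c = 0) ->
  (forall x, f x 0 <-> exists c, g c x) ->
  X ≅ U ⊕ C.
Proof.
move=> lf totf f0 surf lg totg g0 injg exfg.
have f00 : f 0 0 by have [u u0] := totf 0; rewrite -[in X in f _ X](f0 u).
have sker : is_subspace [set x | f x 0].
  split=> // a u v /= fu fv; have := lf a _ _ _ _ fu fv.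
  by rewrite scaler0 addr0.
have [T [sT disjT decT]] := subspace_complement sker.
pose r (x : X) (uc : U ⊕ C) :=
  exists t y, [/\ T t, f t uc.1, g uc.2 y & x = t + y].
apply: (@isomorphic_rel _ _ r).
- move=> a x x' [u c] [u' c'] [t [y [Tt ftu gcy ->]]] [t' [y' [Tt' ftu' gcy' ->]]].
  exists (a *: t + t'), (a *: y + y'); split; first exact: sT.2.
  + exact: lf.
  + exact: lg.
  + by rewrite scalerDr addrACA.
- move=> x; have [y [t [fy Tt xE]]] := decT x.
  have [u fu] := totf t; have [c gc] := (exfg y).1 fy.
  by exists (u, c), t, y; split=> //; rewrite addrC.
- move=> [u c] [t [y [Tt /= ftu gcy]]] /esym ty0.
  have fy : f y 0 by apply/exfg; exists c.
  have tN : t = - y by apply/eqP; rewrite -addr_eq0 ty0.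
  have t0 : t = 0.
    by apply: disjT => //; rewrite tN; exact: (is_subspaceN sker).
  have y0 : y = 0 by rewrite -ty0 t0 add0r.
  rewrite t0 in ftu; rewrite y0 in gcy.
  by rewrite (f0 _ ftu) (injg _ gcy).
- move=> [u c]; have [x fx] := surf u; have [y gy] := totg c.
  have [y' [t [fy Tt xE]]] := decT x.
  exists (t + y), t, y; split=> //=.
  have -> : t = x - y' by rewrite xE addrAC subrr add0r.
  rewrite -[u]subr0; exact: linear_relB.
- move=> x [t [y [Tt /= ft gy ->]]].
  by rewrite (disjT _ ft Tt) (g0 _ gy) addr0.
Qed.

End LinearRelations.

(** * Quotients and classes through representatives *)

Section Quotients.
Context (K : fieldType) (V : lmodType K).

Lemma subspaceP (S : set V) (x : V) : is_subspace S ->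
  x \in lspan S <-> S x.
Proof. by move=> SS; have /seteqP[h1 h2] := lspan_id SS; split; [exact: h1|exact: h2]. Qed.

Lemma quotient_pi0 (S : set V) (x : V) : is_subspace S ->
  \pi_(quotient S)%qT x = 0 <-> S x.
Proof.
move=> SS; rewrite -(subspaceP x SS); split => [/eqP|xS].
  rewrite -[X in _ == X](_ : \pi_(quotient S)%qT 0 = 0); last by rewrite !piE.
  by rewrite -Quotient.idealrBE subr0.
apply/eqP; rewrite -[X in _ == X](_ : \pi_(quotient S)%qT 0 = 0); last by rewrite !piE.
by rewrite -Quotient.idealrBE subr0.
Qed.

Lemma quotient_pi_linear (S : set V) (a : K) (x y : V) :
  \pi_(quotient S)%qT (a *: x + y) =
  a *: \pi_(quotient S)%qT x + \pi_(quotient S)%qT y.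
Proof.
by rewrite -pi_quotientD; congr (_ + _); exact/esym/pi_quotient_scale.
Qed.

End Quotients.

Section Classes.
Context (K : fieldType) (V : lmodType K) (Z B : set V) (SZ : is_subspace Z).

Lemma class_is_mem x (c : subquotient Z B) : class_is x c -> Z x.
Proof. by move=> [z <- _]; apply/(subspaceP _ SZ); exact: subspace_valP z. Qed.

Lemma class_is_rep (c : subquotient Z B) : exists2 x, Z x & class_is x c.
Proof.
have [z ->] := quotient_pi c; exists (val z); last by exists z.
by apply/(subspaceP _ SZ); exact: subspace_valP z.
Qed.

Lemma class_is_ex x : Z x -> exists c : subquotient Z B, class_is x c.
Proof.
move=> /(subspaceP _ SZ) Zx.
by exists (\pi_(quotient _)%qT (Subspace Zx)), (Subspace Zx).
Qed.

Lemma class_is_linear : linear_rel (fun x (c : subquotient Z B) => class_is x c).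
Proof.
move=> a _ _ _ _ [z <- <-] [z' <- <-]; exists (a *: z + z') => //.
exact: quotient_pi_linear.
Qed.

Hypothesis SB : is_subspace B.

Lemma class_is0 x : class_is x (0 : subquotient Z B) <-> Z x /\ B x.
Proof.
have SB' : is_subspace [set z : subspace Z | B (val z)].
  split=> [|a u v /= Bu Bv] /=; [by case: SB|exact: SB.2].
split=> [[z <- /(quotient_pi0 _ SB') //= Bz]|[Zx Bx]].
  by split=> //; apply/(subspaceP _ SZ); exact: subspace_valP z.
move: Zx => /(subspaceP _ SZ) Zx; exists (Subspace Zx) => //.
by apply/(quotient_pi0 _ SB').
Qed.

Lemma class_is_eq x y (c : subquotient Z B) : class_is x c -> class_is y c ->
  B (x - y).
Proof.
move=> cx cy; have := linear_relB class_is_linear cx cy.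
by rewrite subrr => /class_is0[].
Qed.

Lemma class_is_fun x (c c' : subquotient Z B) : class_is x c -> class_is x c' -> c = c'.
Proof.
move=> cx cy; have := linear_relB class_is_linear cx cy; rewrite subrr => -[z z0 zc].
apply/subr0_eq; rewrite -zc; apply/quotient_pi0.
  by split=> [|a u v /= Bu Bv] /=; [case: SB|exact: SB.2].
by rewrite /= z0; case: SB.
Qed.

End Classes.

(** * Exterior algebra of multilinear functions on sequences of vectors *)

Lemma inversions_true b : inversions (true :: b) = inversions b.
Proof.
rewrite /inversions /= big_mkcond big_ord_recl/= add0n -big_mkcond/=.
by apply: eq_big => // i; rewrite /= add0n.
Qed.

(** A position sent to the back is crossed by every selected position after it. *)
Lemma inversions_false b :
  inversions (false :: b) = (inversions b + count id b)%N.
Proof.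
rewrite /inversions /= big_mkcond big_ord_recl/= add0n -big_mkcond/=.
rewrite big_split/= addnC; congr (_ + _)%N.
by rewrite -sum1_count (big_nth false) big_mkord.
Qed.

Section MultilinearFunctions.
Context (R : comNzRingType) (V : lmodType R).
Implicit Types (F G : seq V -> R^o) (s : seq V) (u v : V).

Definition wedge_at F G s : R^o :=
  \sum_(b : (size s).-tuple bool)
    (-1) ^+ inversions b * (F (mask b s) * G (mask (map negb b) s)).

Definition contract v F : seq V -> R^o := fun s => F (v :: s).

(* This sign replaces the usual (-1)^deg, so that contraction and exterior
   derivative are antiderivations on all functions, homogeneous or not, and
   identities can be proved by induction on the sequence of vectors. *)
Definition grading F : seq V -> R^o := fun s => (-1) ^+ size s * F s.

Definition multilinear F := forall s1 s2 a u v,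
  F (s1 ++ (a *: u + v) :: s2) = a * F (s1 ++ u :: s2) + F (s1 ++ v :: s2).

(* For multilinear functions it is enough to test equal neighbours, see
   [alternating_repeat]. *)
Definition alternating F := forall s1 s2 v, F (s1 ++ v :: v :: s2) = 0.

Lemma wedge_at_nil F G : wedge_at F G [::] = F [::] * G [::].
Proof.
rewrite /wedge_at/= (big_pred1 [tuple])/=; last first.
  by move=> b; apply/esym/eqP; exact: tuple0.
by rewrite /inversions big_ord0 expr0 mul1r.
Qed.

(** The shuffles are split by the factor that receives v. If this is G, then v passes the arguments
    of F, whence [grading]. Contraction is thus an antiderivation, and this recursion replaces
    shuffles in the algebraic identities below. *)
Lemma wedge_at_cons F G v s : wedge_at F G (v :: s) =
  wedge_at (contract v F) G s + wedge_at (grading F) (contract v G) s.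
Proof.
rewrite /wedge_at /=.
pose h (x : bool * (size s).-tuple bool) := [tuple of x.1 :: x.2].
rewrite (reindex h)/=; last first.
  exists (fun b => (thead b, [tuple of behead b])) => [[c b] _|b _].
    by rewrite /h/= theadE; congr pair; apply: val_inj.
  by rewrite /h [RHS]tuple_eta.
rewrite -(pair_big predT predT (fun c b => (-1) ^+ inversions (h (c, b)) *
  (F (mask (h (c, b)) (v :: s)) * G (mask (map negb (h (c, b))) (v :: s)))))/=.
rewrite big_bool/=; congr (_ + _); apply: eq_bigr => b _.
  by rewrite inversions_true.
rewrite inversions_false /grading exprD size_mask ?size_tuple//.
by rewrite -!mulrA.
Qed.

Lemma wedge_atDl a F F' G :
  wedge_at (a *: F + F') G = a *: wedge_at F G + wedge_at F' G.
Proof.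
apply/funext => s; rewrite -[RHS]/(a * wedge_at F G s + wedge_at F' G s).
rewrite /wedge_at mulr_sumr -big_split/=; apply: eq_bigr => b _.
by rewrite -[(a *: F + F') _]/(a * F _ + F' _); ring.
Qed.

Lemma wedge_atDr a F G G' :
  wedge_at F (a *: G + G') = a *: wedge_at F G + wedge_at F G'.
Proof.
apply/funext => s; rewrite -[RHS]/(a * wedge_at F G s + wedge_at F G' s).
rewrite /wedge_at mulr_sumr -big_split/=; apply: eq_bigr => b _.
by rewrite -[(a *: G + G') _]/(a * G _ + G' _); ring.
Qed.

Lemma wedge_at0l G : wedge_at 0 G = 0.
Proof. by have := wedge_atDl (-1) 0 0 G; rewrite scaler0 addr0 scaleN1r addNr. Qed.

Lemma wedge_at0r F : wedge_at F 0 = 0.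
Proof. by have := wedge_atDr (-1) F 0 0; rewrite scaler0 addr0 scaleN1r addNr. Qed.

Lemma wedge_atNl F G : wedge_at (- F) G = - wedge_at F G.
Proof. by rewrite -scaleN1r -[_ *: F]addr0 wedge_atDl wedge_at0l addr0 scaleN1r. Qed.

Lemma wedge_atNr F G : wedge_at F (- G) = - wedge_at F G.
Proof. by rewrite -scaleN1r -[_ *: G]addr0 wedge_atDr wedge_at0r addr0 scaleN1r. Qed.

Lemma wedge_at_suml I (r : seq I) (P : pred I) (c : I -> R) (F : I -> seq V -> R^o) G :
  wedge_at (\sum_(i <- r | P i) c i *: F i) G =
  \sum_(i <- r | P i) c i *: wedge_at (F i) G.
Proof.
by elim/big_rec2 : _ => [|i _ F' _ <-]; rewrite ?wedge_at0l// wedge_atDl.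
Qed.

Lemma wedge_at_sumr I (r : seq I) (P : pred I) (c : I -> R) F (G : I -> seq V -> R^o) :
  wedge_at F (\sum_(i <- r | P i) c i *: G i) =
  \sum_(i <- r | P i) c i *: wedge_at F (G i).
Proof.
by elim/big_rec2 : _ => [|i _ G' _ <-]; rewrite ?wedge_at0r// wedge_atDr.
Qed.

Lemma gradingK F : grading (grading F) = F.
Proof.
apply/funext => s; rewrite /grading mulrA -exprD addnn -mul2n exprM.
by rewrite sqrrN !expr1n mul1r.
Qed.

Lemma contract_grading v F : contract v (grading F) = - grading (contract v F).
Proof. by apply/funext => s; rewrite /contract/grading/= exprS mulN1r mulNr. Qed.

Lemma wedge_at_degree0 F G s : (forall s', (0 < size s')%N -> F s' = 0) ->
  wedge_at F G s = F [::] * G s.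
Proof.
elim: s F G => [|v s IH] F G F0; first exact: wedge_at_nil.
rewrite wedge_at_cons (_ : contract v F = 0) ?wedge_at0l; last first.
  by apply/funext => s'; rewrite /contract F0.
rewrite add0r IH ?{1}/grading ?expr0 ?mul1r// => s' s0.
by rewrite /grading F0// mulr0.
Qed.

Lemma multilinear_contract v F : multilinear F -> multilinear (contract v F).
Proof. by move=> mF s1 s2 a u w; rewrite /contract -!cat_cons mF. Qed.

Lemma multilinear_grading F : multilinear F -> multilinear (grading F).
Proof.
move=> mF s1 s2 a u w; rewrite /grading mF !size_cat/=; ring.
Qed.

Lemma contract_linear F a u v : multilinear F ->
  contract (a *: u + v) F = a *: contract u F + contract v F.
Proof.
by move=> mF; apply/funext => s; rewrite /contract; have := mF [::] s a u v.
Qed.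

Lemma multilinear_wedge F G : multilinear F -> multilinear G ->
  multilinear (wedge_at F G).
Proof.
move=> + + s1; elim: s1 F G => [|w s1 IH] F G mF mG s2 a u v /=.
  rewrite !wedge_at_cons !contract_linear// wedge_atDl wedge_atDr !fctE.
  by rewrite -![a *: wedge_at _ _ _]/(a * _); ring.
rewrite !wedge_at_cons !IH//; try exact: multilinear_contract.
  ring.
exact: multilinear_grading.
Qed.

Lemma alternating_contract v F : alternating F -> alternating (contract v F).
Proof. by move=> aF s1 s2 u; rewrite /contract -!cat_cons aF. Qed.

Lemma alternating_grading F : alternating F -> alternating (grading F).
Proof. by move=> aF s1 s2 u; rewrite /grading aF mulr0. Qed.

(** Contracting twice with the same vector leaves two mixed terms, which cancel because contraction
    anticommutes with [grading]. *)
Lemma alternating_wedge F G : alternating F -> alternating G ->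
  alternating (wedge_at F G).
Proof.
have contract2 H v : alternating H -> contract v (contract v H) = 0.
  by move=> aH; apply/funext => s; have := aH [::] s v.
move=> + + s1; elim: s1 F G => [|w s1 IH] F G aF aG s2 u /=.
  rewrite !wedge_at_cons !contract2// contract_grading gradingK.
  rewrite wedge_at0l wedge_at0r wedge_atNl.
  set w := wedge_at _ _; rewrite -[LHS]/(0 + w s2 + (- w s2 + 0)).
  by rewrite add0r addr0 subrr.
rewrite wedge_at_cons !IH ?addr0//; try exact: alternating_contract.
exact: alternating_grading.
Qed.

Lemma alternating_swap F s1 s2 u v : multilinear F -> alternating F ->
  F (s1 ++ u :: v :: s2) = - F (s1 ++ v :: u :: s2).
Proof.
move=> mF aF; apply/eqP; rewrite -addr_eq0; apply/eqP.
have E w : F (s1 ++ w :: (1 *: u + v) :: s2) =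
    F (s1 ++ w :: u :: s2) + F (s1 ++ w :: v :: s2).
  by have := mF (s1 ++ [:: w]) s2 1 u v; rewrite -!catA/= mul1r.
by have := aF s1 s2 (1 *: u + v); rewrite mF mul1r !E !aF add0r addr0.
Qed.

Lemma alternating_repeat F s1 s2 s3 v : multilinear F -> alternating F ->
  F (s1 ++ v :: s2 ++ v :: s3) = 0.
Proof.
move=> mF aF; elim: s2 s1 => [|u s2 IH] s1 /=; first exact: aF.
rewrite alternating_swap//; have := IH (s1 ++ [:: u]).
by rewrite -catA /= => ->; rewrite oppr0.
Qed.

Lemma multilinear_sum F s1 s2 I (r : seq I) (c : I -> R) (w : I -> V) :
  multilinear F ->
  F (s1 ++ (\sum_(i <- r) c i *: w i) :: s2) =
  \sum_(i <- r) c i * F (s1 ++ w i :: s2).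
Proof.
move=> mF; elim: r => [|i r IH]; last by rewrite !big_cons mF IH.
have := mF s1 s2 (-1) 0 0; rewrite !big_nil scaler0 addr0 mulN1r addNr.
by [].
Qed.

Lemma contract_swap F u v : multilinear F -> alternating F ->
  contract v (contract u F) = - contract u (contract v F).
Proof.
by move=> mF aF; apply/funext => s; exact: (alternating_swap [::]).
Qed.

End MultilinearFunctions.

Lemma wedge_at_map (R : comNzRingType) (V V' : lmodType R) (h : V -> V')
    (F G : seq V' -> R^o) s :
  wedge_at F G (map h s) =
  wedge_at (fun s => F (map h s)) (fun s => G (map h s)) s.
Proof.
elim: s F G => [|v s IH] F G /=; first by rewrite !wedge_at_nil.
rewrite !wedge_at_cons !IH; congr (_ + wedge_at _ _ s).
by apply/funext => s'; rewrite /grading size_map.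
Qed.

Lemma not_uniqP (T : eqType) (t : seq T) : ~~ uniq t ->
  exists x s1 s2 s3, t = s1 ++ x :: s2 ++ x :: s3.
Proof.
elim: t => //= x t IH; have [/splitPr[s2 s3] _|_ /= /IH[y [s1 [s2 [s3 ->]]]]] := boolP (x \in t).
  by exists x, [::], s2, s3.
by exists y, (x :: s1), s2, s3.
Qed.

(** * Expansion in a basis *)

Section Coordinates.
Context (R : comNzRingType) (m : nat).
Local Notation V := 'rV[R]_m.
Implicit Types (F G : seq V -> R^o) (s : seq V) (v : V).

Definition dir (a : 'I_m) : V := delta_mx 0 a.

Lemma multilinear_coord F s1 s2 v : multilinear F ->
  F (s1 ++ v :: s2) = \sum_a v 0 a * F (s1 ++ dir a :: s2).
Proof. by move=> mF; rewrite {1}[v]row_sum_delta multilinear_sum. Qed.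

Lemma multilinear_eq0 F s : multilinear F ->
  (forall t : seq 'I_m, size t = size s -> F (map dir t) = 0) -> F s = 0.
Proof.
move=> mF.
(* The arguments in front of s are already basis vectors, so that the induction expands one argument
   at a time. *)
suff H t : (forall t' : seq 'I_m, size t' = (size t + size s)%N ->
    F (map dir t') = 0) -> F (map dir t ++ s) = 0.
  exact: (H [::]).
elim: s t => [|v s IH] t H; first by rewrite cats0 H// addn0.
rewrite multilinear_coord// big1// => a _.
have := IH (rcons t a); rewrite map_rcons cat_rcons => ->; rewrite ?mulr0//.
by move=> t' st'; apply: H; rewrite st' size_rcons addSnnS.
Qed.

(** Among more than m basis vectors two coincide. *)
Lemma multilinear_alternating_eq0 F s : multilinear F -> alternating F ->
  (m < size s)%N -> F s = 0.
Proof.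
move=> mF aF ms; apply: multilinear_eq0 => // t ts.
have : ~~ uniq t.
  apply: contraL ms => /card_uniqP; rewrite -ts -leqNgt => <-.
  by rewrite -[X in (_ <= X)%N](card_ord m) max_card.
move=> /not_uniqP[x [s1 [s2 [s3 ->]]]].
by rewrite map_cat/= map_cat/= alternating_repeat.
Qed.

Lemma contract_coord F s : multilinear F ->
  forall v, F (v :: s) = \sum_a v 0 a * contract (dir a) F s.
Proof. by move=> mF v; exact: (multilinear_coord [::]). Qed.

(** The covector dx^a of the dual basis, as a cochain concentrated on lists of length 1. *)
Definition coord_form (a : 'I_m) s : R^o := if s is [:: v] then v 0 a else 0.

(** Euler's identity of exterior algebra. It is the source of the degree in the commutator
    [Lambda, L]. *)
Lemma sum_wedge_contract F s : multilinear F -> alternating F ->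
  \sum_a wedge_at (coord_form a) (contract (dir a) F) s = (size s)%:R * F s.
Proof.
elim: s F => [|v s IH] F mF aF.
  rewrite mul0r big1// => a _; rewrite wedge_at_nil mul0r//.
under eq_bigr => a _.
  rewrite wedge_at_cons (_ : grading (coord_form a) = - coord_form a); last first.
    apply/funext => -[|u [|u' s']]; rewrite /grading/= fctE/=; try ring.
  rewrite contract_swap// wedge_atNl wedge_atNr opprK wedge_at_degree0; last first.
    by case.
  over.
rewrite big_split/= -(contract_coord s mF v) IH; last 2 first.
- exact: multilinear_contract.
- exact: alternating_contract.
by rewrite /contract -natr1 mulrDl mul1r addrC.
Qed.

End Coordinates.

(** * Contraction with a bivector and its commutator with the wedge product *)

Section Contraction.
Context (R : numFieldType) (m : nat).
Local Notation V := 'rV[R]_m.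
Implicit Types (F G om : seq V -> R^o) (s : seq V) (v : V) (W : 'M[R]_m).

(** The factor 1/2 compensates for counting each pair of indices twice. The sign is chosen for W
    inverse to the matrix of the 2-form: the contraction of the 2-form itself is then m/2. *)
Definition dual_contract W F s : R^o :=
  - 2^-1 * \sum_a \sum_b W a b * F (dir R a :: dir R b :: s).

(** Contraction with u and then with v. The signs are those of the degrees 2 and 1, and the double
    contraction of [om] is a constant. *)
Lemma wedge_at_degree2 om F u v s : (forall s, size s != 2 -> om s = 0) ->
  wedge_at om F (u :: v :: s) = om [:: u; v] * F s
    - wedge_at (contract u om) (contract v F) s
    + wedge_at (contract v om) (contract u F) s
    + wedge_at om (contract v (contract u F)) s.
Proof.
move=> om2; rewrite !wedge_at_cons gradingK contract_grading.
have gr w : grading (contract w om) = - contract w om.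
  apply/funext => s'; rewrite /grading /contract fctE.
  have [s1|s1] := eqVneq (size s') 1%N; first by rewrite s1 expr1 mulN1r.
  by rewrite om2 ?mulr0 ?oppr0.
rewrite !gr opprK wedge_atNl fctE wedge_at_degree0 ?addrA// => s' s'0.
by rewrite /contract om2//=; case: s' s'0.
Qed.

(** The commutator comes from the first three terms of [wedge_at_degree2]. The constant one sums to
    the trace -m; the two cross terms are equal by antisymmetry of W, and each is the Euler sum of
    [sum_wedge_contract]. *)
Lemma dual_contract_wedge W om F s : multilinear om ->
  (forall s, size s != 2 -> om s = 0) ->
  (forall u v, om [:: u; v] = - om [:: v; u]) ->
  (forall a b, W a b = - W b a) ->
  (forall a c, \sum_b W a b * om [:: dir R b; dir R c] = (a == c)%:R) ->
  multilinear F -> alternating F ->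
  dual_contract W (wedge_at om F) s =
  wedge_at om (dual_contract W F) s + (m%:R / 2 - (size s)%:R) * F s.
Proof.
move=> mom om2 omN WN Wom mF aF.
(* Being inverse to [om], the matrix W turns the contractions of [om] with basis vectors into the
   dual basis. *)
have sumW a : \sum_b W a b *: contract (dir R b) om = coord_form a.
  apply/funext => s'.
  have [s1|s1] := eqVneq (size s') 1%N; last first.
    rewrite fct_sumE big1 => [|b _]; last first.
      by rewrite fctE /contract om2; [exact: mulr0|exact: s1].
    by case: s' s1 => [|? []].
  case: s' s1 => [|v []]//= _.
  rewrite fct_sumE.
  under eq_bigr => b _.
    rewrite fctE /contract -[_ *: _]/(_ * _).
    rewrite (multilinear_coord [:: dir R b] [::] v mom)/= mulr_sumr.
    under eq_bigr do rewrite mulrCA.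
    over.
  rewrite exchange_big/=; under eq_bigr do rewrite -mulr_sumr Wom.
  rewrite (bigD1 a)//= eqxx mulr1 big1 ?addr0// => c ca.
  by rewrite eq_sym (negbTE ca) mulr0.
have S1 : \sum_a \sum_b W a b * om [:: dir R a; dir R b] = - m%:R.
  under eq_bigr => a _ do under eq_bigr => b _ do rewrite omN mulrN.
  under eq_bigr => a _ do rewrite sumrN Wom eqxx.
  by rewrite sumrN sumr_const card_ord.
have S2 : \sum_a \sum_b W a b *
    wedge_at (contract (dir R b) om) (contract (dir R a) F) s = (size s)%:R * F s.
  rewrite -(sum_wedge_contract s mF aF); apply: eq_bigr => a _.
  by rewrite -sumW wedge_at_suml fct_sumE.
have S3 : \sum_a \sum_b W a b *
    wedge_at (contract (dir R a) om) (contract (dir R b) F) s = - ((size s)%:R * F s).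
  rewrite exchange_big/= -S2 -sumrN; apply: eq_bigr => a _.
  by rewrite -sumrN; apply: eq_bigr => b _; rewrite WN mulNr.
have S4 : wedge_at om (dual_contract W F) s = - 2^-1 * \sum_a \sum_b W a b *
    wedge_at om (contract (dir R b) (contract (dir R a) F)) s.
  have -> : dual_contract W F = - 2^-1 *: \sum_a \sum_b W a b *:
      contract (dir R b) (contract (dir R a) F).
    apply/funext => s'; rewrite /dual_contract fctE fct_sumE; congr (_ * _).
    by apply: eq_bigr => a _; rewrite fct_sumE.
  rewrite -[_ *: _]addr0 wedge_atDr wedge_at0r addr0 fctE; congr (_ * _).
  under eq_bigr do rewrite -[\sum_b _]scale1r.
  rewrite wedge_at_sumr fct_sumE; apply: eq_bigr => a _.
  by rewrite scale1r wedge_at_sumr fct_sumE.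
rewrite S4 /dual_contract.
under eq_bigr => a _ do under eq_bigr => b _ do
  rewrite wedge_at_degree2// !mulrDr mulrN mulrA.
under eq_bigr => a _ do rewrite !big_split/= sumrN -mulr_suml.
rewrite !big_split/= sumrN -mulr_suml S1 S2 S3.
by field.
Qed.

End Contraction.

(** * Smooth functions *)

Section Smoothness.
Context (R : realType) (V : normedModType R).

Lemma near_eq_differentiable (W : normedModType R) (f g : V -> W) (x : V) :
  (\near x, f x = g x) -> differentiable f x -> differentiable g x.
Proof.
move=> fg df; have [cf /eqaddoP ef] := (diff_locallyP _ _).1 df.
have dgf : g \o shift x = cst (g x) + 'd f x +o_ 0 id.
  apply/eqaddoP => e e0; have := ef e e0.
  have fgx : f x = g x by exact: nbhs_singleton fg.
  have fg' : \forall h \near 0, f (h + x) = g (h + x).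
    by move: fg; rewrite (near_shift 0 x) subr0.
  by apply: filterS2 fg' => h fgh; rewrite /= !fctE /= fgh fgx.
apply/diff_locallyP; rewrite (diff_unique cf dgf); split => //.
Qed.

Lemma near_open_eq (W : Type) (U : set V) (f g : V -> W) (x : V) : open U -> U x ->
  (forall y, U y -> f y = g y) -> \near x, f x = g x.
Proof. by move=> oU Ux fg; near=> y; apply: fg; near: y; exact: open_nbhs_nbhs. Unshelve. all: by end_near. Qed.

(** Directional derivatives as derivatives in one variable, the form required by the mean value
    theorem. *)
Lemma derive_line (W : normedModType R) (f : V -> W) (y v : V) (r : R) :
  differentiable f (y + r *: v) ->
  is_derive r 1 (fun s => f (y + s *: v)) ('D_v f (y + r *: v)).
Proof.
move=> df; have dv : derivable f (y + r *: v) v by exact: diff_derivable.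
have E : (fun h => h^-1 *: (((fun s => f (y + s *: v)) \o shift r) (h *: 1) - f (y + r *: v))) =
  (fun h => h^-1 *: ((f \o shift (y + r *: v)) (h *: v) - f (y + r *: v))).
  apply/funext => h /=; rewrite [h *: 1]mulr1 scalerDl addrA.
  by rewrite [y + h *: v]addrC -addrA.
by split; rewrite /derivable ?/derive E.
Qed.

End Smoothness.

(** * Symmetry of second derivatives *)

Section Schwarz.
Context (R : realType) (V : normedModType R).
Implicit Types (f : V -> R) (U : set V).

(** The mean value theorem is applied in the direction v to the difference in the direction w, and
    then in the direction w to the derivative along v. *)
Lemma second_difference f U (x v w : V) (t : R) : 0 < t ->
  (forall a b, 0 <= a <= t -> 0 <= b <= t -> U (x + a *: v + b *: w)) ->
  Ck_on 2 U f ->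
  exists a b, [/\ 0 <= a <= t, 0 <= b <= t &
    f (x + t *: v + t *: w) - f (x + t *: v) - f (x + t *: w) + f x =
    t * t * 'D_w ('D_v f) (x + a *: v + b *: w)].
Proof.
move=> t0 HU [df /(_ v)[ddf _]].
have tt : 0 <= t <= t by rewrite lexx ltW.
have t00 : 0 <= (0 : R) <= t by rewrite lexx ltW.
pose g s := f ((x + t *: w) + s *: v) - f (x + s *: v).
have HU1 s : 0 <= s <= t -> U (x + t *: w + s *: v).
  by move=> st; rewrite addrAC; exact: HU.
have HU0 s : 0 <= s <= t -> U (x + s *: v).
  by move=> st; have := HU s 0 st t00; rewrite scale0r addr0.
have dg s : 0 <= s <= t ->
    is_derive s 1 g ('D_v f (x + t *: w + s *: v) - 'D_v f (x + s *: v)).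
  move=> st; apply: is_deriveB.
    by apply: derive_line; apply: df; exact: HU1.
  by apply: derive_line; apply: df; exact: HU0.
have [|||a /[!in_itv]/= ait gE] := @MVT R g
   (fun s => 'D_v f (x + t *: w + s *: v) - 'D_v f (x + s *: v)) 0 t.
- exact: t0.
- by move=> s /[!in_itv]/= /andP[s0 st]; apply: dg; rewrite !ltW.
- apply: derivable_within_continuous => s /[!in_itv]/= st.
  by have [] := dg s st.
have at' : 0 <= a <= t by case/andP : ait => a0 at'; rewrite !ltW.
pose h s := 'D_v f (x + a *: v + s *: w).
have dh s : 0 <= s <= t -> is_derive s 1 h ('D_w ('D_v f) (x + a *: v + s *: w)).
  by move=> st; apply: derive_line; apply: ddf; exact: HU.
have [|||b /[!in_itv]/= bit hE] := @MVT R h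
   (fun s => 'D_w ('D_v f) (x + a *: v + s *: w)) 0 t.
- exact: t0.
- by move=> s /[!in_itv]/= /andP[s0 st]; apply: dh; rewrite !ltW.
- apply: derivable_within_continuous => s /[!in_itv]/= st.
  by have [] := dh s st.
exists a, b; split=> //.
  by case/andP : bit => b0 bt; rewrite !ltW.
move: gE hE; rewrite /g /h !scale0r !addr0 !subr0 => gE hE.
rewrite -mulrA [t * (_ * _)]mulrC [t * 'D_w _ _]mulrC -hE [x + a *: v + _]addrAC -gE.
rewrite [x + t *: w + t *: v]addrAC; ring.
Qed.

Lemma continuous_pair_ball U (x : V) (g h : V -> R) (e : R) : open U -> U x ->
  {for x, continuous g} -> {for x, continuous h} -> 0 < e ->
  exists2 r : R, 0 < r & forall y, `|x - y| < r ->
    [/\ U y, `|g x - g y| < e & `|h x - h y| < e].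
Proof.
move=> oU Ux cg ch e0.
have : \forall y \near x, [/\ U y, `|g x - g y| < e & `|h x - h y| < e].
  near=> y; split.
  - by near: y; exact: open_nbhs_nbhs.
  - by near: y; move/cvgrPdist_lt : cg => /(_ _ e0).
  - by near: y; move/cvgrPdist_lt : ch => /(_ _ e0).
by move=> /nbhs_normP[r /= r0 Hr]; exists r.
Unshelve. all: by end_near. Qed.

Lemma eq_of_second_difference U (x v w : V) (D : R -> R) (g h : V -> R) :
  open U -> U x -> {for x, continuous g} -> {for x, continuous h} ->
  (forall t, 0 < t ->
    (forall a b, 0 <= a <= t -> 0 <= b <= t -> U (x + a *: v + b *: w)) ->
    exists a b, [/\ 0 <= a <= t, 0 <= b <= t &
      D t = t * t * g (x + a *: v + b *: w)]) ->
  (forall t, 0 < t ->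
    (forall a b, 0 <= a <= t -> 0 <= b <= t -> U (x + a *: w + b *: v)) ->
    exists a b, [/\ 0 <= a <= t, 0 <= b <= t &
      D t = t * t * h (x + a *: w + b *: v)]) ->
  g x = h x.
Proof.
move=> oU Ux cg ch Dg Dh; apply/eqP; rewrite -subr_eq0 -normr_le0.
apply/ler_addgt0Pr => e e0; rewrite add0r.
have e2 : 0 < e / 2 by rewrite divr_gt0.
have [r r0 Hr] := continuous_pair_ball oU Ux cg ch e2.
(* With this t the whole parallelogram of sides t v and t w at x lies in the ball of radius r; the
   summand 1 keeps the denominator positive when v = w = 0. *)
pose t := r / 2 / (1 + `|v| + `|w|).
have den : 0 < 1 + `|v| + `|w| by rewrite -addrA ltr_wpDr ?addr_ge0.
have t0 : 0 < t by rewrite !divr_gt0.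
have near_x a b : 0 <= a <= t -> 0 <= b <= t ->
    `|x - (x + a *: v + b *: w)| < r.
  move=> /andP[a0 at'] /andP[b0 bt].
  rewrite -addrA opprD addrA subrr add0r normrN.
  apply: (@le_lt_trans _ _ (t * (1 + `|v| + `|w|))); last first.
    by rewrite /t divfK ?gt_eqF// ltr_pdivrMr// ltr_pMr// ltr1n.
  apply: le_trans (ler_normD _ _) _; rewrite !normrZ !ger0_norm// !mulrDr mulr1.
  by rewrite -addrA ler_wpDl ?(ltW t0)// lerD// ler_wpM2r.
have [a b at' bt|a [b [at' bt E1]]] := Dg t t0.
  by have [] := Hr _ (near_x a b at' bt).
have [a' b' at1 bt1|a' [b' [at1 bt1 E2]]] := Dh t t0.
  by rewrite addrAC; have [] := Hr _ (near_x b' a' bt1 at1).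
have tt : t * t != 0 by rewrite mulf_neq0 ?gt_eqF.
rewrite addrAC in E2.
have E : g (x + a *: v + b *: w) = h (x + b' *: v + a' *: w).
  by apply: (mulfI tt); rewrite -E1.
have [_ A _] := Hr _ (near_x _ _ at' bt).
have [_ _ B] := Hr _ (near_x _ _ bt1 at1).
rewrite -(subrKA (g (x + a *: v + b *: w))) (le_trans (ler_normD _ _))//.
by rewrite [e]splitr ltW// ltrD// E distrC.
Qed.

(** The second difference is symmetric in v and w, and divided by t^2 it approximates either mixed
    derivative. *)
Lemma derive_comm f U (x v w : V) : open U -> U x -> Ck_on 2 U f ->
  'D_v ('D_w f) x = 'D_w ('D_v f) x.
Proof.
move=> oU Ux C2f.
have cvw : {for x, continuous ('D_v ('D_w f))} by have [_ /(_ w)[_ /(_ v)]] := C2f; apply.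
have cwv : {for x, continuous ('D_w ('D_v f))} by have [_ /(_ v)[_ /(_ w)]] := C2f; apply.
apply: (eq_of_second_difference (v := w) (w := v) (D := fun t =>
  f (x + t *: w + t *: v) - f (x + t *: w) - f (x + t *: v) + f x) oU Ux cvw cwv).
  by move=> t t0 HU; exact: (second_difference t0 HU C2f).
move=> t t0 HU; have [a [b [a' b' E]]] := second_difference t0 HU C2f.
exists a, b; split=> //; rewrite -E [x + t *: w + _]addrAC.
ring.
Qed.

End Schwarz.

(** * Closure properties of smooth functions *)

Section Ck.
Context (R : realType) (V : normedModType R) (U : set V) (oU : open U).

Lemma Ck_onW (W : normedModType R) k (f : V -> W) : Ck_on k.+1 U f -> Ck_on k U f.
Proof.
elim: k f => [|k IH] f [df ddf].
  by move=> x /df; exact: differentiable_continuous.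
by split=> // v; apply: IH; exact: ddf.
Qed.

Lemma Ck_on_ext (W : normedModType R) k (f g : V -> W) :
  (forall x, U x -> f x = g x) -> Ck_on k U f -> Ck_on k U g.
Proof.
elim: k f g => [|k IH] f g fg /=.
  move=> cf x Ux; have : f @ x --> f x by exact: cf.
  rewrite (fg _ Ux); apply: cvg_trans.
  by apply: near_eq_cvg; exact: near_open_eq fg.
move=> [df ddf]; split=> [x Ux|v].
  by apply: near_eq_differentiable (df x Ux); exact: near_open_eq fg.
apply: (IH _ _ _ (ddf v)) => x Ux; apply: near_eq_derive.
exact: near_open_eq fg.
Qed.

Lemma Ck_on_cst (W : normedModType R) k (c : W) : Ck_on k U (cst c).
Proof.
elim: k c => [|k IH] c /=; first by move=> x _; exact: cst_continuous.
split=> [x _|v]; first exact: differentiable_cst.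
rewrite (_ : 'D_v (cst c) = cst 0); first exact: IH.
by apply/funext => x; rewrite derive_cst.
Qed.

Lemma Ck_on_linear (W : normedModType R) k (a : R) (f g : V -> W) :
  Ck_on k U f -> Ck_on k U g -> Ck_on k U (a *: f + g).
Proof.
elim: k f g => [|k IH] f g /=.
  move=> cf cg x Ux; apply: continuousD; last exact: cg.
  by apply: continuousZr; exact: cf.
move=> [df ddf] [dg ddg]; split=> [x Ux|v].
  apply: differentiableD; last exact: dg.
  by apply: differentiableZ; exact: df.
apply: Ck_on_ext (IH _ _ (ddf v) (ddg v)) => x Ux.
rewrite deriveD; [|by apply/derivableZ/diff_derivable; exact: df|exact/diff_derivable/dg].
by rewrite deriveZ//; exact/diff_derivable/df.
Qed.

Lemma Ck_onM k (f g : V -> R) :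
  Ck_on k U f -> Ck_on k U g -> Ck_on k U (f * g).
Proof.
elim: k f g => [|k IH] f g.
  by move=> cf cg x Ux; apply: continuousM; [exact: cf|exact: cg].
move=> Cf Cg; have /= [df ddf] := Cf; have /= [dg ddg] := Cg.
split=> [x Ux|v]; first by apply: differentiableM; [exact: df|exact: dg].
apply: Ck_on_ext (Ck_on_linear 1 (IH _ _ (Ck_onW Cf) (ddg v)) (IH _ _ (Ck_onW Cg) (ddf v))).
move=> x Ux; rewrite deriveM; [|exact/diff_derivable/df|exact/diff_derivable/dg].
by rewrite scale1r.
Qed.

Lemma Ck_onV k (f : V -> R) : (forall x, U x -> f x != 0) ->
  Ck_on k U f -> Ck_on k U (fun x => (f x)^-1).
Proof.
move=> f0; elim: k => [|k IH].
  by move=> cf x Ux; apply: continuousV; [exact: f0|exact: cf].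
move=> Cf; have /= [df ddf] := Cf.
split=> [x Ux|v]; first by apply: differentiableV; [exact: df|exact: f0].
have Cf' := IH (Ck_onW Cf).
have C0 := @Ck_on_cst _ k (0 : R).
apply: Ck_on_ext (Ck_on_linear (-1) (Ck_onM (Ck_onM Cf' Cf') (ddf v)) C0).
move=> x Ux; rewrite deriveV; [|exact: f0|exact/diff_derivable/df].
rewrite scaleN1r addr0 !fctE -[_ *: _]/(_ * _) -exprVn expr2.
by rewrite mulNr.
Qed.

Lemma Ck_on_mx m n k (f : V -> 'M[R]_(m, n)) i j :
  Ck_on k U f -> Ck_on k U (fun x => f x i j : R).
Proof.
elim: k f => [|k IH] f /=.
  move=> cf x Ux; apply: (@continuous_comp _ _ _ f (fun N : 'M[R]_(_, _) => N i j)).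
    exact: cf.
  exact: (differentiable_continuous (@differentiable_coord R m n (f x) i j)).
move=> [df ddf]; split=> [x Ux|v].
  apply: (@differentiable_comp _ _ _ _ f (fun N : 'M[R]_(_, _) => N i j)).
    exact: df.
  exact: differentiable_coord.
apply: Ck_on_ext (IH _ (ddf v)) => x Ux.
by rewrite derive_mx ?mxE//; exact/diff_derivable/df.
Qed.

Lemma smooth_on_derive (W : normedModType R) (f : V -> W) v :
  smooth_on U f -> smooth_on U ('D_v f).
Proof. by move=> sf k; have [_] := sf k.+1; apply. Qed.

Lemma smooth_on_differentiable (W : normedModType R) (f : V -> W) x :
  smooth_on U f -> U x -> differentiable f x.
Proof. by move=> sf Ux; have [+ _] := sf 1%N; apply. Qed.

Lemma smooth_on_ext (W : normedModType R) (f g : V -> W) :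
  (forall x, U x -> f x = g x) -> smooth_on U f -> smooth_on U g.
Proof. by move=> fg sf k; exact: Ck_on_ext fg (sf k). Qed.

Lemma smooth_on_cst (W : normedModType R) (c : W) : smooth_on U (fun=> c).
Proof. by move=> k; exact: Ck_on_cst. Qed.

Lemma smooth_on_linear (W : normedModType R) a (f g : V -> W) :
  smooth_on U f -> smooth_on U g -> smooth_on U (a *: f + g).
Proof. by move=> sf sg k; exact: Ck_on_linear. Qed.

Lemma smooth_onD (W : normedModType R) (f g : V -> W) :
  smooth_on U f -> smooth_on U g -> smooth_on U (fun x => f x + g x).
Proof. by move=> sf sg; have := smooth_on_linear 1 sf sg; rewrite scale1r. Qed.

Lemma smooth_on_sum (W : normedModType R) I (r : seq I) (P : pred I)
    (f : I -> V -> W) : (forall i, P i -> smooth_on U (f i)) ->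
  smooth_on U (fun x => \sum_(i <- r | P i) f i x).
Proof.
move=> sf; rewrite (_ : (fun x => _) = \sum_(i <- r | P i) f i); last first.
  by apply/funext => x; rewrite fct_sumE.
elim/big_ind : _ => //; first exact: smooth_on_cst.
by move=> g h; exact: smooth_onD.
Qed.

Lemma smooth_onM (f g : V -> R) :
  smooth_on U f -> smooth_on U g -> smooth_on U (fun x => f x * g x).
Proof. by move=> sf sg k; exact: Ck_onM. Qed.

Lemma smooth_onV (f : V -> R) : (forall x, U x -> f x != 0) ->
  smooth_on U f -> smooth_on U (fun x => (f x)^-1).
Proof. by move=> f0 sf k; exact: Ck_onV. Qed.

Lemma smooth_on_prod I (r : seq I) (P : pred I)
    (f : I -> V -> R) : (forall i, P i -> smooth_on U (f i)) ->
  smooth_on U (fun x => \prod_(i <- r | P i) f i x).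
Proof.
move=> sf; elim: r => [|i r IH].
  by under eq_fun do rewrite big_nil; exact: smooth_on_cst.
under eq_fun do rewrite big_cons.
have [Pi|nPi] := boolP (P i); last exact: IH.
by apply: smooth_onM IH; exact: sf.
Qed.

Lemma smooth_on_det n (A : V -> 'M[R]_n) :
  (forall i j, smooth_on U (fun x => A x i j)) ->
  smooth_on U (fun x => \det (A x)).
Proof.
move=> sA; apply: smooth_on_sum => s _; apply: smooth_onM.
  exact: smooth_on_cst.
by apply: smooth_on_prod => i _.
Qed.

(** By Cramer's formula. This is what makes Lambda preserve smoothness. *)
Lemma smooth_on_invmx n (A : V -> 'M[R]_n) :
  (forall x, U x -> A x \in unitmx) ->
  (forall i j, smooth_on U (fun x => A x i j)) ->
  forall i j, smooth_on U (fun x => invmx (A x) i j).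
Proof.
move=> uA sA i j.
have : smooth_on U (fun x => (\det (A x))^-1 * (\adj (A x)) i j).
  apply: smooth_onM.
    apply: smooth_onV; last exact: smooth_on_det.
    by move=> x /uA; rewrite unitmxE unitfE.
  under eq_fun do rewrite mxE /cofactor.
  apply: smooth_onM; first exact: smooth_on_cst.
  apply: smooth_on_det => i' j'.
  apply: smooth_on_ext (sA (lift j i') (lift i j')) => x _.
  by rewrite !mxE.
apply: smooth_on_ext => x Ux.
by rewrite /invmx (uA _ Ux) [RHS]mxE.
Qed.

End Ck.

(** * Exterior derivative *)

Section AlternatingSums.
Context (R : comNzRingType) (V : lmodType R).
Implicit Types (g : V -> seq V -> R^o) (s : seq V) (v : V).

(** The shape of the exterior derivative, with an arbitrary [g] in place of the directional
    derivative: the second-derivative terms of a pullback are sums of the same shape. *)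
Definition altsum g s : R^o :=
  \sum_(a < size s) (-1) ^+ a * g s`_a (take a s ++ drop a.+1 s).

Lemma altsum_cons g v s :
  altsum g (v :: s) = g v s - altsum (fun u s' => g u (v :: s')) s.
Proof.
rewrite /altsum big_ord_recl/= drop0 mul1r; congr (_ + _).
by rewrite -sumrN; apply: eq_bigr => a _; rewrite /= exprS mulN1r mulNr.
Qed.

Lemma altsum_nil g : altsum g [::] = 0.
Proof. by rewrite /altsum big_ord0. Qed.

Lemma eq_altsum g h s : (forall u s', (size s').+1 = size s -> g u s' = h u s') ->
  altsum g s = altsum h s.
Proof.
elim: s g h => [|v s IH] g h gh; first by rewrite !altsum_nil.
rewrite !altsum_cons gh//; congr (_ - _); apply: IH => u s' s's.
by rewrite gh//= s's.
Qed.

Lemma altsum_linear a g h s : altsum (fun u s' => a * g u s' + h u s') s =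
  a * altsum g s + altsum h s.
Proof.
rewrite /altsum mulr_sumr -big_split/=; apply: eq_bigr => i _; ring.
Qed.

Lemma altsumD g h s : altsum (fun u s' => g u s' + h u s') s =
  altsum g s + altsum h s.
Proof.
by rewrite -[altsum g s]mul1r -altsum_linear; apply: eq_altsum => u s' _; rewrite mul1r.
Qed.

End AlternatingSums.

Section ExteriorDerivative.
Context (R : realType) (V : normedModType R).
Implicit Types (al be : V -> seq V -> R^o) (x v : V) (s : seq V) (U : set V).

Definition exterior al x s : R^o :=
  altsum (fun v s' => 'D_v (fun y => al y s') x) s.

Lemma exterior_cons al x v s : exterior al x (v :: s) =
  'D_v (fun y => al y s) x - exterior (fun y => contract v (al y)) x s.
Proof. exact: altsum_cons. Qed.

Lemma exterior_nil al x : exterior al x [::] = 0.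
Proof. exact: altsum_nil. Qed.

Definition differentiable_form al x :=
  forall s, differentiable (fun y => al y s) x.

Lemma derive_lin (f g : V -> R) (a : R) x v :
  differentiable f x -> differentiable g x ->
  'D_v (fun y => a * f y + g y) x = a * 'D_v f x + 'D_v g x.
Proof.
move=> df dg; rewrite -[LHS]/('D_v (a *: f + g) x) deriveD.
- by rewrite deriveZ//; exact: diff_derivable.
- exact/derivableZ/diff_derivable.
- exact: diff_derivable.
Qed.

Lemma exterior_linear a al be x s : differentiable_form al x -> differentiable_form be x ->
  exterior (fun y s => a * al y s + be y s) x s =
  a * exterior al x s + exterior be x s.
Proof.
move=> dal dbe; rewrite /exterior -altsum_linear; apply: eq_altsum => u s' _.
exact: derive_lin.
Qed.

Lemma eq_exterior U al be x s : open U -> U x ->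
  (forall y s', U y -> (size s').+1 = size s -> al y s' = be y s') ->
  exterior al x s = exterior be x s.
Proof.
move=> oU Ux ab; apply: eq_altsum => u s' s's; apply: near_eq_derive.
by apply: (near_open_eq oU Ux) => y Uy; exact: ab.
Qed.

Lemma exterior0 x s : exterior (fun _ _ => 0) x s = 0.
Proof.
rewrite /exterior /altsum big1// => a _.
by rewrite -[fun=> 0]/(cst 0) derive_cst mulr0.
Qed.

Lemma differentiable_contract al x v : differentiable_form al x ->
  differentiable_form (fun y => contract v (al y)) x.
Proof. by move=> dal s; exact: dal. Qed.

Lemma multilinear_exterior al x : (forall y, multilinear (al y)) ->
  differentiable_form al x -> multilinear (exterior al x).
Proof.
move=> + + s1; elim: s1 al => [|w s1 IH] al mal dal s2 a u v /=.
  rewrite !exterior_cons (_ : (fun y => contract (a *: u + v) (al y)) =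
    fun y s => a * contract u (al y) s + contract v (al y) s); last first.
    by apply/funext => y; rewrite contract_linear.
  rewrite exterior_linear; try exact: differentiable_contract.
  by rewrite !deriveE// linearP/= -[a *: _]/(a * _); ring.
rewrite !exterior_cons IH; last 2 first.
- by move=> y; exact: multilinear_contract.
- exact: differentiable_contract.
by under eq_fun do rewrite mal; rewrite derive_lin//; ring.
Qed.

(** Cartan's formula used twice with the same v produces the same derivative with opposite signs,
    and d of a double contraction, which is 0. *)
Lemma alternating_exterior al x : (forall y, alternating (al y)) ->
  alternating (exterior al x).
Proof.
move=> + s1; elim: s1 al => [|w s1 IH] al aal s2 v /=.
  rewrite !exterior_cons [X in _ - (_ - X)](_ : _ = 0) ?subr0 ?subrr//.
  rewrite -(exterior0 x s2); congr (exterior _ x s2).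
  by apply/funext => y; apply/funext => s; have := aal y [::] s v.
rewrite exterior_cons IH; last by move=> y; exact: alternating_contract.
by under eq_fun do rewrite aal; rewrite -[fun=> 0]/(cst 0) derive_cst subr0.
Qed.

Lemma exterior_eq0 al x s :
  (forall y s', (size s').+1 = size s -> al y s' = 0) -> exterior al x s = 0.
Proof.
move=> al0; rewrite -(exterior0 x s).
by apply: (eq_exterior openT) => // y s' _; exact: al0.
Qed.

Section Smooth.
Variables (U : set V) (oU : open U).

Definition smooth_form al := forall s, smooth_on U (fun y => al y s).

Lemma smooth_form_differentiable al x : smooth_form al -> U x ->
  differentiable_form al x.
Proof. by move=> sal Ux s; exact: smooth_on_differentiable (sal s) Ux. Qed.

Lemma smooth_contract al v : smooth_form al ->
  smooth_form (fun y => contract v (al y)).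
Proof. by move=> sal s; exact: sal. Qed.

Lemma smooth_exterior al : smooth_form al -> smooth_form (exterior al).
Proof.
move=> sal s; apply: smooth_on_sum => // a _; apply: smooth_onM => //.
  exact: smooth_on_cst.
exact: smooth_on_derive (sal _).
Qed.

Lemma smooth_derive al v : smooth_form al ->
  smooth_form (fun y s => 'D_v (fun z => al z s) y).
Proof. by move=> sal s; exact: smooth_on_derive (sal s). Qed.

(** The induction step is the symmetry of second derivatives. *)
Lemma derive_exterior al x v s : smooth_form al -> U x ->
  'D_v (fun y => exterior al y s) x =
  exterior (fun y s => 'D_v (fun z => al z s) y) x s.
Proof.
elim: s al => [|u s IH] al sal Ux.
  under eq_fun do rewrite exterior_nil.
  by rewrite -[fun=> 0]/(cst 0) derive_cst exterior_nil.
have scal := smooth_contract u sal.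
have du := smooth_on_derive u (sal s).
rewrite exterior_cons -IH// (derive_comm u v oU Ux (sal s 2%N)).
transitivity ('D_v (fun y => -1 * exterior (fun y => contract u (al y)) y s
  + 'D_u (fun z => al z s) y) x).
  by congr ('D_v _ x); apply/funext => y; rewrite exterior_cons mulN1r addrC.
rewrite derive_lin.
- by rewrite mulN1r addrC.
- exact: (smooth_form_differentiable (smooth_exterior scal)).
- exact: smooth_on_differentiable du Ux.
Qed.

(** By Cartan's formula i_v d d = D_v d - d (D_v - d i_v). Here D_v commutes with d, and d d i_v
    vanishes by induction. *)
Lemma exterior_exterior al x s : smooth_form al -> U x ->
  exterior (exterior al) x s = 0.
Proof.
elim: s al => [|v s IH] al sal Ux; first exact: exterior_nil.
rewrite exterior_cons derive_exterior//.
have scal := smooth_contract v sal.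
rewrite [X in _ - X](_ : _ = exterior (fun y s => -1 * exterior (fun y => contract v (al y)) y s
   + 'D_v (fun z => al z s) y) x s).
  rewrite exterior_linear; last 2 first.
  - exact: (smooth_form_differentiable (smooth_exterior scal)).
  - exact: (smooth_form_differentiable (smooth_derive v sal)).
  by rewrite IH// mulr0 add0r subrr.
congr (exterior _ x s); apply/funext => y; apply/funext => s'.
by rewrite /contract exterior_cons mulN1r addrC.
Qed.

End Smooth.

Lemma differentiable_wedge al be x : differentiable_form al x ->
  differentiable_form be x ->
  differentiable_form (fun y => wedge_at (al y) (be y)) x.
Proof.
move=> dal dbe s; rewrite (_ : (fun y => _) = \sum_(b : (size s).-tuple bool)
  (-1) ^+ inversions b *: ((fun y => al y (mask b s)) * (fun y => be y (mask (map negb b) s)))).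
  elim/big_ind : _ => [|f g|b _]; first exact: differentiable_cst.
    exact: differentiableD.
  by apply: differentiableZ; apply: differentiableM.
by apply/funext => y; rewrite fct_sumE.
Qed.

Lemma derive_wedge al be x v s : differentiable_form al x ->
  differentiable_form be x ->
  'D_v (fun y => wedge_at (al y) (be y) s) x =
  wedge_at (fun s => 'D_v (fun y => al y s) x) (be x) s +
  wedge_at (al x) (fun s => 'D_v (fun y => be y s) x) s.
Proof.
elim: s al be => [|u s IH] al be dal dbe.
  under eq_fun do rewrite wedge_at_nil.
  rewrite !wedge_at_nil -[LHS]/('D_v ((fun y => al y [::]) * (fun y => be y [::])) x).
  rewrite deriveM; try exact: diff_derivable.
  by rewrite -![_ *: _]/(_ * _); ring.
have dcal := differentiable_contract u dal.
have dcbe := differentiable_contract u dbe.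
have dgal : differentiable_form (fun y => grading (al y)) x.
  by move=> s'; exact: differentiableZ.
under eq_fun do rewrite wedge_at_cons -[wedge_at (contract u _) _ _]mul1r.
rewrite derive_lin; try exact: differentiable_wedge.
rewrite mul1r !IH// !wedge_at_cons.
rewrite [X in wedge_at X (contract u (be x)) s + _](_ : _ =
   grading (fun s0 => 'D_v (fun y => al y s0) x)); first by ring.
apply/funext => s'; rewrite /grading.
rewrite -[LHS]/('D_v ((-1) ^+ size s' *: (fun y => al y s')) x) deriveZ//.
exact: diff_derivable.
Qed.

Lemma exterior_grading al x s : differentiable_form al x ->
  exterior (fun y => grading (al y)) x s = - grading (exterior al x) s.
Proof.
move=> dal; have := altsum_linear (- (-1) ^+ size s)
  (fun v s' => 'D_v (fun y => al y s') x) (fun _ _ => 0) s.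
rewrite {3}/altsum [X in _ + X]big1 => [|a _]; last by rewrite mulr0.
rewrite addr0 mulNr => <-; apply: eq_altsum => u s' <-.
rewrite addr0 exprS mulN1r opprK /grading.
rewrite -[LHS]/('D_u ((-1) ^+ size s' *: (fun y => al y s')) x) deriveZ//.
exact: diff_derivable.
Qed.

(** Both sides are compared after contraction with the first vector: [grading] anticommutes with
    contraction and with d, which matches the minus sign in Cartan's formula. *)
Lemma exterior_wedge al be x s : differentiable_form al x ->
  differentiable_form be x ->
  exterior (fun y => wedge_at (al y) (be y)) x s =
  wedge_at (exterior al x) (be x) s +
  wedge_at (grading (al x)) (exterior be x) s.
Proof.
have contrE (ga : V -> seq V -> R^o) u : contract u (exterior ga x) =
    -1 *: exterior (fun y => contract u (ga y)) x + (fun s => 'D_u (fun y => ga y s) x).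
  apply/funext => s'; rewrite /contract exterior_cons addrC; congr (_ + _).
  by rewrite -[RHS]/(-1 * _) mulN1r.
elim: s al be => [|u s IH] al be dal dbe.
  by rewrite !wedge_at_nil !exterior_nil mul0r mulr0 addr0.
have dcal := differentiable_contract u dal.
have dcbe := differentiable_contract u dbe.
have dgal : differentiable_form (fun y => grading (al y)) x.
  by move=> s'; exact: differentiableZ.
rewrite exterior_cons derive_wedge//.
rewrite (_ : (fun y => contract u (wedge_at (al y) (be y))) =
  fun y s => 1 * wedge_at (contract u (al y)) (be y) s +
    wedge_at (grading (al y)) (contract u (be y)) s); last first.
  apply/funext => y; apply/funext => s'.
  by rewrite /contract wedge_at_cons mul1r.
rewrite (exterior_linear 1 s (differentiable_wedge dcal dbe) (differentiable_wedge dgal dcbe)).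
rewrite (IH _ _ dcal dbe) (IH _ _ dgal dcbe) gradingK !wedge_at_cons gradingK contract_grading.
rewrite !contrE wedge_atDl wedge_atDr wedge_atNl.
have -> : exterior (fun y => grading (al y)) x = - grading (exterior al x).
  by apply/funext => s'; rewrite exterior_grading.
rewrite wedge_atNl !fctE -![_ *: _]/(_ * _); ring.
Qed.

End ExteriorDerivative.

(** * Pullbacks and naturality of the exterior derivative *)

Section Substitution.
Context (R : comNzRingType) (V W : lmodType R).
Implicit Types (J T : V -> W) (F : seq W -> R^o) (s : seq V).

(** The sum over all positions of F applied to the J-images, with J replaced by T at that position:
    the product rule when T is the derivative of J. *)
Fixpoint replace_sum J T F s : R^o :=
  if s is v :: s' then F (T v :: map J s') + replace_sum J T (contract (J v) F) s'
  else 0.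

Lemma altsum_map J (g : W -> seq W -> R^o) s :
  altsum g (map J s) = altsum (fun u s' => g (J u) (map J s')) s.
Proof.
elim: s g => [|v s IH] g; first by rewrite !altsum_nil.
by rewrite /= !altsum_cons IH.
Qed.

Lemma replace_sum_linear J T a F F' s :
  replace_sum J T (a *: F + F') s = a * replace_sum J T F s + replace_sum J T F' s.
Proof.
elim: s F F' => [|v s IH] F F' /=; first by rewrite mulr0 addr0.
rewrite -[contract _ _]/(a *: contract (J v) F + contract (J v) F') IH.
by rewrite -[(_ + _) (_ :: _)]/(a * F _ + F' _); ring.
Qed.

Lemma replace_sum0 J T s : replace_sum J T 0 s = 0.
Proof.
have := replace_sum_linear J T (-1) 0 0 s; rewrite scaler0 addr0 mulN1r => ->.
by rewrite addNr.
Qed.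

Lemma sum_replace_sum J T I (r : seq I) (c : I -> R) (F : I -> seq W -> R^o) s :
  replace_sum J T (\sum_(i <- r) c i *: F i) s = \sum_(i <- r) c i * replace_sum J T (F i) s.
Proof.
elim: r => [|i r IH]; first by rewrite !big_nil replace_sum0.
by rewrite !big_cons replace_sum_linear IH.
Qed.

(** Alternation moves the replaced argument to the front, at the cost of the sign of its
    position. *)
Lemma replace_sum_altsum J T F s : multilinear F -> alternating F ->
  replace_sum J T F s = altsum (fun u s' => F (T u :: map J s')) s.
Proof.
elim: s F => [|v s IH] F mF aF /=; first by rewrite altsum_nil.
rewrite altsum_cons IH; [|exact: multilinear_contract|exact: alternating_contract].
congr (_ + _); rewrite -mulN1r -[RHS]addr0.
have <- : altsum (fun (_ : V) (_ : seq V) => 0) s = 0 :> R^o.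
  by rewrite /altsum big1// => a _; rewrite mulr0.
rewrite -altsum_linear; apply: eq_altsum => u s' _.
by rewrite mulN1r addr0 /contract; exact: (alternating_swap [::]).
Qed.

(** The term with u differentiating and v replaced cancels the one with u and v exchanged, H being
    symmetric. *)
Lemma altsum_replace_sum J (H : V -> V -> W) F s : (forall u v, H u v = H v u) ->
  multilinear F -> alternating F ->
  altsum (fun u s' => replace_sum J (H u) F s') s = 0.
Proof.
move=> HC; elim: s F => [|v s IH] F mF aF /=; first by rewrite altsum_nil.
rewrite altsum_cons altsumD IH; [|exact: multilinear_contract|exact: alternating_contract].
rewrite addr0 replace_sum_altsum//; apply/eqP; rewrite subr_eq0; apply/eqP.
by apply: eq_altsum => u s' _; rewrite HC.
Qed.

End Substitution.

Section Pullback.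
Context (R : realType) (V : normedModType R) (m : nat).
Local Notation W := 'rV[R]_m.

Lemma derive_substitution (G : V -> seq W -> R^o) (J : V -> V -> W) x v s :
  (forall y, multilinear (G y)) ->
  (forall s, differentiable (fun y => G y s) x) ->
  (forall u, differentiable (fun y => J y u) x) ->
  differentiable (fun y => G y (map (J y) s)) x /\
  'D_v (fun y => G y (map (J y) s)) x =
    'D_v (fun y => G y (map (J x) s)) x +
    replace_sum (J x) (fun u => 'D_v (fun y => J y u) x) (G x) s.
Proof.
move=> + + dJ; elim: s G => [|u s IH] G mG dG /=; first by rewrite addr0.
(* Expanding the first argument in the basis leaves sums of products of scalar functions, to which
   the product rule applies; the second factors are covered by the induction hypothesis for
   contracted forms. *)
pose f c y : R := J y u 0 c.
pose g c y : R := contract (dir R c) (G y) (map (J y) s).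
pose g0 c y : R := contract (dir R c) (G y) (map (J x) s).
have GE : (fun y => G y (J y u :: map (J y) s)) = \sum_c f c * g c.
  apply/funext => y; rewrite fct_sumE.
  exact: (multilinear_coord [::]).
have G0E : (fun y => G y (J x u :: map (J x) s)) = \sum_c f c x *: g0 c.
  apply/funext => y; rewrite fct_sumE.
  exact: (multilinear_coord [::]).
have df c : differentiable (f c) x.
  apply: (@differentiable_comp _ _ _ _ (fun y => J y u) (fun N : W => N 0 c)).
    exact: dJ.
  exact: differentiable_coord.
have IHc c := IH (fun y => contract (dir R c) (G y))
  (fun y => multilinear_contract (dir R c) (mG y)) (fun s => dG (dir R c :: s)).
have dg c : differentiable (g c) x by have [] := IHc c.
have dg0 c : differentiable (g0 c) x by exact: dG.
split; first by rewrite GE; apply: differentiable_sum => c; exact: differentiableM.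
have D1 : 'D_v (\sum_c f c * g c) x = \sum_c 'D_v (f c * g c) x.
  by apply: derive_sum => c; apply: diff_derivable; exact: differentiableM.
have D2 : 'D_v (\sum_c f c x *: g0 c) x = \sum_c 'D_v (f c x *: g0 c) x.
  by apply: derive_sum => c; apply: diff_derivable; exact: differentiableZ.
rewrite GE G0E D1 D2.
rewrite -[G x (_ :: _)]/(G x ([::] ++ _ :: _)) (multilinear_coord _ _ _ (mG x))/=.
rewrite [contract (J x u) (G x)](_ : _ = \sum_c J x u 0 c *: contract (dir R c) (G x)).
  rewrite sum_replace_sum -!big_split/=; apply: eq_bigr => c _.
  rewrite deriveM; try exact: diff_derivable.
  rewrite deriveZ; last exact: diff_derivable.
  have [_ ->] := IHc c.
  rewrite derive_mx; last exact: diff_derivable.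
  by rewrite mxE -![_ *: _]/(_ * _) /f /g /g0 /contract; ring.
apply/funext => s'; rewrite fct_sumE; exact: (multilinear_coord [::]).
Qed.

End Pullback.

Section Naturality.
Context (R : realType) (m' m : nat).
Local Notation V := 'rV[R]_m'.
Local Notation W := 'rV[R]_m.

Lemma derive_coord (f : V -> W) x v i j : differentiable f x ->
  'D_v f x i j = 'D_v (fun y => f y i j) x.
Proof. by move=> df; rewrite derive_mx ?mxE//; exact: diff_derivable. Qed.

Lemma derive2_coord (U : set V) (f : V -> W) x u v i j : open U -> U x ->
  smooth_on U f ->
  'D_u ('D_v f) x i j = 'D_u ('D_v (fun y => f y i j)) x.
Proof.
move=> oU Ux sf; have sdf := smooth_on_derive v sf.
apply: etrans (derive_coord u i j (smooth_on_differentiable sdf Ux)) _.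
apply: near_eq_derive; apply: (near_open_eq oU Ux) => y Uy.
exact: derive_coord (smooth_on_differentiable sf Uy).
Qed.

Lemma derive_comm_mx (U : set V) (f : V -> W) x u v : open U -> U x ->
  smooth_on U f -> 'D_u ('D_v f) x = 'D_v ('D_u f) x.
Proof.
move=> oU Ux sf; apply/matrixP => i j.
have Cf : Ck_on 2 U (fun y => f y i j) by apply: Ck_on_mx => //; exact: sf.
have Euv := derive2_coord u v i j oU Ux sf.
have Evu := derive2_coord v u i j oU Ux sf.
exact: etrans Euv (etrans (derive_comm u v oU Ux Cf) (esym Evu)).
Qed.

(* The second derivatives of phi contribute a term symmetric in two of the
   arguments, which [altsum_replace_sum] cancels against the alternation. *)
Lemma exterior_pullback (U : set V) (phi : V -> W) (al : W -> seq W -> R^o) x s :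
  open U -> U x -> smooth_on U phi ->
  (forall y, multilinear (al y)) -> (forall y, alternating (al y)) ->
  differentiable_form al (phi x) ->
  exterior (fun y s => al (phi y) (map ('d phi y) s)) x s =
  exterior al (phi x) (map ('d phi x) s).
Proof.
move=> oU Ux sphi mal aal dal.
have dphi : differentiable phi x by exact: smooth_on_differentiable sphi Ux.
have nearJ u : \forall y \near x, 'D_u phi y = 'd phi y u.
  apply: (near_open_eq oU Ux) => y Uy; rewrite deriveE//.
  exact: smooth_on_differentiable sphi Uy.
have dJ u : differentiable (fun y => 'd phi y u) x.
  apply: near_eq_differentiable (nearJ u) _.
  exact: smooth_on_differentiable (smooth_on_derive u sphi) Ux.
have HC u v : 'D_u (fun y => 'd phi y v) x = 'D_v (fun y => 'd phi y u) x.
  have Euv := near_eq_derive u (nearJ v); have Evu := near_eq_derive v (nearJ u).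
  exact: etrans (esym Euv) (etrans (derive_comm_mx u v oU Ux sphi) Evu).
rewrite {2}/exterior altsum_map.
rewrite -[RHS]addr0 -(altsum_replace_sum ('d phi x) s HC (mal (phi x)) (aal (phi x))).
rewrite -altsumD; apply: eq_altsum => u s' _.
have dG s0 : differentiable (fun y => al (phi y) s0) x.
  by apply: (@differentiable_comp _ _ _ _ phi (fun z => al z s0)) => //; exact: dal.
have [_ ->] := derive_substitution u s' (fun y => mal (phi y)) dG dJ.
congr (_ + _).
rewrite deriveE// (deriveE _ (dal _)).
by rewrite (@diff_comp _ _ _ _ phi (fun z => al z (map ('d phi x) s')))//; exact: dal.
Qed.

End Naturality.

(** * Differential forms on manifolds *)

Lemma size_mask_negb (T : Type) (b : bitseq) (s : seq T) : size b = size s ->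
  (size (mask b s) + size (mask (map negb b) s))%N = size s.
Proof.
elim: b s => [|[] b IH] [|x s]//= [bs]; first by rewrite -[in RHS](IH _ bs).
by rewrite addnS IH.
Qed.

Section Forms.
Context (R : realType) (m : nat) (M : manifold R m).
Implicit Types (A B : cochain M) (k : int) (i j : chart M) (p : M).
Local Notation forms := (Defs.forms M).

Lemma forms_eq0_at k A i p s : forms k A -> ~ dom i p \/ (size s)%:Z <> k ->
  A i p s = 0.
Proof. by case=> + _ _ _ _; exact. Qed.

Lemma forms_multilinear k A i p : forms k A -> multilinear (A i p).
Proof. by case=> _ + _ _ _; exact. Qed.

Lemma forms_alternating k A i p : forms k A -> alternating (A i p).
Proof. by case=> _ _ aA _ _ s1 s2 v; exact: (aA i p s1 [::] s2). Qed.

Lemma forms_smooth k A i : forms k A ->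
  smooth_form (coord i @` dom i) (fun x => A i (param i x)).
Proof. by case=> _ _ _ sA _ s; exact: sA. Qed.

Lemma forms_chart k A i j p s : forms k A -> dom i p -> dom j p ->
  A i p s = A j p (map ('d (coord j \o param i) (coord i p)) s).
Proof. by case=> _ _ _ _; exact. Qed.

Lemma forms_of k A :
  (forall i p s, ~ dom i p \/ (size s)%:Z <> k -> A i p s = 0) ->
  (forall i p, multilinear (A i p)) -> (forall i p, alternating (A i p)) ->
  (forall i, smooth_form (coord i @` dom i) (fun x => A i (param i x))) ->
  (forall i j p s, dom i p -> dom j p ->
     A i p s = A j p (map ('d (coord j \o param i) (coord i p)) s)) ->
  forms k A.
Proof.
move=> A0 mA aA sA cA; split=> // i p s1 s2 s3 v.
exact: alternating_repeat.
Qed.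

Lemma is_subspace_forms k : is_subspace (forms k).
Proof.
split.
  apply: forms_of => //.
  - by move=> i p s1 s2 a u v; rewrite mulr0 addr0.
  - by move=> i s; exact: smooth_on_cst.
move=> a A B fA fB.
have E i p s : (a *: A + B) i p s = a * A i p s + B i p s by [].
apply: forms_of.
- by move=> i p s H; rewrite E (forms_eq0_at fA H) (forms_eq0_at fB H) mulr0 addr0.
- move=> i p s1 s2 b u v; rewrite !E (forms_multilinear _ _ fA).
  by rewrite (forms_multilinear _ _ fB); ring.
- move=> i p s1 s2 v; rewrite E (forms_alternating _ _ fA).
  by rewrite (forms_alternating _ _ fB) mulr0 addr0.
- move=> i s; apply: smooth_on_linear; [exact: coord_open|exact: forms_smooth fA _|].
  exact: forms_smooth fB _.
- move=> i j p s ip jp; rewrite !E (forms_chart s fA ip jp).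
  by rewrite (forms_chart s fB ip jp).
Qed.

Lemma forms_eq0 k A : forms k A -> k < 0 \/ m%:Z < k -> A = 0.
Proof.
move=> fA km; apply/funext => i; apply/funext => p; apply/funext => s.
have [sk|/eqP sk] := eqVneq ((size s)%:Z) k; last first.
  by rewrite (forms_eq0_at fA)//; right.
apply: multilinear_alternating_eq0; [exact: forms_multilinear fA|exact: forms_alternating fA|].
by case: km; rewrite -sk.
Qed.

Lemma ext_dE A i p : dom i p ->
  ext_d A i p = exterior (fun x => A i (param i x)) (coord i p).
Proof. by move=> ip; apply/funext => s; rewrite /ext_d mem_set. Qed.

Lemma ext_d_out A i p : ~ dom i p -> ext_d A i p = fun=> 0.
Proof. by move=> ip; apply/funext => s; rewrite /ext_d memNset. Qed.

Lemma image_param i (D : set M) x : D `<=` dom i -> (coord i @` D) x ->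
  D (param i x) /\ coord i (param i x) = x.
Proof. by move=> Di [q Dq <-]; rewrite coordK//; exact: Di. Qed.

Lemma coord_image i p : dom i p -> (coord i @` dom i) (coord i p).
Proof. by move=> ip; exists p. Qed.

Lemma open_overlap i j : open (coord i @` (dom i `&` dom j)).
Proof.
rewrite openE => x [p [ip jp] <-].
have xi : nbhs (coord i p) (coord i @` dom i).
  by apply: open_nbhs_nbhs; split; [exact: coord_open|].
have : nbhs (coord i p) (param i @^-1` dom j).
  apply: param_continuous => //; rewrite coordK//.
  by apply: open_nbhs_nbhs; split => //; exact: dom_open.
move=> nj; apply: filterS2 xi nj => y [q iq <-]; rewrite /= coordK// => jq.
by exists q.
Qed.

Lemma differentiable_chart k A i p : forms k A -> dom i p ->
  differentiable_form (fun x => A i (param i x)) (coord i p).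
Proof.
move=> fA ip; apply: smooth_form_differentiable (forms_smooth i fA) _.
exact: coord_image.
Qed.

Lemma forms_ext_d k A : forms k A -> forms (k + 1) (ext_d A).
Proof.
move=> fA; apply: forms_of.
- move=> i p s [ip|sk]; first by rewrite ext_d_out.
  have [ip|ip] := pselect (dom i p); last by rewrite ext_d_out.
  rewrite ext_dE// exterior_eq0// => y s' s's.
  apply: (forms_eq0_at fA); right=> s'k; apply: sk.
  by rewrite -s's -s'k -addn1 PoszD.
- move=> i p; have [ip|ip] := pselect (dom i p); last first.
    by rewrite ext_d_out// => s1 s2 a u v; rewrite mulr0 addr0.
  rewrite ext_dE//; apply: multilinear_exterior.
    by move=> y; exact: forms_multilinear fA.
  exact: differentiable_chart fA ip.
- move=> i p; have [ip|ip] := pselect (dom i p); last by rewrite ext_d_out.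
  by rewrite ext_dE//; apply: alternating_exterior => y; exact: forms_alternating fA.
- move=> i s; have := smooth_exterior (@coord_open _ _ M i) (forms_smooth i fA) s.
  apply: smooth_on_ext; first exact: coord_open.
  by move=> x /(image_param (@subset_refl _ _))[ix ixE]; rewrite ext_dE// ixE.
(* On the overlap, the expression of A in the chart i is the pullback of the one in the chart j
   along the transition map, and d commutes with pullbacks. *)
- move=> i j p s ip jp; rewrite !ext_dE//.
  pose phi := coord j \o param i.
  have ipU : (coord i @` (dom i `&` dom j)) (coord i p) by exists p.
  have jE : coord j p = phi (coord i p) by rewrite /phi/= coordK.
  rewrite jE -(exterior_pullback s (@open_overlap i j) ipU (@transition_smooth _ _ _ i j)).
  + apply: (eq_exterior (@open_overlap i j) ipU) => y s' yU _.
      have [[iy jy] yE] := image_param (@subIsetl _ _ _) yU.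
    by rewrite (forms_chart s' fA iy jy) yE /= coordK.
  + by move=> y; exact: forms_multilinear fA.
  + by move=> y; exact: forms_alternating fA.
  + by have := differentiable_chart fA jp; rewrite jE.
Qed.

Lemma ext_d_linear k a A B : forms k A -> forms k B ->
  ext_d (a *: A + B) = a *: ext_d A + ext_d B.
Proof.
move=> fA fB; apply/funext => i; apply/funext => p; apply/funext => s.
rewrite -[RHS]/(a * ext_d A i p s + ext_d B i p s).
have [ip|ip] := pselect (dom i p); last by rewrite !ext_d_out// mulr0 addr0.
rewrite !ext_dE//; apply: exterior_linear; first exact: differentiable_chart fA ip.
exact: differentiable_chart fB ip.
Qed.

Lemma ext_d_ext_d k A : forms k A -> ext_d (ext_d A) = 0.
Proof.
move=> fA; apply/funext => i; apply/funext => p; apply/funext => s.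
have [ip|ip] := pselect (dom i p); last by rewrite ext_d_out.
have oi := @coord_open _ _ M i.
rewrite ext_dE// -[RHS](exterior_exterior oi s (forms_smooth i fA) (coord_image ip)).
apply: (eq_exterior oi (coord_image ip)) => y s' /(image_param (@subset_refl _ _))[iy yE] _.
by rewrite ext_dE// yE.
Qed.

Lemma wedgeE A B i p : wedge A B i p = wedge_at (A i p) (B i p).
Proof. by []. Qed.

Lemma wedge_linear A a B C :
  wedge A (a *: B + C) = a *: wedge A B + wedge A C.
Proof.
apply/funext => i; apply/funext => p.
by rewrite wedgeE -[(a *: B + C) i p]/(a *: B i p + C i p) wedge_atDr.
Qed.

Lemma forms_wedge k l A B : forms k A -> forms l B -> forms (k + l) (wedge A B).
Proof.
move=> fA fB; apply: forms_of.
- move=> i p s H; rewrite wedgeE /wedge_at big1// => b _.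
  case: H => [ip|skl]; first by rewrite (forms_eq0_at fA)// ?mul0r ?mulr0//; left.
  have [sk|/eqP sk] := eqVneq ((size (mask b s))%:Z) k.
    rewrite (forms_eq0_at fB) ?mulr0//; right => sl; apply: skl.
    by rewrite -sk -sl -PoszD size_mask_negb// size_tuple.
  by rewrite (forms_eq0_at fA) ?mul0r ?mulr0//; right.
- move=> i p; apply: multilinear_wedge; [exact: forms_multilinear fA|].
  exact: forms_multilinear fB.
- move=> i p; apply: alternating_wedge; [exact: forms_alternating fA|].
  exact: forms_alternating fB.
- move=> i s; have oi := @coord_open _ _ M i.
  apply: smooth_on_sum => // b _; apply: smooth_onM => //.
    exact: smooth_on_cst.
  by apply: smooth_onM => //; [exact: forms_smooth fA _|exact: forms_smooth fB _].
- move=> i j p s ip jp; rewrite !wedgeE wedge_at_map; congr (wedge_at _ _ s).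
    by apply/funext => s'; exact: forms_chart fA ip jp.
  by apply/funext => s'; exact: forms_chart fB ip jp.
Qed.

Lemma ext_d_wedge_closed A B k : forms 2 A -> ext_d A = 0 -> forms k B ->
  ext_d (wedge A B) = wedge A (ext_d B).
Proof.
move=> fA dA fB; apply/funext => i; apply/funext => p; apply/funext => s.
have [ip|ip] := pselect (dom i p); last first.
  rewrite ext_d_out// wedgeE (_ : A i p = 0) ?wedge_at0l//.
  by apply/funext => s'; rewrite (forms_eq0_at fA)//; left.
rewrite ext_dE//; apply: etrans (exterior_wedge s
  (differentiable_chart fA ip) (differentiable_chart fB ip)) _.
rewrite -!ext_dE// coordK// dA wedge_at0l add0r.
congr (wedge_at _ _ s); apply/funext => s'; rewrite /grading.
(* The grading sign is 1 on lists of length 2, and A vanishes on all others. *)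
have [s2|s2] := eqVneq (size s') 2%N; first by rewrite s2 sqrrN expr1n mul1r.
by rewrite (forms_eq0_at fA) ?mulr0//; right => /eqP; rewrite eqz_nat; apply/negP.
Qed.

End Forms.

(** * The operator Lambda on a symplectic manifold *)

Section ContractionMatrix.
Context (R : numFieldType) (m : nat).
Local Notation V := 'rV[R]_m.
Implicit Types (F G : seq V -> R^o) (s : seq V) (W P : 'M[R]_m).

Lemma multilinear_coord2 F s u v : multilinear F ->
  F (u :: v :: s) = \sum_c \sum_d u 0 c * v 0 d * F (dir R c :: dir R d :: s).
Proof.
move=> mF; rewrite -[LHS]/(F ([::] ++ u :: v :: s)) multilinear_coord//.
apply: eq_bigr => c _; rewrite -[F _]/(F ([:: dir R c] ++ v :: s)).
rewrite multilinear_coord// mulr_sumr; apply: eq_bigr => d _.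
by rewrite mulrA.
Qed.

(** A change of basis by P turns the bivector W into P^T W P. With P the Jacobian of a change of
    charts, this gives the independence of Lambda from the chart. *)
Lemma sum_contract_row F s W P : multilinear F ->
  \sum_a \sum_b W a b * F (row a P :: row b P :: s) =
  \sum_c \sum_d (P^T *m W *m P) c d * F (dir R c :: dir R d :: s).
Proof.
move=> mF.
under eq_bigr => a _ do under eq_bigr => b _ do
  rewrite (multilinear_coord2 s (row a P) (row b P) mF) mulr_sumr.
under eq_bigr => a _ do rewrite exchange_big/=.
rewrite exchange_big/=; apply: eq_bigr => c _.
under eq_bigr => a _ do under eq_bigr => b _ do rewrite mulr_sumr.
under eq_bigr => a _ do rewrite exchange_big/=.
rewrite exchange_big/=; apply: eq_bigr => d _.
rewrite [in RHS]mxE mulr_suml exchange_big/=; apply: eq_bigr => b _.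
rewrite [in RHS]mxE !mulr_suml; apply: eq_bigr => a _.
by rewrite !mxE; ring.
Qed.

Lemma dual_contract_linear W a F G :
  dual_contract W (a *: F + G) = a *: dual_contract W F + dual_contract W G.
Proof.
apply/funext => s; rewrite -[RHS]/(a * dual_contract W F s + dual_contract W G s).
rewrite /dual_contract [a * _]mulrCA -mulrDr; congr (_ * _).
rewrite mulr_sumr -big_split/=.
apply: eq_bigr => c _; rewrite mulr_sumr -big_split/=; apply: eq_bigr => d _.
by rewrite -[(_ + _) _]/(a * F _ + G _); ring.
Qed.

Lemma dual_contract0 W : dual_contract W 0 = 0.
Proof.
have := dual_contract_linear W (-1) 0 0.
by rewrite scaler0 addr0 scaleN1r addNr.
Qed.

Lemma multilinear_dual_contract W F : multilinear F ->
  multilinear (dual_contract W F).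
Proof.
move=> mF s1 s2 a u v; rewrite /dual_contract mulrCA -mulrDr; congr (_ * _).
rewrite mulr_sumr -big_split/=; apply: eq_bigr => c _.
rewrite mulr_sumr -big_split/=; apply: eq_bigr => d _.
by rewrite -!cat_cons mF; ring.
Qed.

Lemma alternating_dual_contract W F : alternating F ->
  alternating (dual_contract W F).
Proof.
move=> aF s1 s2 v; rewrite /dual_contract big1 ?mulr0// => c _.
by rewrite big1// => d _; rewrite -!cat_cons aF mulr0.
Qed.

End ContractionMatrix.

Lemma invmxN (R : comUnitRingType) m (A : 'M[R]_m) : invmx (- A) = - invmx A.
Proof.
have [uA|nA] := boolP (A \in unitmx).
  have uN : (-1 *: A) \in unitmx by rewrite unitmxZ// unitrN1.
  by rewrite -scaleN1r invmxZ// invrN1 scaleN1r.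
have nN : - A \notin unitmx by rewrite -scaleN1r unitmxZ// unitrN1.
by rewrite /invmx (negbTE nA) (negbTE nN).
Qed.

Section SymplecticForms.
Context (R : realType) (n : nat) (M : symplectic_manifold R n).
Implicit Types (A B : cochain M) (k : int) (i j : chart M) (p : M).
Local Notation forms := (Defs.forms M).
Local Notation m := (2 * n)%N.
Local Notation dir := (dir R).

Definition omega_mx i p : 'M[R]_m := \matrix_(a, b) omega M i p [:: dir a; dir b].

Lemma omega_coord i p u v :
  omega M i p [:: u; v] = \sum_a \sum_b u 0 a * v 0 b * omega_mx i p a b.
Proof.
rewrite (multilinear_coord2 [::] u v (forms_multilinear i p (omega_form M))).
by apply: eq_bigr => a _; apply: eq_bigr => b _; rewrite mxE.
Qed.

Lemma omega_antisym i p u v : omega M i p [:: u; v] = - omega M i p [:: v; u].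
Proof.
by apply: (alternating_swap [::]);
  [exact: forms_multilinear (omega_form M)|exact: forms_alternating (omega_form M)].
Qed.

(** A row of the left kernel is a vector u with omega(u, v) = 0 for all v. *)
Lemma omega_mx_unit i p : dom i p -> omega_mx i p \in unitmx.
Proof.
move=> ip; rewrite -row_free_unit -kermx_eq0; apply/eqP/row_matrixP => a.
rewrite row0; apply: (omega_nondegenerate ip) => v.
rewrite omega_coord exchange_big/= big1// => b _.
transitivity (v 0 b * (row a (kermx (omega_mx i p)) *m omega_mx i p) 0 b).
  by rewrite mxE mulr_sumr; apply: eq_bigr => c _; ring.
by rewrite -row_mul mulmx_ker row0 mxE mulr0.
Qed.

Lemma omega_mxT i p : (omega_mx i p)^T = - omega_mx i p.
Proof. by apply/matrixP => a b; rewrite !mxE omega_antisym. Qed.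

Lemma invmx_omegaT i p a b :
  invmx (omega_mx i p) a b = - invmx (omega_mx i p) b a.
Proof.
have -> : invmx (omega_mx i p) a b = (invmx (omega_mx i p))^T b a by rewrite mxE.
by rewrite trmx_inv omega_mxT invmxN mxE.
Qed.

Lemma omega_mx_chart i j p : dom i p -> dom j p ->
  let P := lin1_mx ('d (coord j \o param i) (coord i p)) in
  omega_mx i p = P *m omega_mx j p *m P^T.
Proof.
move=> ip jp P; apply/matrixP => a b.
rewrite mxE (forms_chart _ (omega_form M) ip jp)/= omega_coord.
rewrite mxE exchange_big/=; apply: eq_bigr => d _.
rewrite !mxE mulr_suml; apply: eq_bigr => c _.
by rewrite !mxE; ring.
Qed.

Definition dual_Lop (A : cochain M) : cochain M :=
  fun i p => dual_contract (invmx (omega_mx i p)) (A i p).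

Lemma dual_Lop_linear a A B :
  dual_Lop (a *: A + B) = a *: dual_Lop A + dual_Lop B.
Proof.
by apply/funext => i; apply/funext => p; rewrite /dual_Lop dual_contract_linear.
Qed.

Lemma forms_out k A i p : forms k A -> ~ dom i p -> A i p = 0.
Proof. by move=> fA ip; apply/funext => s; apply: (forms_eq0_at fA); left. Qed.

Lemma forms_dual_Lop k A : forms k A -> forms (k - 2) (dual_Lop A).
Proof.
move=> fA; apply: forms_of.
- move=> i p s H; rewrite /dual_Lop /dual_contract big1 ?mulr0// => a _.
  rewrite big1// => b _; rewrite (forms_eq0_at fA) ?mulr0//.
  case: H => [ip|sk]; [by left|right => E; apply: sk].
  by rewrite -E /=; move: (size s) => q; lia.
- by move=> i p; apply: multilinear_dual_contract; exact: forms_multilinear fA.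
- by move=> i p; apply: alternating_dual_contract; exact: forms_alternating fA.
- move=> i s; have oi := @coord_open _ _ M i.
  apply: smooth_onM => //; first exact: smooth_on_cst.
  apply: smooth_on_sum => // a _; apply: smooth_on_sum => // b _.
  apply: smooth_onM => //; last exact: forms_smooth fA _.
  apply: smooth_on_invmx => //.
    move=> x /(image_param (@subset_refl _ _))[ix _]; exact: omega_mx_unit.
  move=> c d; under eq_fun do rewrite mxE.
  exact: forms_smooth (omega_form M) _.
- move=> i j p s ip jp.
  set P := lin1_mx ('d (coord j \o param i) (coord i p)).
  have OE : omega_mx i p = P *m omega_mx j p *m P^T by exact: omega_mx_chart.
  (* The Jacobian is a factor of the invertible matrix of omega, hence invertible itself. *)
  have uP : P \in unitmx.
    by have := omega_mx_unit ip; rewrite OE !unitmx_mul => /andP[/andP[]].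
  (* This is [OE] inverted, the transformation rule that [sum_contract_row] requires. *)
  have WE : P^T *m invmx (omega_mx i p) *m P = invmx (omega_mx j p).
    have uj := omega_mx_unit jp.
    have ui := omega_mx_unit ip.
    apply: (can_inj (mulKmx uj)); rewrite mulmxV//.
    apply: (can_inj (mulKmx uP)); rewrite mulmx1 !mulmxA -OE.
    by rewrite mulmxV// mul1mx.
  rewrite /dual_Lop /dual_contract -WE -sum_contract_row; last first.
    exact: forms_multilinear fA.
  congr (_ * _); apply: eq_bigr => a _; apply: eq_bigr => b _; congr (_ * _).
  rewrite (forms_chart _ fA ip jp)/=; congr (A j p [:: _, _ & _]).
    by rewrite /P rowE mul_rV_lin1.
  by rewrite /P rowE mul_rV_lin1.
Qed.

Lemma Lop_linear a A B : Lop (a *: A + B) = a *: Lop A + Lop B.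
Proof. exact: wedge_linear. Qed.

Lemma forms_Lop k A : forms k A -> forms (k + 2) (Lop A).
Proof. by move=> fA; rewrite addrC; apply: forms_wedge => //; exact: omega_form. Qed.

Lemma ext_d_Lop k A : forms k A -> ext_d (Lop A) = Lop (ext_d A).
Proof.
move=> fA; apply: ext_d_wedge_closed fA; first exact: omega_form.
exact: omega_closed.
Qed.

Lemma dual_Lop_Lop k A : forms k A ->
  dual_Lop (Lop A) = Lop (dual_Lop A) + (n%:Z - k)%:~R *: A.
Proof.
move=> fA; apply/funext => i; apply/funext => p; apply/funext => s.
rewrite -[RHS]/(wedge_at (omega M i p) (dual_Lop A i p) s + (n%:Z - k)%:~R * A i p s).
have [ip|ip] := pselect (dom i p); last first.
  rewrite /dual_Lop (forms_out fA ip) dual_contract0 wedge_at0r mulr0 addr0.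
  by rewrite /Lop wedgeE (forms_out fA ip) wedge_at0r dual_contract0.
apply: etrans (@dual_contract_wedge _ _ _ _ _ _ _ _ _ _ _ _ _) _.
- exact: forms_multilinear (omega_form M).
- move=> s' s2; apply: (forms_eq0_at (omega_form M)); right => -[s2'].
  by rewrite s2' in s2.
- exact: omega_antisym.
- exact: invmx_omegaT.
- move=> a c; have := mulVmx (omega_mx_unit ip) => /matrixP/(_ a c).
  by rewrite !mxE => <-; apply: eq_bigr => b _; rewrite [omega_mx _ _ _ _]mxE.
- exact: forms_multilinear fA.
- exact: forms_alternating fA.
have [sk|/eqP sk] := eqVneq ((size s)%:Z) k; last first.
  by rewrite (forms_eq0_at fA (or_intror sk)) !mulr0.
rewrite -sk intrB; congr (_ + (_ - _) * _).
by rewrite natrM mulrAC mulfV ?mul1r// pnatr_eq0.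
Qed.

End SymplecticForms.

(** * Hard Lefschetz property *)

Section HardLefschetz.
Context (K : numFieldType) (V : lmodType K) (n : int).
Variables (Om : int -> set V) (L Lam : {linear V -> V}).
Hypothesis Om_sub : forall k, is_subspace (Om k).
Hypothesis Om_eq0 : forall k A, Om k A -> k < 0 \/ 2 * n < k -> A = 0.
Hypothesis Om_L : forall k A, Om k A -> Om (k + 2) (L A).
Hypothesis Om_Lam : forall k A, Om k A -> Om (k - 2) (Lam A).
Hypothesis Lam_L : forall k A, Om k A ->
  Lam (L A) = L (Lam A) + (n - k)%:~R *: A.

Lemma iter_linear q a A B : iter q L (a *: A + B) = a *: iter q L A + iter q L B.
Proof. by elim: q => //= q ->; rewrite linearP. Qed.

Lemma iter_L0 q : iter q L 0 = 0.
Proof. by elim: q => //= q ->; exact: linear0. Qed.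

Lemma Om_iter q k A : Om k A -> Om (k + 2 * q%:Z) (iter q L A).
Proof.
move=> kA; elim: q => [|q IH]; first by rewrite mulr0 addr0.
by rewrite (_ : k + _ = k + 2 * q%:Z + 2); [exact: Om_L|lia].
Qed.

(** The usual sl2 relation; the coefficient is the sum of n - k - 2i over 0 <= i <= q. *)
Lemma Lam_iter q k A : Om k A -> Lam (iter q.+1 L A) =
  iter q.+1 L (Lam A) + (q.+1%:Z * (n - k - q%:Z))%:~R *: iter q L A.
Proof.
move=> kA; elim: q => [|q IH].
  by rewrite /= (Lam_L kA) subr0 mul1r.
rewrite [iter q.+2 L A]/= (Lam_L (Om_iter q.+1 kA)) IH linearD linearZ/=.
rewrite -addrA -scalerDl -intrD; congr (_ + _%:~R *: _); lia.
Qed.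

(** Induction on k and, inside, on q. If L^(q+1) A = 0, the commutation formula and the injectivity
    of L^q make A a multiple of L (Lam A), the coefficient being nonzero since q < n - k. Then
    L^(q+2) kills Lam A, of degree k - 2, which vanishes by induction. *)
Lemma L_injective q k A : Om k A -> q%:Z <= n - k -> iter q L A = 0 -> A = 0.
Proof.
have [N] := ubnP (absz k).
suff H : forall k : int, k < N%:Z -> forall q A, Om k A -> q%:Z <= n - k ->
    iter q L A = 0 -> A = 0.
  by move=> kN; apply: H; lia.
elim: N => [k0 k00 q0 A0 kA _ _|N IH {}k kN].
  by apply: Om_eq0 kA _; left.
elim=> [|{}q IHq] {}A kA qk LA //.
have := Lam_iter q kA; rewrite LA linear0; set c := _%:~R => E.
have c0 : c != 0 by rewrite intr_eq0 mulf_neq0//; lia.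
have AE : A = (- c^-1) *: L (Lam A).
  apply/eqP; rewrite -subr_eq0 scaleNr opprK; apply/eqP; apply: IHq; [|lia|].
    apply: is_subspaceD => //; apply: is_subspaceZ => //.
    by have := Om_L (Om_Lam kA); rewrite subrK.
  rewrite addrC iter_linear -iterSr; apply: (scalerI c0).
  by rewrite scaler0 scalerDr scalerA mulfV// scale1r -E.
have : Lam A = 0.
  apply: (IH (k - 2) _ q.+2); [lia|exact: Om_Lam|lia|].
  apply: (@scalerI _ _ (- c^-1)); first by rewrite oppr_eq0 invr_eq0.
  rewrite scaler0 -LA [in RHS]AE -[in RHS](addr0 (_ *: _)) iter_linear.
  by rewrite -iterSr iter_L0 addr0.
by move=> L0; rewrite AE L0 linear0 scaler0.
Qed.

(** Descending induction on k and, inside, induction on q. Write A = L^q A' and, two degrees higher,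
    L A = L^(q+2) C. For D = A' - L C one has L^(q+1) D = 0, so the commutation formula expresses
    L^q D through L^(q+1) (Lam D), and A = L^q D + L^(q+1) C lies in the image of L^(q+1). *)
Lemma L_surjective q k A : Om k A -> q%:Z <= k - n ->
  exists2 B, Om (k - 2 * q%:Z) B & A = iter q L B.
Proof.
have [N] := ubnP (absz (2 * n + 1 - k)%R).
suff H : forall k : int, 2 * n - N%:Z < k -> forall q A, Om k A -> q%:Z <= k - n ->
    exists2 B, Om (k - 2 * q%:Z) B & A = iter q L B.
  by move=> kN; apply: H; lia.
elim: N => [k0 k00 q0 A0 kA _|N IH {}k kN].
  exists 0; first by case: (Om_sub (k0 - 2 * q0%:Z)).
  rewrite iter_L0; apply: Om_eq0 kA _; right; lia.
elim=> [|{}q IHq] {}A kA qk; first by exists A; rewrite // mulr0 subr0.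
have [|A' kA' AE] := IHq A kA; first lia.
have [||C kC CE] := IH (k + 2) _ q.+2 (L A) (Om_L kA); [lia|lia|].
have kC' : Om (k - 2 * q%:Z - 2) C by move: kC; congr (Om _ C); lia.
pose D := A' - L C.
have kD : Om (k - 2 * q%:Z) D.
  by apply: is_subspaceB => //; have := Om_L kC'; rewrite subrK.
have itB r x y : iter r L (x - y) = iter r L x - iter r L y.
  by rewrite addrC -scaleN1r iter_linear scaleN1r addrC.
have LD : iter q.+1 L D = 0.
  by rewrite itB -iterSr -CE /= -AE subrr.
have := Lam_iter q kD; rewrite LD linear0; set c := _%:~R => E.
have c0 : c != 0 by rewrite intr_eq0 mulf_neq0//; lia.
exists (C - c^-1 *: Lam D).
  rewrite (_ : k - _ = k - 2 * q%:Z - 2); last lia.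
  apply: is_subspaceB => //; apply: is_subspaceZ => //; exact: Om_Lam.
rewrite itB -[_ *: Lam D]addr0 iter_linear iter_L0 addr0.
have -> : iter q.+1 L (Lam D) = - (c *: iter q L D).
  by apply/eqP; rewrite -addr_eq0 -E.
rewrite scalerN scalerA mulVf// scale1r opprK /D itB -iterSr -AE.
by rewrite addrC subrK.
Qed.

End HardLefschetz.

(** * Primitive forms and the operators del_+ and del_- *)

Section LefschetzMaps.
Context (R : realType) (n : nat) (M : symplectic_manifold R n).
Implicit Types (A B C E : cochain M) (k l s : int) (q r : nat).
Local Notation forms := (Defs.forms M).
Local Notation primitive := (@Defs.primitive R n M).

HB.instance Definition _ := GRing.isLinear.Build _ _ _ _ (@Lop R n M) (@Lop_linear R n M).

Lemma Lpow_linear r a A B :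
  Lpow r (a *: A + B) = a *: Lpow r A + Lpow r B.
Proof. exact: iter_linear. Qed.

HB.instance Definition _ r :=
  GRing.isLinear.Build _ _ _ _ (@Lpow R n M r) (Lpow_linear r).

Lemma Lpow_sum r I (t : seq I) (P : pred I) (F : I -> cochain M) :
  Lpow r (\sum_(i <- t | P i) F i) = \sum_(i <- t | P i) Lpow r (F i).
Proof. exact: linear_sum. Qed.

Lemma LpowB r A B : Lpow r (A - B) = Lpow r A - Lpow r B.
Proof. exact: linearB. Qed.

Lemma LpowN r A : Lpow r (- A) = - Lpow r A.
Proof. exact: linearN. Qed.

Lemma LpowDr r A B : Lpow r (A + B) = Lpow r A + Lpow r B.
Proof. exact: linearD. Qed.

Lemma Lpow0r r : Lpow r (0 : cochain M) = 0.
Proof. exact: linear0. Qed.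

Lemma LpowD q r A : Lpow (q + r) A = Lpow q (Lpow r A).
Proof. exact: iterD. Qed.

Lemma Lpow_Lop q A : Lpow q (Lop A) = Lpow q.+1 A.
Proof. by rewrite /Lpow iterSr. Qed.

Lemma eq_forms k l A : k = l -> forms k A -> forms l A.
Proof. by move=> ->. Qed.

Lemma formsD k A B : forms k A -> forms k B -> forms k (A + B).
Proof. by apply: is_subspaceD; exact: is_subspace_forms. Qed.

Lemma formsB k A B : forms k A -> forms k B -> forms k (A - B).
Proof. by apply: is_subspaceB; exact: is_subspace_forms. Qed.

Lemma formsN k A : forms k A -> forms k (- A).
Proof. by apply: is_subspaceN; exact: is_subspace_forms. Qed.

Lemma forms_linear k a A B : forms k A -> forms k B -> forms k (a *: A + B).
Proof. by case: (is_subspace_forms M k) => _; apply. Qed.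

Lemma forms0 k : forms k 0.
Proof. by case: (is_subspace_forms M k). Qed.

Lemma forms_Lpow r k A : forms k A -> forms (k + 2 * r%:Z) (Lpow r A).
Proof. exact: (Om_iter (@forms_Lop R n M)). Qed.

Lemma ext_d_Lpow r k A : forms k A -> ext_d (Lpow r A) = Lpow r (ext_d A).
Proof.
move=> fA; elim: r => //= r IH.
by rewrite (ext_d_Lop (forms_Lpow r fA)) IH.
Qed.

Lemma ext_d0 : ext_d (0 : cochain M) = 0.
Proof.
have := ext_d_linear (-1) (forms0 0) (forms0 0).
by rewrite scaler0 addr0 scaleN1r addNr.
Qed.

Lemma ext_dD k A B : forms k A -> forms k B -> ext_d (A + B) = ext_d A + ext_d B.
Proof. by move=> fA fB; rewrite -[A]scale1r (ext_d_linear 1 fA fB) !scale1r. Qed.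

Lemma ext_dB k A B : forms k A -> forms k B -> ext_d (A - B) = ext_d A - ext_d B.
Proof.
move=> fA fB; rewrite -scaleN1r addrC (ext_d_linear (-1) fB fA).
by rewrite scaleN1r addrC.
Qed.

Lemma ext_dN k A : forms k A -> ext_d (- A) = - ext_d A.
Proof. by move=> fA; rewrite -[- A]add0r (ext_dB (forms0 k) fA) ext_d0 add0r. Qed.

Lemma forms_degree k l A : forms k A -> forms l A -> k != l -> A = 0.
Proof.
move=> fA gA kl; apply/funext => i; apply/funext => p; apply/funext => s.
have [sk|/eqP sk] := eqVneq ((size s)%:Z) k; last first.
  by rewrite (forms_eq0_at fA)//; right.
by rewrite (forms_eq0_at gA)//; right; apply/eqP; rewrite sk.
Qed.

Let dual_linear : {linear cochain M -> cochain M} := HB.pack (@dual_Lop R n M)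
  (GRing.isLinear.Build _ _ _ _ (@dual_Lop R n M) (@dual_Lop_linear R n M)).

Let forms_eq0' k A : forms k A -> k < 0 \/ 2 * n%:Z < k -> A = 0.
Proof. by move=> fA kn; apply: forms_eq0 fA _; case: kn => kn; [left|right; lia]. Qed.

Lemma Lpow_inj q k A : forms k A -> q%:Z <= n%:Z - k -> Lpow q A = 0 -> A = 0.
Proof.
exact: (@L_injective _ _ n%:Z (Defs.forms M) (@Lop R n M) dual_linear
  (is_subspace_forms M) forms_eq0' (@forms_Lop R n M) (@forms_dual_Lop R n M)
  (@dual_Lop_Lop R n M)).
Qed.

Lemma Lpow_surj q k A : forms k A -> q%:Z <= k - n%:Z ->
  exists2 B, forms (k - 2 * q%:Z) B & A = Lpow q B.
Proof.
exact: (@L_surjective _ _ n%:Z (Defs.forms M) (@Lop R n M) dual_linear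
  (is_subspace_forms M) forms_eq0' (@forms_Lop R n M) (@forms_dual_Lop R n M)
  (@dual_Lop_Lop R n M)).
Qed.

Lemma Lpow_eq q k A B : forms k A -> forms k B -> q%:Z <= n%:Z - k ->
  Lpow q A = Lpow q B -> A = B.
Proof.
move=> fA fB qk AB; apply/subr0_eq; apply: (Lpow_inj (formsB fA fB) qk).
by rewrite linearB/= AB subrr.
Qed.

Lemma primitive_forms s B : primitive s B -> forms s B.
Proof.
rewrite /Defs.primitive; case: ifP => _ /=; first by case.
by move=> ->; exact: forms0.
Qed.

Lemma primitive_Lpow s B q : primitive s B -> n%:Z + 1 - s <= q%:Z -> Lpow q B = 0.
Proof.
rewrite /Defs.primitive; case: ifP => /= [sn [_ LB] sq|_ ->]; last by rewrite linear0.
have -> : q = (q - absz (n%:Z + 1 - s)%R + absz (n%:Z + 1 - s)%R)%N by lia.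
by rewrite LpowD LB linear0.
Qed.

(** Degrees outside [0, n] are included: for s < 0 there are no nonzero forms, and for s = n + 1 the
    exponent q is 0, so the hypothesis reads B = 0. *)
Lemma primitive_intro s B q : forms s B -> q%:Z = n%:Z + 1 - s -> Lpow q B = 0 ->
  primitive s B.
Proof.
move=> fB qs LB; rewrite /Defs.primitive; case: ifP => /= sn.
  by split=> //; rewrite -qs.
have [s0|s0] := ltP s 0; first by apply: forms_eq0' fB _; left.
by move: LB; have -> : q = 0%N by lia.
Qed.

Lemma primitive_out s B : primitive s B -> ~~ (0 <= s <= n%:Z) -> B = 0.
Proof. by rewrite /Defs.primitive; case: ifP. Qed.

Lemma primitive0 s : primitive s 0.
Proof.
rewrite /Defs.primitive; case: ifP => //= _; split; first exact: forms0.
by rewrite linear0.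
Qed.

Lemma is_subspace_primitive s : is_subspace (primitive s).
Proof.
split=> [|a A B]; first exact: primitive0.
rewrite /Defs.primitive; case: ifP => _ /=; last first.
  by move=> -> ->; rewrite scaler0 addr0.
move=> [fA LA] [fB LB]; split; first exact: forms_linear.
by rewrite Lpow_linear LA LB scaler0 addr0.
Qed.

Lemma primitive_split k A : forms k A -> k <= n%:Z ->
  exists A0 A1, [/\ primitive k A0, forms (k - 2) A1 & A = A0 + Lop A1].
Proof.
move=> fA kn.
pose q := absz (n%:Z + 1 - k)%R.
(* L^(q+1) maps Omega^(k-2) onto Omega^(2n+2-k), which contains L^q A. Subtracting L A1 then leaves
   a form killed by L^q. *)
have [|A1 fA1 LA] := @Lpow_surj q.+1 _ _ (forms_Lpow q fA); first lia.
have fA1' : forms (k - 2) A1 by apply: eq_forms fA1; lia.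
exists (A - Lop A1), A1; split=> //; last by rewrite subrK.
apply: (@primitive_intro _ _ q); [|lia|].
  by apply: formsB => //; apply: eq_forms (forms_Lop fA1'); lia.
rewrite linearB/= LA.
by rewrite Lpow_Lop subrr.
Qed.

Lemma primitive_split_eq0 k A0 A1 : k <= n%:Z -> primitive k A0 ->
  forms (k - 2) A1 -> A0 + Lop A1 = 0 -> A0 = 0 /\ A1 = 0.
Proof.
move=> kn pA0 fA1 E; suff A10 : A1 = 0.
  by split=> //; move: E; rewrite A10 linear0 addr0.
pose q := absz (n%:Z + 1 - k)%R.
apply: (@Lpow_inj q.+1 _ _ fA1); first lia.
have := congr1 (Lpow q) E.
rewrite linearD linear0/= (primitive_Lpow pA0) ?add0r; last lia.
by rewrite Lpow_Lop.
Qed.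

(** The division of [primitive_split], carried out for dB up to degree s + 1 = n + 1. The quotient
    C.2 is itself primitive because L^(n+2-s) C.2 = L^(n+1-s) dB = d (L^(n+1-s) B) = 0. *)
Lemma del_exists s B : 0 <= s <= n%:Z -> primitive s B ->
  exists C : cochain M * cochain M, [/\ primitive (s + 1) C.1,
    primitive (s - 1) C.2 & ext_d B = C.1 + Lop C.2].
Proof.
move=> sn pB; have fB := primitive_forms pB; have fdB := forms_ext_d fB.
pose q := absz (n%:Z - s)%R.
have [|C2 fC2 LC] := @Lpow_surj q.+1 _ _ (forms_Lpow q fdB); first lia.
have fC2' : forms (s - 1) C2 by apply: eq_forms fC2; lia.
exists (ext_d B - Lop C2, C2); split=> /=; last by rewrite subrK.
  apply: (@primitive_intro _ _ q); [|lia|by rewrite linearB/= LC Lpow_Lop subrr].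
  by apply: formsB => //; apply: eq_forms (forms_Lop fC2'); lia.
apply: (@primitive_intro _ _ q.+2) => //; first lia.
rewrite -[LHS]/(Lop (Lpow q.+1 C2)) -LC -[LHS]/(Lpow q.+1 (ext_d B)).
by rewrite -(ext_d_Lpow _ fB) (primitive_Lpow pB) ?ext_d0//; lia.
Qed.

Lemma del_spec s B : primitive s B -> [/\ primitive (s + 1) (del_plus s B),
  primitive (s - 1) (del_minus s B) & ext_d B = del_plus s B + Lop (del_minus s B)].
Proof.
move=> pB; rewrite /del_plus /del_minus /del; case: ifPn => sn.
  exact: (@xgetPex _ (0, 0) [set C | [/\ primitive (s + 1) C.1,
    primitive (s - 1) C.2 & ext_d B = C.1 + Lop C.2]] (del_exists sn pB)).
by rewrite (primitive_out pB sn) ext_d0 /= linear0 addr0; split=> //; exact: primitive0.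
Qed.

Lemma del_eq s B C1 C2 : 0 <= s <= n%:Z -> primitive s B -> primitive (s + 1) C1 ->
  primitive (s - 1) C2 -> ext_d B = C1 + Lop C2 ->
  del_plus s B = C1 /\ del_minus s B = C2.
Proof.
move=> sn pB pC1 pC2 dB; have [p1 p2 E] := del_spec pB.
have p1' : primitive (s + 1) (del_plus s B - C1).
  by apply: is_subspaceB => //; exact: is_subspace_primitive.
have p2' : primitive (s - 1) (del_minus s B - C2).
  by apply: is_subspaceB => //; exact: is_subspace_primitive.
have E0 : (del_plus s B - C1) + Lop (del_minus s B - C2) = 0.
  by rewrite linearB/= addrACA -opprD -dB -E subrr.
pose q := absz (n%:Z - s)%R.
(* L^(n-s) kills primitive forms of degree s + 1, while L^(n-s+1) is injective in degree s - 1. *)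
have C20 : del_minus s B - C2 = 0.
  apply: (@Lpow_inj q.+1 _ _ (primitive_forms p2')); first lia.
  have := congr1 (Lpow q) E0; rewrite linearD linear0/=.
  rewrite (primitive_Lpow p1') ?add0r; last lia.
  by rewrite Lpow_Lop.
move: E0; rewrite C20 linear0 addr0 => C10.
by split; exact: subr0_eq.
Qed.

Lemma del_linear s a A B : primitive s A -> primitive s B ->
  del_plus s (a *: A + B) = a *: del_plus s A + del_plus s B /\
  del_minus s (a *: A + B) = a *: del_minus s A + del_minus s B.
Proof.
move=> pA pB; have [sn|sn] := boolP (0 <= s <= n%:Z); last first.
  by rewrite /del_plus /del_minus /del (negbTE sn) /= scaler0 addr0.
have [p1 p2 EA] := del_spec pA; have [p1' p2' EB] := del_spec pB.
apply: del_eq => //.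
- exact: (is_subspace_primitive s).2.
- exact: (is_subspace_primitive _).2.
- exact: (is_subspace_primitive _).2.
rewrite (ext_d_linear a (primitive_forms pA) (primitive_forms pB)) EA EB.
by rewrite linearP/= scalerDr addrACA.
Qed.

Lemma del0 s : del_plus s (0 : cochain M) = 0 /\ del_minus s (0 : cochain M) = 0.
Proof.
have := del_linear (-1) (primitive0 s) (primitive0 s).
by rewrite scaler0 addr0 !scaleN1r !addNr.
Qed.

Lemma Lpow_del_minus s B q : primitive s B -> q%:Z = n%:Z - s ->
  Lpow q.+1 (del_minus s B) = ext_d (Lpow q B).
Proof.
move=> pB qs; have [p1 p2 E] := del_spec pB.
rewrite (ext_d_Lpow _ (primitive_forms pB)) E linearD/=.
rewrite (primitive_Lpow p1) ?add0r; last lia.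
by rewrite Lpow_Lop.
Qed.

Lemma forms_del_minus s B : primitive s B -> forms (s - 1) (del_minus s B).
Proof. by move=> /del_spec[_ /primitive_forms]. Qed.

(** Two uses of [Lpow_del_minus] turn an injective power of L applied to the left-hand side into d d
    (L^(n-s) B). *)
Lemma del_minus_del_minus s B : primitive s B -> del_minus (s - 1) (del_minus s B) = 0.
Proof.
move=> pB; have [p1 p2 E] := del_spec pB.
have [sn|sn] := boolP (0 <= s <= n%:Z); last first.
  by rewrite [del_minus s B](_ : _ = 0) ?(del0 _).2// (primitive_out pB sn) (del0 _).2.
apply: (@Lpow_inj (absz (n%:Z - s)%R).+2 _ _ (forms_del_minus p2)); first lia.
rewrite (Lpow_del_minus p2); last lia.
rewrite (Lpow_del_minus pB); last lia.
by rewrite (ext_d_ext_d (forms_Lpow _ (primitive_forms pB))).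
Qed.

(** So del_+ del_- is d del_-, and the primitive cohomologies can be expressed with d. *)
Lemma ext_d_del_minus s B : primitive s B ->
  ext_d (del_minus s B) = del_plus (s - 1) (del_minus s B).
Proof.
move=> pB; have [_ p2 _] := del_spec pB; have [_ _ ->] := del_spec p2.
by rewrite del_minus_del_minus// linear0 addr0.
Qed.

End LefschetzMaps.

(** * Lefschetz maps on de Rham cohomology *)

Section DeRhamCohomology.
Context (R : realType) (n : nat) (M : symplectic_manifold R n).
Implicit Types (A C D : cochain M) (j k l : int) (q r : nat).
Local Notation forms := (Defs.forms M).
Local Notation exact_forms := (@Defs.exact_forms R (2 * n) M).
Local Notation closed_forms := (@Defs.closed_forms R (2 * n) M).

Lemma is_subspace_closed k : is_subspace (closed_forms k).
Proof.
split; first by split; [exact: forms0|exact: ext_d0].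
move=> a A C [fA dA] [fC dC]; split; first exact: forms_linear.
by rewrite (ext_d_linear a fA fC) dA dC scaler0 addr0.
Qed.

Lemma is_subspace_exact k : is_subspace (exact_forms k).
Proof.
split; first by exists 0; [exact: forms0|exact: ext_d0].
move=> a _ _ [A fA <-] [C fC <-]; exists (a *: A + C); first exact: forms_linear.
exact: ext_d_linear fA fC.
Qed.

Lemma exact_closed k : exact_forms k `<=` closed_forms k.
Proof.
move=> _ [A fA <-]; split; last exact: ext_d_ext_d fA.
by have := forms_ext_d fA; rewrite subrK.
Qed.

Lemma exact_ext_d k l A : forms l A -> l = k - 1 -> exact_forms k (ext_d A).
Proof. by move=> fA lk; exists A => //; rewrite -lk. Qed.

Lemma closed_Lpow r k A : closed_forms k A -> closed_forms (k + 2 * r%:Z) (Lpow r A).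
Proof.
move=> [fA dA]; split; first exact: forms_Lpow.
by rewrite (ext_d_Lpow _ fA) dA Lpow0r.
Qed.

Lemma exact_Lpow r k A : exact_forms k A -> exact_forms (k + 2 * r%:Z) (Lpow r A).
Proof.
move=> [C fC <-]; rewrite -(ext_d_Lpow _ fC).
by apply: exact_ext_d (forms_Lpow r fC) _; lia.
Qed.

Lemma exact0 k : exact_forms k 0.
Proof. by case: (is_subspace_exact k). Qed.

#[local] Hint Resolve is_subspace_closed is_subspace_exact : core.

Lemma is_subspace_kerL r (j l : int) : l = j + 2 * r%:Z ->
  is_subspace [set c : HdR M j | @Lefschetz_graph R n M r j l c 0].
Proof.
move=> lE; split.
  have class0 k : class_is (0 : cochain M) (0 : HdR M k).
    apply/(class_is0 (is_subspace_closed k) (is_subspace_exact k)).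
    by split; [case: (is_subspace_closed k)|case: (is_subspace_exact k)].
  exists 0; split; first exact: class0.
  exact: (eq_ind_r (fun A => class_is A 0) (class0 l) (Lpow0r M r)).
move=> a u v [A [uA LA]] [A' [vA LA']]; exists (a *: A + A'); split.
  exact: class_is_linear.
rewrite Lpow_linear -[X in class_is _ X](_ : a *: (0 : HdR M l) + 0 = 0).
  exact: class_is_linear.
by rewrite scaler0 addr0.
Qed.

(** L^r preserves exactness, so any representative may be tested. *)
Lemma Lefschetz_graph0P r (j l : int) (A : cochain M) (c : HdR M j) : l = j + 2 * r%:Z ->
  class_is A c ->
  (@Lefschetz_graph R n M r j l c 0 <-> exact_forms l (Lpow r A)).
Proof.
move=> lE Ac; have cA := class_is_mem (is_subspace_closed _) Ac.
split=> [[A' [A'c /(class_is0 (is_subspace_closed l) (is_subspace_exact l))[_ eA']]]|eA].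
  rewrite -(subrK A' A) -[A - A']scale1r Lpow_linear.
  apply: (is_subspace_exact _).2 => //; rewrite lE; apply: exact_Lpow.
  exact: class_is_eq Ac A'c.
exists A; split=> //; apply/class_is0 => //; split=> //.
by rewrite lE; exact: closed_Lpow.
Qed.

Lemma is_subspace_imL r (j l : int) : l = j + 2 * r%:Z ->
  is_subspace [set c' : HdR M l | exists c : HdR M j, Lefschetz_graph r c c'].
Proof.
move=> lE; split.
  by exists 0; case: (is_subspace_kerL lE).
move=> a u v [c [A [cA uA]]] [c' [A' [cA' uA']]].
exists (a *: c + c'), (a *: A + A'); rewrite Lpow_linear.
by split; exact: class_is_linear.
Qed.

Lemma Lefschetz_imageP r (j l : int) (D : cochain M) (c' : HdR M l) : l = j + 2 * r%:Z ->
  class_is D c' ->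
  ((exists c : HdR M j, Lefschetz_graph r c c') <->
   exists G F, [/\ closed_forms j G, exact_forms l F & D = F + Lpow r G]).
Proof.
move=> lE Dc'; have cD := class_is_mem (is_subspace_closed _) Dc'.
split=> [[c [A [Ac LAc']]]|[G [F [cG eF DE]]]].
  exists A, (D - Lpow r A); split.
  - exact: (class_is_mem (is_subspace_closed _) Ac).
  - exact: class_is_eq Dc' LAc'.
  - by rewrite subrK.
have [c Gc] := class_is_ex (exact_forms j) (is_subspace_closed _) cG.
exists c, G; split => //.
have -> : Lpow r G = D - F by rewrite DE addrC addKr.
rewrite -[c']subr0; apply: linear_relB Dc' _; first exact: class_is_linear.
apply/class_is0 => //; split=> //.
have -> : F = D - Lpow r G by rewrite DE addrK.
by apply: is_subspaceB => //; rewrite lE; exact: closed_Lpow.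
Qed.

(** The exact sequence 0 -> coker -> Z / B -> ker -> 0 on representatives: [f] stands for the map to
    the kernel and [g] for the map from the cokernel. The three hypotheses on [f] give its values,
    their independence of B and surjectivity; the two on [g] give its values and injectivity; the
    last two give exactness in the middle. *)
Lemma cohomology_split r (j l j' l' : int) (Z B : set (cochain M))
    (f g : cochain M -> cochain M -> Prop) :
  l = j + 2 * r%:Z -> l' = j' + 2 * r%:Z ->
  is_subspace Z -> is_subspace B -> linear_rel f -> linear_rel g ->
  (forall A, Z A -> exists C,
    [/\ f A C, closed_forms j C & exact_forms l (Lpow r C)]) ->
  (forall A C, Z A -> B A -> f A C -> closed_forms j C -> exact_forms j C) ->
  (forall C, closed_forms j C -> exact_forms l (Lpow r C) ->
    exists2 A, Z A & f A C) ->
  (forall D, closed_forms l' D -> exists2 A, Z A & g D A) ->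
  (forall D A, closed_forms l' D -> Z A -> g D A ->
    (B A <->
     exists G F, [/\ closed_forms j' G, exact_forms l' F & D = F + Lpow r G])) ->
  (forall A C, Z A -> f A C -> exact_forms j C ->
    exists D A', [/\ closed_forms l' D, Z A', g D A' & B (A - A')]) ->
  (forall D A, closed_forms l' D -> Z A -> g D A ->
    exists2 C, exact_forms j C & f A C) ->
  subquotient Z B ≅ kerL M r j l ⊕ cokerL M r j' l'.
Proof.
move=> lE l'E SZ SB lf lg totf f0 surf totg injg kerf compl.
pose F (x : subquotient Z B) (u : kerL M r j l) :=
  exists A C, [/\ class_is A x, f A C & class_is C (val u)].
pose G (c : cokerL M r j' l') (x : subquotient Z B) := exists D A h,
  [/\ c = \pi_(quotient _)%qT h, class_is D h, g D A & class_is A x].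
apply: (@split_exact _ _ _ _ F G).
- move=> a x x' u u' [A [C [Ax fAC Cu]]] [A' [C' [Ax' fAC' Cu']]].
  exists (a *: A + A'), (a *: C + C'); split; [exact: class_is_linear|exact: lf|].
  exact: class_is_linear.
- move=> x; have [A ZA Ax] := class_is_rep SZ x.
  have [C [fAC cC eLC]] := totf A ZA.
  have [c Cc] := class_is_ex (exact_forms j) (is_subspace_closed j) cC.
  have /(subspaceP _ (is_subspace_kerL lE)) cker := (Lefschetz_graph0P lE Cc).2 eLC.
  by exists (Subspace cker), A, C.
- move=> u [A [C [/(class_is0 SZ SB)[ZA BA] fAC Cu]]].
  have cC := class_is_mem (is_subspace_closed _) Cu.
  apply: val_inj; apply: class_is_fun Cu _ => //; apply/class_is0 => //.
  by split=> //; exact: f0 fAC _.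
- move=> u; have /(subspaceP _ (is_subspace_kerL lE)) uker := subspace_valP u.
  have [C cC Cu] := class_is_rep (is_subspace_closed j) (val u).
  have /(Lefschetz_graph0P lE Cu) eLC := uker.
  have [A ZA fAC] := surf C cC eLC.
  by have [x Ax] := class_is_ex (B) SZ ZA; exists x, A, C.
- move=> a _ _ x x' [D [A [h [-> Dh gDA Ax]]]] [D' [A' [h' [-> Dh' gDA' Ax']]]].
  exists (a *: D + D'), (a *: A + A'), (a *: h + h').
  split; [exact/esym/quotient_pi_linear|exact: class_is_linear|exact: lg|].
  exact: class_is_linear.
- move=> c; have [h ->] := quotient_pi c.
  have [D cD Dh] := class_is_rep (is_subspace_closed l') h.
  have [A ZA gDA] := totg D cD; have [x Ax] := class_is_ex (B) SZ ZA.
  by exists x, D, A, h.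
- move=> x [D [A [h [/esym/(quotient_pi0 _ (is_subspace_imL l'E))/= imh Dh gDA Ax]]]].
  have ZA := class_is_mem SZ Ax.
  apply: class_is_fun Ax _ => //; apply/class_is0 => //; split=> //.
  apply/(injg D) => //; first exact: class_is_mem Dh.
  exact/(Lefschetz_imageP l'E Dh).
- move=> _ [D [A [h [-> Dh gDA /(class_is0 SZ SB)[ZA BA]]]]].
  apply/quotient_pi0; first exact: is_subspace_imL.
  apply/(Lefschetz_imageP l'E Dh); apply/(injg D A) => //.
  exact: class_is_mem Dh.
- move=> x; split=> [[A [C [Ax fAC /(class_is0 (is_subspace_closed j) (is_subspace_exact j))[cC eC]]]]|].
    have ZA := class_is_mem SZ Ax.
    have [D [A' [cD ZA' gDA' BA]]] := kerf A C ZA fAC eC.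
    have [h Dh] := class_is_ex (exact_forms l') (is_subspace_closed _) cD.
    exists (\pi_(quotient _)%qT h), D, A', h; split=> //.
    rewrite -[x]subr0 -(subKr A A'); apply: linear_relB Ax _.
      exact: class_is_linear.
    by apply/class_is0 => //; split=> //; exact: is_subspaceB.
  move=> [c [D [A [h [_ Dh gDA Ax]]]]].
  have ZA := class_is_mem SZ Ax; have cD := class_is_mem (is_subspace_closed _) Dh.
  have [C eC fAC] := compl D A cD ZA gDA.
  exists A, C; split=> //; apply/class_is0 => //; split=> //.
  exact: exact_closed.
Qed.

End DeRhamCohomology.

(** * Lefschetz decomposition *)

Section LefschetzDecomposition.
Context (R : realType) (n : nat) (M : symplectic_manifold R n).
Implicit Types (A C E : cochain M) (B : nat -> cochain M) (k l s : int) (p q r : nat).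
Local Notation forms := (Defs.forms M).
Local Notation primitive := (@Defs.primitive R n M).

(** The conditions on the components alone, without the form they decompose, so that families can be
    shifted or truncated. *)
Definition Lefschetz_family k B :=
  (forall r, k - n%:Z <= r%:Z -> 2 * r%:Z <= k -> primitive (k - 2 * r%:Z) (B r)) /\
  (forall r, ~ (k - n%:Z <= r%:Z /\ 2 * r%:Z <= k) -> B r = 0).

Lemma family_primitive k B r : Lefschetz_family k B -> primitive (k - 2 * r%:Z) (B r).
Proof.
move=> [pB B0]; have [/andP[kr rk]|kr] := boolP ((k - n%:Z <= r%:Z) && (2 * r%:Z <= k)).
  exact: pB.
by rewrite B0; [exact: primitive0|move=> /andP; apply/negP].
Qed.

Lemma family_eq0 k B r : Lefschetz_family k B ->
  ~~ ((k - n%:Z <= r%:Z) && (2 * r%:Z <= k)) -> B r = 0.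
Proof. by move=> [_ B0] kr; apply: B0 => /andP; apply/negP. Qed.

Lemma family_Lpow k B r q : Lefschetz_family k B -> n%:Z + 1 - k + 2 * r%:Z <= q%:Z ->
  Lpow q (B r) = 0.
Proof. by move=> fB kq; apply: primitive_Lpow (family_primitive r fB) _; lia. Qed.

(* Top-down in q: applying L^(n-k+q-c) to the sum kills the terms r < q and
   leaves L^(n-(k-2q)) (B q). For c = 0 this is uniqueness of the
   decomposition. *)
Lemma family_unique k B (c : int) : Lefschetz_family k B ->
  (forall r, k - n%:Z <= r%:Z -> 2 * r%:Z <= k -> 0 <= c + r%:Z) ->
  \sum_(r < n.+1) Lpow (absz (c + r%:Z)%R) (B r) = 0 ->
  forall r, c - n%:Z + k <= r%:Z -> B r = 0.
Proof.
move=> fB c0 S0.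
suff H N : forall r, (n < r + N)%N -> c - n%:Z + k <= r%:Z -> B r = 0.
  by move=> r; apply: (H n.+1); lia.
elim: N => [q nq _|N IH q nq cq]; first by apply: (family_eq0 fB); lia.
have [qN|qN] := ltnP n (q + N); first exact: IH.
have [/andP[kq qk]|kq] := boolP ((k - n%:Z <= q%:Z) && (2 * q%:Z <= k)); last first.
  exact: family_eq0 fB kq.
have qn : (q < n.+1)%N by lia.
have := congr1 (Lpow (absz (n%:Z - k + q%:Z - c)%R)) S0.
rewrite linear0 linear_sum/= (bigD1 (Ordinal qn))//= big1 ?addr0 => [|r rq]; last first.
  have [/andP[kr rk]|kr] := boolP ((k - n%:Z <= r%:Z) && (2 * r%:Z <= k)); last first.
    by rewrite (family_eq0 fB kr) !linear0.
  have cr := c0 r kr rk.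
  have : (r : nat) != q by apply: contra rq => /eqP rq; apply/eqP/val_inj.
  rewrite neq_ltn => /orP[rq'|rq']; last first.
    by rewrite (IH r) ?linear0//; lia.
  by rewrite -LpowD (family_Lpow fB)//; lia.
have cq0 := c0 q kq qk.
rewrite -LpowD; apply: Lpow_inj; first exact: primitive_forms (family_primitive q fB).
lia.
Qed.

(* *_r sends L^r B_s to L^r' B_s with r' - r = n - k. *)
Definition shift_family k B : nat -> cochain M := fun r =>
  if 0 <= r%:Z + (k - n%:Z) then B (absz (r%:Z + (k - n%:Z))%R) else 0.

Lemma Lefschetz_shift k B : Lefschetz_family k B ->
  Lefschetz_family (2 * n%:Z - k) (shift_family k B).
Proof.
move=> fB; split=> [r nr rn|r nr]; rewrite /shift_family; case: ifPn => // r0.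
- have := family_primitive (absz (r%:Z + (k - n%:Z))%R) fB.
  by congr (primitive _ _); lia.
- exact: primitive0.
- by apply: (family_eq0 fB); lia.
Qed.

Lemma shift_shift k B : Lefschetz_family k B ->
  shift_family (2 * n%:Z - k) (shift_family k B) = B.
Proof.
move=> fB; apply/funext => r; rewrite /shift_family.
case: ifPn => [r0|r0]; last by rewrite (family_eq0 fB)//; lia.
rewrite ifT; last by lia.
by congr B; lia.
Qed.

Lemma sum_shift k B : Lefschetz_family k B ->
  \sum_(r < n.+1) Lpow r (shift_family k B r) =
  \sum_(r < n.+1) Lpow (absz (n%:Z - r%:Z - (k - 2 * r%:Z))%R) (B r).
Proof.
move=> fB.
(* The shift r' = r + k - n need not map the index range to itself. Both sides are therefore written
   as the sum of [K] over all pairs, indices outside the range contributing 0. *)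
pose K (r r' : nat) : cochain M := if r%:Z + (k - n%:Z) == r'%:Z then Lpow r (B r') else 0.
transitivity (\sum_(r < n.+1) \sum_(r' < n.+1) K r r').
  apply: eq_bigr => r _; rewrite /shift_family; case: ifPn => r0; last first.
    rewrite linear0 big1// => r' _; rewrite /K ifF//; lia.
  set r1 := absz _; have r1E : r1%:Z = r%:Z + (k - n%:Z) by lia.
  have [r1n|r1n] := ltnP r1 n.+1.
    rewrite (bigD1 (Ordinal r1n))//= big1 ?addr0 => [|r' r'r]; last first.
      rewrite /K ifF//; apply/negP => /eqP E; move/eqP: r'r; apply.
      by apply: val_inj => /=; lia.
    by rewrite /K ifT//; apply/eqP.
  rewrite (family_eq0 fB) ?linear0; last by lia.
  rewrite big1// => r' _; rewrite /K ifF//; apply/negP => /eqP E.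
  by have := ltn_ord r'; lia.
rewrite exchange_big/=; apply: eq_bigr => r' _.
have [/andP[kr rk]|kr] := boolP ((k - n%:Z <= r'%:Z) && (2 * r'%:Z <= k)); last first.
  rewrite (family_eq0 fB kr) linear0 big1// => r _.
  by rewrite /K (family_eq0 fB kr) linear0 if_same.
set r1 := absz _; have r1n : (r1 < n.+1)%N by lia.
rewrite (bigD1 (Ordinal r1n))//= big1 ?addr0 => [|r rr]; last first.
  rewrite /K ifF//; apply/negP => /eqP E; move/eqP: rr; apply.
  by apply: val_inj => /=; lia.
by rewrite /K ifT//; apply/eqP; lia.
Qed.

Lemma family_forms k B : Lefschetz_family k B ->
  forms k (\sum_(r < n.+1) Lpow r (B r)).
Proof.
move=> fB; apply: is_subspace_sum; first exact: is_subspace_forms.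
move=> r _; apply: eq_forms (forms_Lpow r (primitive_forms (family_primitive r fB))).
by lia.
Qed.

Lemma decompositionP k A B : is_Lefschetz_decomposition k A B <->
  Lefschetz_family k B /\ A = \sum_(r < n.+1) Lpow r (B r).
Proof. by split=> [[]|[[]]]. Qed.

(** Up to degree n, [primitive_split] is iterated. Above n, L^(k-n) is onto from degree 2n - k, and
    it shifts the indices of a decomposition there. *)
Lemma decomposition_exists k A : forms k A ->
  exists B, is_Lefschetz_decomposition k A B.
Proof.
move=> fA; have [k2n|k2n] := boolP ((k < 0) || (2 * n%:Z < k)).
  exists (fun=> 0); split=> //.
    by move=> *; exact: primitive0.
  rewrite big1 => [|r _]; last exact: linear0.
  by apply: forms_eq0 fA _; case/orP: k2n => ?; [left|right; lia].
suff H N : forall k A, k <= n%:Z -> k < N%:Z -> forms k A ->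
    exists B, is_Lefschetz_decomposition k A B.
  have [kn|kn] := leP k n%:Z; first by apply: (H (absz k).+1 _ _ kn _ fA); lia.
  have [|A' fA' AE] := @Lpow_surj _ _ _ (absz (k - n%:Z)%R) _ _ fA; first lia.
  have fA'' : forms (2 * n%:Z - k) A' by apply: eq_forms fA'; lia.
  have [||B /decompositionP[fB BE]] := H (absz (2 * n%:Z - k)%R).+1 _ _ _ _ fA''; [lia|lia|].
  exists (shift_family (2 * n%:Z - k) B); apply/decompositionP; split.
    have := Lefschetz_shift fB; congr (Lefschetz_family _ _); lia.
  rewrite (sum_shift fB) AE BE linear_sum/=; apply: eq_bigr => r _.
  have [/andP[kr rk]|kr] := boolP ((2 * n%:Z - k - n%:Z <= r%:Z) && (2 * r%:Z <= 2 * n%:Z - k)).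
    by rewrite -LpowD; congr Lpow; lia.
  by rewrite (family_eq0 fB kr) !linear0.
elim: N => [k0 A0 _ k00 fA0|N IH k0 A0 kn kN fA0].
  exists (fun=> 0); split=> //.
    by move=> *; exact: primitive0.
  rewrite big1 => [|r _]; last exact: linear0.
  by apply: forms_eq0 fA0 _; left.
have [A1 [A2 [pA1 fA2 AE]]] := primitive_split fA0 kn.
have [||B /decompositionP[fB BE]] := IH _ _ _ _ fA2; [lia|lia|].
have [k00|k00] := ltP k0 0.
  exists (fun=> 0); split=> //.
    by move=> *; exact: primitive0.
  rewrite big1 => [|r _]; last exact: linear0.
  by apply: forms_eq0 fA0 _; left.
exists (fun r => if r is r'.+1 then B r' else A1); apply/decompositionP; split.
  split=> [[|r] nr rn|[|r] nr].
  - by rewrite mulr0 subr0.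
  - by have := family_primitive r fB; congr (primitive _ _); lia.
  - by exfalso; apply: nr; lia.
  - by apply: (family_eq0 fB); lia.
rewrite big_ord_recl/= AE BE; congr (_ + _).
rewrite linear_sum/= big_ord_recr/= (_ : B n = 0) ?linear0 ?addr0//.
by apply: (family_eq0 fB); lia.
Qed.

Lemma Lefschetz_part_family k A : forms k A ->
  Lefschetz_family k (Lefschetz_part k A) /\
  A = \sum_(r < n.+1) Lpow r (Lefschetz_part k A r).
Proof.
move=> /decomposition_exists H; apply/decompositionP.
exact: (@xgetPex _ (fun=> 0) [set B | is_Lefschetz_decomposition k A B] H).
Qed.

Lemma Lefschetz_part_eq k A B : Lefschetz_family k B ->
  A = \sum_(r < n.+1) Lpow r (B r) -> Lefschetz_part k A = B.
Proof.
move=> fB AE.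
have fA : forms k A by rewrite AE; exact: family_forms.
have [fP PE] := Lefschetz_part_family fA.
pose D r := Lefschetz_part k A r - B r.
have fD : Lefschetz_family k D.
  split=> r nr; first move=> rn; rewrite /D.
    apply: is_subspaceB; first exact: is_subspace_primitive.
      exact: family_primitive.
    exact: family_primitive.
  by rewrite fP.2// fB.2// subrr.
apply/funext => r.
have [/andP[kr rk]|kr] := boolP ((k - n%:Z <= r%:Z) && (2 * r%:Z <= k)); last first.
  by rewrite (family_eq0 fP kr) (family_eq0 fB kr).
apply/subr0_eq; apply: (family_unique (c := 0) fD); [lia| |lia].
under eq_bigr do rewrite add0r /D linearB/=.
by rewrite sumrB -AE -PE subrr.
Qed.

Lemma Lefschetz_part_linear k a A C r : forms k A -> forms k C ->
  Lefschetz_part k (a *: A + C) r =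
  a *: Lefschetz_part k A r + Lefschetz_part k C r.
Proof.
move=> fA fC; have [fP PE] := Lefschetz_part_family fA.
have [fQ QE] := Lefschetz_part_family fC.
rewrite (@Lefschetz_part_eq _ _ (fun r => a *: Lefschetz_part k A r + Lefschetz_part k C r))//.
  split=> q nq; first move=> qn.
    by apply: (is_subspace_primitive _ _).2; exact: family_primitive.
  by rewrite fP.2// fQ.2// scaler0 addr0.
under eq_bigr do rewrite linearP/=.
by rewrite big_split/= -scaler_sumr -PE -QE.
Qed.

Lemma Lefschetz_part_primitive k A : 0 <= k <= n%:Z -> primitive k A ->
  Lefschetz_part k A = fun r => if r is 0%N then A else 0.
Proof.
move=> kn pA; apply: Lefschetz_part_eq.
  split=> [[|r] nr rn|[|r] nr]//.
  - by rewrite mulr0 subr0.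
  - exact: primitive0.
  - by exfalso; apply: nr; lia.
by rewrite big_ord_recl big1 ?addr0// => r _; exact: linear0.
Qed.

(** F^p Omega^k as the kernel of L^(n+p+1-k), for k <= n + p + 1. Asking for all larger exponents as
    well avoids an absolute value in the exponent. *)
Definition is_filtered p k A :=
  forms k A /\ forall q, n%:Z + p%:Z + 1 - k <= q%:Z -> Lpow q A = 0.

(** L^(n+p+1-k) kills L^r B_(k-2r) for r <= p by primitivity; the components with r > p are detected
    by [family_unique]. *)
Lemma is_filteredP p k A : k <= n%:Z + p%:Z + 1 -> is_filtered p k A <->
  forms k A /\ forall r, (p < r)%N -> Lefschetz_part k A r = 0.
Proof.
move=> kn; split=> -[fA HA]; split=> //; have [fP PE] := Lefschetz_part_family fA.
  move=> r pr; apply: (family_unique (c := n%:Z + p%:Z + 1 - k) fP); [lia| |lia].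
  rewrite -[RHS](HA (absz (n%:Z + p%:Z + 1 - k)%R)); last lia.
  rewrite [in RHS]PE linear_sum/=; apply: eq_bigr => r' _.
  by rewrite -LpowD; congr Lpow; lia.
move=> q nq; rewrite PE linear_sum/= big1// => r _.
have [pr|pr] := ltnP p r; first by rewrite HA// !linear0.
by rewrite -LpowD (family_Lpow fP)//; lia.
Qed.

Lemma filteredP p k A : (p <= n)%N -> filtered p k A <->
  forms k A /\ forall r, (p < r)%N -> Lefschetz_part k A r = 0.
Proof.
move=> pn; split=> [[A' fA' <-]|[fA HA]].
  have [fP PE] := Lefschetz_part_family fA'.
  pose B r := if (r < p.+1)%N then Lefschetz_part k A' r else 0.
  have fB : Lefschetz_family k B.
    split=> r nr; first move=> rn; rewrite /B; case: ifP => _ //.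
    - exact: family_primitive.
    - exact: primitive0.
    - exact: fP.2.
  have BE : Pi p k A' = \sum_(r < n.+1) Lpow r (B r).
    rewrite /Pi (big_ord_widen _ (fun r => Lpow r (Lefschetz_part k A' r)) (_ : (p.+1 <= n.+1)%N))//.
    rewrite big_mkcond/=; apply: eq_bigr => r _; rewrite /B.
    by case: ifP => // _; rewrite linear0.
  split; first by rewrite BE; exact: family_forms.
  by move=> r pr; rewrite (Lefschetz_part_eq fB BE) /B ltnS leqNgt pr.
exists A => //; have [fP PE] := Lefschetz_part_family fA.
rewrite [RHS]PE /Pi (big_ord_widen _ (fun r => Lpow r (Lefschetz_part k A r)) (_ : (p.+1 <= n.+1)%N))//.
rewrite big_mkcond/=; apply: eq_bigr => r _; case: ifPn => //.
by rewrite -leqNgt => pr; rewrite HA// linear0.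
Qed.

Lemma filteredE p k A : (p <= n)%N -> k <= n%:Z + p%:Z + 1 ->
  filtered p k A <-> is_filtered p k A.
Proof. by move=> pn kn; rewrite filteredP// is_filteredP. Qed.

Lemma Pi_decomposition p k A : (p <= n)%N -> forms k A ->
  exists2 C, forms (k - 2 * p%:Z - 2) C & A = Pi p k A + Lpow p.+1 C.
Proof.
move=> pn fA; have [fP PE] := Lefschetz_part_family fA.
exists (\sum_(r < n.+1 | ~~ (r < p.+1)%N) Lpow (r - p.+1)%N (Lefschetz_part k A r)).
  apply: is_subspace_sum; first exact: is_subspace_forms.
  move=> r pr; apply: eq_forms (forms_Lpow _ (primitive_forms (family_primitive r fP))).
  lia.
rewrite [LHS]PE (bigID (fun r : 'I_n.+1 => (r < p.+1)%N))/=; congr (_ + _).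
  by rewrite /Pi (big_ord_widen _ (fun r => Lpow r (Lefschetz_part k A r)) (_ : (p.+1 <= n.+1)%N)).
rewrite -[Lop _]/(Lpow p.+1 _) Lpow_sum; apply: eq_bigr => r pr.
by rewrite -LpowD subnKC// leqNgt.
Qed.

Lemma is_subspace_filtered p k : is_subspace (is_filtered p k).
Proof.
split=> [|a A C [fA HA] [fC HC]].
  by split=> [|q _]; [exact: forms0|exact: linear0].
split=> [|q qn]; first exact: forms_linear.
by rewrite linearP/= HA// HC// scaler0 addr0.
Qed.

(** F^p meets the image of L^(p+1) only in 0: a common element L^(p+1) X is killed by L^(n+p+1-k),
    and L^(n+2p+2-k) is injective on Omega^(k-2p-2). *)
Lemma Pi_eq p k A C : (p <= n)%N -> k <= n%:Z + p%:Z + 1 -> is_filtered p k A ->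
  forms (k - 2 * p%:Z - 2) C -> Pi p k (A + Lpow p.+1 C) = A.
Proof.
move=> pn kn HA fC; set A' := A + _.
have fA' : forms k A'.
  apply: formsD; first by case: HA.
  by apply: eq_forms (forms_Lpow p.+1 fC); lia.
have [C' fC' E] := Pi_decomposition pn fA'.
have HP : is_filtered p k (Pi p k A').
  by apply/filteredE => //; exists A'.
have [_ HD] := is_subspaceB (is_subspace_filtered p k) HP HA.
have DE : Pi p k A' - A = Lpow p.+1 (C - C').
  rewrite LpowB; apply/eqP; rewrite subr_eq addrAC eq_sym subr_eq.
  by rewrite [_ + A]addrC; apply/eqP; exact: E.
apply/subr0_eq; rewrite DE.
rewrite (_ : C - C' = 0) ?linear0//.
apply: (@Lpow_inj _ _ _ (absz (n%:Z + p%:Z + 1 - k)%R + p.+1) _ _ (formsB fC fC')); first lia.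
by rewrite LpowD -DE HD//; lia.
Qed.

Lemma forms_star k A : forms k A -> forms (2 * n%:Z - k) (star_r k A).
Proof.
move=> /Lefschetz_part_family[fP _].
by rewrite /star_r -(sum_shift fP); exact/family_forms/Lefschetz_shift.
Qed.

Lemma star_linear k a A C : forms k A -> forms k C ->
  star_r k (a *: A + C) = a *: star_r k A + star_r k C.
Proof.
move=> fA fC; rewrite /star_r scaler_sumr -big_split/=; apply: eq_bigr => r _.
by rewrite Lefschetz_part_linear// linearP.
Qed.

Lemma star0 k : star_r k (0 : cochain M) = 0.
Proof.
have := star_linear (-1) (forms0 M k) (forms0 M k).
by rewrite scaler0 addr0 scaleN1r addNr.
Qed.

Lemma star_star k A : forms k A -> star_r (2 * n%:Z - k) (star_r k A) = A.
Proof.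
move=> fA; have [fP PE] := Lefschetz_part_family fA.
rewrite {1}/star_r (Lefschetz_part_eq (Lefschetz_shift fP)); last first.
  by rewrite (sum_shift fP).
by rewrite -(sum_shift (Lefschetz_shift fP)) shift_shift.
Qed.

Lemma star_starE k l A : forms k A -> l = 2 * n%:Z - k -> star_r l (star_r k A) = A.
Proof. by move=> fA ->; exact: star_star. Qed.

(** The exponent n - r - s of a component of the image, raised by p + 1, reaches the bound n + 1 - s
    of primitivity exactly when r <= p. *)
Lemma star_filtered p k A : (p <= n)%N -> forms k A ->
  filtered p k A <-> Lpow p.+1 (star_r k A) = 0.
Proof.
move=> pn fA; have [fP PE] := Lefschetz_part_family fA.
rewrite filteredP// /star_r Lpow_sum; split=> [[_ HA]|S0].
  apply: big1 => r _.
  have [pr|pr] := ltnP p r; first by rewrite HA// !linear0.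
  have [/andP[kr rk]|kr] := boolP ((k - n%:Z <= r%:Z) && (2 * r%:Z <= k)); last first.
    by rewrite (family_eq0 fP kr) !linear0.
  by rewrite -LpowD (family_Lpow fP)//; lia.
split=> // r pr; apply: (family_unique (c := p%:Z + 1 + n%:Z - k) fP); [lia| |lia].
rewrite -[RHS]S0; apply: eq_bigr => r' _.
have [/andP[kr rk]|kr] := boolP ((k - n%:Z <= r'%:Z) && (2 * r'%:Z <= k)); last first.
  by rewrite (family_eq0 fP kr) !linear0.
by rewrite -LpowD; congr Lpow; lia.
Qed.

Lemma star_primitive k A q : q%:Z = n%:Z - k -> 0 <= k -> primitive k A ->
  star_r k A = Lpow q A.
Proof.
move=> qk k0 pA; rewrite /star_r Lefschetz_part_primitive//; last lia.
rewrite big_ord_recl/= big1 ?addr0 => [|r _]; last exact: linear0.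
by congr Lpow; lia.
Qed.

End LefschetzDecomposition.

(** * The isomorphisms *)

Lemma scalerDACA (K : pzRingType) (V : lmodType K) (a : K) (x y x' y' : V) :
  a *: (x + y) + (x' + y') = (a *: x + x') + (a *: y + y').
Proof. by rewrite scalerDr addrACA. Qed.

Lemma addrBK (V : zmodType) (x y z : V) : x + y + (z - y) = x + z.
Proof. by rewrite addrACA subrr addr0. Qed.

(** * Filtered cohomology of d_+ *)

Section FilteredPlusCohomology.
Context (R : realType) (n : nat) (M : symplectic_manifold R n).
Implicit Types (A C D E F G : cochain M) (k l s : int) (p q r : nat).
Local Notation forms := (Defs.forms M).
Local Notation primitive := (@Defs.primitive R n M).
Local Notation exact_forms := (@Defs.exact_forms R (2 * n) M).
Local Notation closed_forms := (@Defs.closed_forms R (2 * n) M).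
Local Notation is_filtered := (@is_filtered R n M).

Lemma PiP p k A A0 : (p <= n)%N -> k <= n%:Z + p%:Z + 1 -> forms k A ->
  Pi p k A = A0 <-> is_filtered p k A0 /\
    exists2 C, forms (k - 2 * p%:Z - 2) C & A = A0 + Lpow p.+1 C.
Proof.
move=> pn kn fA; split=> [<-|[FA0 [C fC ->]]]; last exact: Pi_eq.
by split; [apply/filteredE => //; exists A|exact: Pi_decomposition].
Qed.

Section FilteredPlus.
Variables (p : nat) (k : int).
Hypotheses (pn : (p <= n)%N) (knp : k < n%:Z + p%:Z).

(** Cocycles of the cokernel complex of L^(p+1), represented in F^p; [B] gives its coboundaries. *)
Let Z : set (cochain M) := [set A | is_filtered p k A /\
  exists2 C, forms (k - 2 * p%:Z - 1) C & ext_d A = Lpow p.+1 C].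

Let B : set (cochain M) := [set A | is_filtered p k A /\
  exists A' C, [/\ is_filtered p (k - 1) A', forms (k - 2 * p%:Z - 2) C
    & ext_d A' = A + Lpow p.+1 C]].

Let ZE : [set A | filtered p k A /\ d_plus p k A = 0] = Z.
Proof.
have kn : k <= n%:Z + p%:Z + 1 by lia.
have kn1 : k + 1 <= n%:Z + p%:Z + 1 by lia.
apply/seteqP; split=> A /= [].
  move=> /(filteredE _ pn kn) FA P0; split=> //.
  have [_ [C fC ->]] := (PiP 0 pn kn1 (forms_ext_d FA.1)).1 P0.
  by exists C; [apply: eq_forms fC; lia|rewrite add0r].
move=> FA [C fC dA]; split; first exact/filteredE.
apply/(PiP 0 pn kn1 (forms_ext_d FA.1)); split.
  by case: (is_subspace_filtered M p (k + 1)).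
by exists C; [apply: eq_forms fC; lia|rewrite add0r].
Qed.

Let BE : [set d_plus p (k - 1) A | A in filtered p (k - 1)] = B.
Proof.
have kn : k <= n%:Z + p%:Z + 1 by lia.
have kn1 : k - 1 <= n%:Z + p%:Z + 1 by lia.
apply/seteqP; split=> A /=.
  move=> [A' /(filteredE _ pn kn1) FA' <-]; rewrite /d_plus subrK.
  have fdA' : forms k (ext_d A') by have := forms_ext_d FA'.1; rewrite subrK.
  have [FA [C fC E]] := (PiP _ pn kn fdA').1 erefl.
  by split=> //; exists A', C.
move=> [FA [A' [C [FA' fC E]]]]; exists A'; first exact/filteredE.
by rewrite /d_plus subrK E; apply: Pi_eq.
Qed.

Let SZ : is_subspace Z.
Proof.
split.
  split; first by case: (is_subspace_filtered M p k).
  by exists 0; [exact: forms0|rewrite ext_d0 Lpow0r].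
move=> a A A' [FA [C fC E]] [FA' [C' fC' E']]; split.
  exact: (is_subspace_filtered M p k).2.
exists (a *: C + C'); first exact: forms_linear.
by rewrite (ext_d_linear a FA.1 FA'.1) E E' Lpow_linear.
Qed.

Let SB : is_subspace B.
Proof.
split.
  split; first by case: (is_subspace_filtered M p k).
  exists 0, 0; split; [by case: (is_subspace_filtered M p (k - 1))|exact: forms0|].
  by rewrite ext_d0 Lpow0r addr0.
move=> a A A' [FA [D [C [FD fC E]]]] [FA' [D' [C' [FD' fC' E']]]]; split.
  exact: (is_subspace_filtered M p k).2.
exists (a *: D + D'), (a *: C + C'); split.
- exact: (is_subspace_filtered M p (k - 1)).2.
- exact: forms_linear.
rewrite (ext_d_linear a FD.1 FD'.1) E E' Lpow_linear; exact: scalerDACA.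
Qed.

Lemma FH_plus_split : FH_plus M p k ≅
  kerL M p.+1 (k - 2 * p%:Z - 1) (k + 1) ⊕ cokerL M p.+1 (k - 2 * p%:Z - 2) k.
Proof.
rewrite /FH_plus ZE BE.
set i := k - 2 * p%:Z - 2; set j := k - 2 * p%:Z - 1.
have ij : i = j - 1 by rewrite /i /j; lia.
(* f is the connecting map and g the projection, both up to exact forms. *)
pose f A C := forms k A /\
  exists2 E, forms i E & ext_d A = Lpow p.+1 (C + ext_d E).
pose g D A := is_filtered p k A /\
  exists2 E, forms i E & D = A + Lpow p.+1 E.
have fLi E : forms i E -> forms k (Lpow p.+1 E).
  by move=> fE; apply: eq_forms (forms_Lpow p.+1 fE); rewrite /i; lia.
have fdi E : forms i E -> forms j (ext_d E).
  by move=> fE; apply: eq_forms (forms_ext_d fE); lia.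
have injj C D : forms j C -> forms j D -> Lpow p.+1 C = Lpow p.+1 D -> C = D.
  by move=> fC fD; apply: Lpow_eq fC fD _; rewrite /j; lia.
apply: (@cohomology_split _ _ M p.+1 _ _ _ _ Z B f g _ _ SZ SB).
- by rewrite /j; lia.
- by rewrite /i; lia.
- move=> a A A' C C' [fA [E fE EE]] [fA' [E' fE' EE']]; split; first exact: forms_linear.
  exists (a *: E + E'); first exact: forms_linear.
  rewrite (ext_d_linear a fA fA') EE EE' -Lpow_linear (ext_d_linear a fE fE').
  congr (Lpow _ _); exact: scalerDACA.
- move=> a D D' A A' [FA [E fE ->]] [FA' [E' fE' ->]]; split.
    exact: (is_subspace_filtered M p k).2.
  exists (a *: E + E'); first exact: forms_linear.
  rewrite Lpow_linear; exact: scalerDACA.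
- move=> A [FA [C fC dA]]; exists C; split.
  + split; first exact: FA.1.
    by exists 0; [exact: forms0|rewrite ext_d0 addr0].
  + split=> //; have fdC := forms_ext_d fC.
    (* L^(p+1) is injective on Omega^(k-2p) because k < n + p. *)
    apply: (Lpow_inj (q := p.+1) fdC); first by lia.
    by rewrite -(ext_d_Lpow _ fC) -dA (ext_d_ext_d FA.1).
  + by rewrite -dA; apply: exact_ext_d FA.1 _; lia.
- move=> A C _ [FA [A' [E' [FA' fE' dA']]]] [_ [E fE dA]] [fC _].
  have E0 : C + ext_d E = - ext_d E'.
    apply: injj; [exact/formsD/fdi|exact/formsN/fdi|].
    rewrite -dA LpowN; apply/eqP; rewrite -addr_eq0 -(ext_d_Lpow _ fE').
    by rewrite -(ext_dD FA.1 (fLi _ fE')) -dA' (ext_d_ext_d FA'.1).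
  have -> : C = ext_d (- E' - E).
    by rewrite (ext_dB (formsN fE') fE) (ext_dN fE') -E0 addrK.
  by apply: exact_ext_d (formsB (formsN fE') fE) _.
- move=> C [fC dC] [A fA' EA]; have fA : forms k A by rewrite addrK in fA'.
  have kn : k <= n%:Z + p%:Z + 1 by lia.
  have [FA0 [E fE AE]] := (PiP _ pn kn fA).1 erefl.
  (* Projecting A to F^p changes C by the exact form d E, which [f] allows. *)
  have dA0 : ext_d (Pi p k A) = Lpow p.+1 (C - ext_d E).
    rewrite LpowB -EA {2}AE (ext_dD FA0.1 (fLi _ fE)) (ext_d_Lpow _ fE).
    by rewrite addrK.
  exists (Pi p k A).
    by split=> //; exists (C - ext_d E) => //; exact/formsB/fdi.
  split; first exact: FA0.1.
  exists (- E); first exact: formsN.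
  by rewrite (ext_dN fE).
- move=> D [fD dD]; have kn : k <= n%:Z + p%:Z + 1 by lia.
  have [FA [E fE DE]] := (PiP _ pn kn fD).1 erefl.
  exists (Pi p k D); last by split=> //; exists E.
  split=> //; exists (- ext_d E); first exact/formsN/fdi.
  apply/eqP; rewrite LpowN -addr_eq0 -(ext_d_Lpow _ fE).
  by rewrite -(ext_dD FA.1 (fLi _ fE)) -DE dD.
- move=> D A [fD dD] ZA [FA [E fE DE]]; split.
    move=> [_ [A' [E' [FA' fE' dA']]]].
    have DE' : D = ext_d A' + Lpow p.+1 (E - E').
      by rewrite dA' LpowB addrBK -DE.
    exists (E - E'), (ext_d A'); split=> //; last first.
      by apply: exact_ext_d FA'.1 _.
    have fEE := formsB fE fE'; split=> //.
    apply: injj; [exact: fdi|exact: forms0|].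
    rewrite Lpow0r -(ext_d_Lpow _ fEE).
    have -> : Lpow p.+1 (E - E') = D - ext_d A' by rewrite DE' [_ + Lpow _ _]addrC addrK.
    have fdA' : forms k (ext_d A') by have := forms_ext_d FA'.1; rewrite subrK.
    by rewrite (ext_dB fD fdA') dD (ext_d_ext_d FA'.1) subrr.
  move=> [G [_ [[fG dG] [F fF <-] DE']]]; split=> //.
  have kn1 : k - 1 <= n%:Z + p%:Z + 1 by lia.
  have [FF [E' fE' FE]] := (PiP _ pn kn1 fF).1 erefl.
  have fdE' : forms i (ext_d E') by apply: eq_forms (forms_ext_d fE'); rewrite /i; lia.
  (* Only the projection of F lies in F^p; the remainder L^(p+1) E' contributes d E' to the second
     witness. *)
  exists (Pi p (k - 1) F), (E - G - ext_d E'); split=> //.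
    exact: formsB (formsB fE fG) fdE'.
  have fLE' : forms (k - 1) (Lpow p.+1 E').
    by apply: eq_forms (forms_Lpow p.+1 fE'); lia.
  have dF : ext_d F = ext_d (Pi p (k - 1) F) + Lpow p.+1 (ext_d E').
    by rewrite {1}FE (ext_dD FF.1 fLE') (ext_d_Lpow _ fE').
  rewrite !LpowB !addrA -DE DE' dF.
  by rewrite !addrK.
- move=> A C ZA [fA [E fE dA]] [E0 fE0 CE]; have FA := ZA.1.
  have fE0' : forms i E0 by rewrite ij.
  have fS := formsD fE0' fE.
  (* As C = d E0, this correction of A by the image of L^(p+1) is closed and has the same class in
     the cokernel complex. *)
  exists (A - Lpow p.+1 (E0 + E)), A; split=> //.
  + split; first exact/formsB/fLi.
    rewrite (ext_dB fA (fLi _ fS)) (ext_d_Lpow _ fS) dA (ext_dD fE0' fE) CE.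
    by rewrite subrr.
  + split=> //; exists (- (E0 + E)); first exact: formsN.
    by rewrite LpowN.
  + by rewrite subrr; case: SB.
- move=> D A [fD dD] ZA [FA [E fE DE]]; exists 0; first exact: exact0.
  split; first exact: FA.1.
  exists (- E); first exact: formsN.
  apply/eqP; rewrite add0r (ext_dN fE) LpowN -addr_eq0 -(ext_d_Lpow _ fE).
  by rewrite -(ext_dD FA.1 (fLi _ fE)) -DE dD.
Qed.

End FilteredPlus.

End FilteredPlusCohomology.

(** * Filtered cohomology of d_- *)

Section FilteredMinus.
Context (R : realType) (n : nat) (M : symplectic_manifold R n).
Implicit Types (A C D E F G : cochain M).
Local Notation forms := (Defs.forms M).
Local Notation exact_forms := (@Defs.exact_forms R (2 * n) M).
Local Notation closed_forms := (@Defs.closed_forms R (2 * n) M).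
Variables (p : nat) (k : int).
Hypotheses (pn : (p <= n)%N) (knp : k < n%:Z + p%:Z).

Let m : int := 2 * n%:Z - k.

Let fstar A : forms k A -> forms m (star_r k A).
Proof. exact: forms_star. Qed.

Let fstar' A : forms m A -> forms k (star_r m A).
Proof. by move=> fA; apply: eq_forms (forms_star fA); rewrite /m; lia. Qed.

Let starK A : forms m A -> star_r k (star_r m A) = A.
Proof. by move=> fA; apply: star_starE => //; rewrite /m; lia. Qed.

Let starK' A : forms k A -> star_r m (star_r k A) = A.
Proof. by move=> fA; apply: star_starE. Qed.

(** Through the involution [star_r], cocycles of the kernel complex of L^(p+1) in degree m, with d
    in place of d_-; [B] gives its coboundaries. *)
Let Z : set (cochain M) := [set A | [/\ forms k A, Lpow p.+1 (star_r k A) = 0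
  & ext_d (star_r k A) = 0]].

Let B : set (cochain M) := [set A | forms k A /\
  exists E, [/\ forms (m - 1) E, Lpow p.+1 E = 0 & star_r k A = ext_d E]].

Let fdm E : forms (m - 1) E -> forms m (ext_d E).
Proof. by move=> fE; apply: eq_forms (forms_ext_d fE); lia. Qed.

Let ZE : [set A | filtered p k A /\ d_minus k A = 0] = Z.
Proof.
apply/seteqP; split=> A /=; rewrite /d_minus.
  move=> [FA dA]; have [fA _] := (filteredP _ _ pn).1 FA.
  split=> //; first exact/(star_filtered pn fA).
  have fd := forms_ext_d (fstar fA).
  have := star_starE fd (erefl : 2 * n%:Z - (m + 1) = _).
  by rewrite /m dA star0.
move=> [fA LA dA]; split; first exact/star_filtered.
by rewrite dA star0.
Qed.

Let BE : [set d_minus (k + 1) A | A in filtered p (k + 1)] = B.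
Proof.
have km : 2 * n%:Z - (k + 1) = m - 1 by rewrite /m; lia.
have km' : 2 * n%:Z - (k + 1) + 1 = m by rewrite /m; lia.
apply/seteqP; split=> A /=; rewrite /d_minus km'.
  move=> [A' FA' <-]; have [fA' _] := (filteredP _ _ pn).1 FA'.
  have fS : forms (m - 1) (star_r (k + 1) A') by rewrite -km; exact: forms_star.
  split; first exact/fstar'/fdm.
  exists (star_r (k + 1) A'); split=> //; first exact/star_filtered.
  exact/starK/fdm.
move=> [fA [E [fE LE SE]]].
have fE' : forms (k + 1) (star_r (m - 1) E).
  by apply: eq_forms (forms_star fE); lia.
have SK : star_r (k + 1) (star_r (m - 1) E) = E.
  by apply: star_starE fE _; lia.
exists (star_r (m - 1) E); first by apply/star_filtered => //; rewrite SK.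
by rewrite SK -SE starK'.
Qed.

Let SZ : is_subspace Z.
Proof.
split; first by split; rewrite ?star0 ?Lpow0r ?ext_d0//; exact: forms0.
move=> a A A' [fA LA dA] [fA' LA' dA']; split; first exact: forms_linear.
  by rewrite (star_linear a fA fA') Lpow_linear LA LA' scaler0 addr0.
by rewrite (star_linear a fA fA') (ext_d_linear a (fstar fA) (fstar fA')) dA dA' scaler0 addr0.
Qed.

Let SB : is_subspace B.
Proof.
split.
  split; first exact: forms0.
  by exists 0; rewrite star0 Lpow0r ext_d0; split=> //; exact: forms0.
move=> a A A' [fA [E [fE LE SE]]] [fA' [E' [fE' LE' SE']]].
split; first exact: forms_linear.
exists (a *: E + E'); split; first exact: forms_linear.
  by rewrite Lpow_linear LE LE' scaler0 addr0.
by rewrite (star_linear a fA fA') SE SE' (ext_d_linear a fE fE').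
Qed.

Lemma FH_minus_split : FH_minus M p k ≅
  kerL M p.+1 m (m + 2 * p%:Z + 2) ⊕ cokerL M p.+1 (m - 1) (m + 2 * p%:Z + 1).
Proof.
rewrite /FH_minus ZE BE.
(* Here [f] is the inclusion of the kernel complex, up to exact forms, and [g] the connecting map:
   lift D to E through L^(p+1) and take d E. *)
pose f A C := forms k A /\
  exists2 E, forms (m - 1) E & C = star_r k A + ext_d E.
pose g D A := exists E, [/\ forms (m - 1) E, D = Lpow p.+1 E, forms k A
  & star_r k A = ext_d E].
have surj E : forms (m + 2 * p%:Z + 1) E -> exists2 F, forms (m - 1) F & E = Lpow p.+1 F.
  move=> fE; have [|F fF ->] := Lpow_surj (q := p.+1) fE; first by rewrite /m; lia.
  by exists F => //; apply: eq_forms fF; lia.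
apply: (@cohomology_split _ _ M p.+1 _ _ _ _ Z B f g _ _ SZ SB).
- lia.
- lia.
- move=> a A A' C C' [fA [E fE ->]] [fA' [E' fE' ->]]; split; first exact: forms_linear.
  exists (a *: E + E'); first exact: forms_linear.
  rewrite (star_linear a fA fA') (ext_d_linear a fE fE'); exact: scalerDACA.
- move=> a D D' A A' [E [fE -> fA SA]] [E' [fE' -> fA' SA']].
  exists (a *: E + E'); split; [exact: forms_linear|by rewrite Lpow_linear|exact: forms_linear|].
  by rewrite (star_linear a fA fA') SA SA' (ext_d_linear a fE fE').
- move=> A [fA LA dA]; exists (star_r k A); split.
  + split=> //; exists 0; first exact: forms0.
    by rewrite ext_d0 addr0.
  + by split=> //; exact: fstar.
  + by rewrite LA; exact: exact0.
- move=> A C [fA LA dA] [_ [E' [fE' LE' SE']]] [_ [E fE ->]] [fC _].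
  rewrite SE' -(ext_dD fE' fE).
  by apply: exact_ext_d (formsD fE' fE) _.
- move=> C [fC dC] [F fF EF].
  have [|E fE FE] := surj F; first by apply: eq_forms fF; lia.
  have fCE : forms m (C - ext_d E) by exact/formsB/fdm.
  exists (star_r m (C - ext_d E)).
    split; [exact: fstar'| |].
      rewrite starK// LpowB -EF FE (ext_d_Lpow _ fE); exact: subrr.
    rewrite starK// (ext_dB fC (fdm fE)) dC (ext_d_ext_d fE); exact: subrr.
  split; first exact: fstar'.
  by exists E => //; rewrite starK// subrK.
- move=> D [fD dD]; have [E fE DE] := surj D fD.
  exists (star_r m (ext_d E)).
    split; [exact/fstar'/fdm| |].
      by rewrite starK ?(ext_d_Lpow _ fE)//; [rewrite -(ext_d_Lpow _ fE) -DE|exact: fdm].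
    by rewrite starK; [exact: ext_d_ext_d fE|exact: fdm].
  exists E; split=> //; first exact/fstar'/fdm.
  exact/starK/fdm.
- move=> D A [fD dD] ZA [E [fE DE fA SA]]; split.
    move=> [_ [E' [fE' LE' SE']]].
    exists (E - E'), 0; split; [|exact: exact0|by rewrite add0r LpowB LE' subr0].
    split; first exact: formsB.
    by rewrite (ext_dB fE fE') -SA -SE' subrr.
  move=> [G [_ [[fG dG] [F fF <-] DE']]]; split=> //.
  (* L^(p+1) is onto Omega^(m+2p) because k < n + p. *)
  have [|F' fF' FF'] := Lpow_surj (q := p.+1) fF; first by rewrite /m; lia.
  have fF'' : forms (m - 1 - 1) F' by apply: eq_forms fF'; lia.
  have fdF' : forms (m - 1) (ext_d F').
    by apply: eq_forms (forms_ext_d fF''); lia.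
  exists (E - ext_d F' - G); split.
  + exact: formsB (formsB fE fdF') fG.
  + rewrite !LpowB -DE DE' FF' (ext_d_Lpow _ fF'').
    by rewrite addrAC addrK subrr.
  + rewrite (ext_dB (formsB fE fdF') fG) (ext_dB fE fdF') dG (ext_d_ext_d fF'').
    by rewrite !subr0.
- move=> A C ZA [fA [E fE ->]] [E'' fE'' EE].
  have SA : star_r k A = ext_d (E'' - E).
    by rewrite (ext_dB fE'' fE) EE addrK.
  have fEE := formsB fE'' fE.
  exists (Lpow p.+1 (E'' - E)), A; split=> //.
  + split; first by apply: eq_forms (forms_Lpow p.+1 fEE); lia.
    by rewrite (ext_d_Lpow _ fEE) -SA; case: ZA.
  + by exists (E'' - E).
  + by rewrite subrr; case: SB.
- move=> D A [fD dD] ZA [E [fE DE fA SA]]; exists 0; first exact: exact0.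
  split=> //; exists (- E); first exact: formsN.
  by rewrite (ext_dN fE) SA subrr.
Qed.

End FilteredMinus.

(** * Cohomologies of d + d^Lambda and dd^Lambda *)

Section PrimitiveCohomologies.
Context (R : realType) (n : nat) (M : symplectic_manifold R n).
Implicit Types (A C D E F G : cochain M).
Local Notation forms := (Defs.forms M).
Local Notation primitive := (@Defs.primitive R n M).
Local Notation exact_forms := (@Defs.exact_forms R (2 * n) M).
Local Notation closed_forms := (@Defs.closed_forms R (2 * n) M).
Variables (q : nat) (k : int).
Hypotheses (kq : q%:Z = n%:Z - k) (k0 : 0 <= k).

Let l : int := 2 * n%:Z - k.

Let fdk E : forms (k - 1) E -> forms k (ext_d E).
Proof. by move=> fE; apply: eq_forms (forms_ext_d fE); lia. Qed.

(** L^q maps Omega^k = P^k + L Omega^(k-2) onto Omega^l. So P^k represents the cokernel of L^(q+1)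
    on Omega^(k-2). *)
Let surj D : forms l D -> exists A E,
  [/\ primitive k A, forms (k - 2) E & D = Lpow q A + Lpow q.+1 E].
Proof.
move=> fD; have [|D' fD' ->] := Lpow_surj (q := q) fD; first by rewrite /l; lia.
have fD'' : forms k D' by apply: eq_forms fD'; rewrite /l; lia.
have [|A [E [pA fE ->]]] := primitive_split fD''; first by lia.
by exists A, E; rewrite LpowDr Lpow_Lop.
Qed.

Let injk A C : forms (k - 1) A -> forms (k - 1) C -> Lpow q.+1 A = Lpow q.+1 C ->
  A = C.
Proof. by move=> fA fC; apply: Lpow_eq fA fC _; lia. Qed.

Section DPlusDLambda.

Let Z : set (cochain M) := [set A | primitive k A /\ ext_d A = 0].
Let B : set (cochain M) := [set A | exists2 F, primitive k F & A = ext_d (del_minus k F)].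

(** The two summands have degrees k + 1 and k - 1, so they vanish separately. *)
Let ZE : [set A | primitive k A /\ del_plus k A + del_minus k A = 0] = Z.
Proof.
apply/seteqP; split=> A /= [pA]; have [p1 p2 dA] := del_spec pA => A0; split=> //.
  have f1 := primitive_forms p1; have f2 := primitive_forms p2.
  have E : del_plus k A = - del_minus k A by apply/eqP; rewrite -addr_eq0 A0.
  have P0 : del_plus k A = 0.
    apply: (forms_degree f1 (l := k - 1)); last by apply/eqP; lia.
    by rewrite E; exact: formsN.
  by rewrite dA P0 -[del_minus k A]opprK -E P0 oppr0 linear0 addr0.
have [||-> ->] := @del_eq _ _ M k A 0 0 _ pA (primitive0 _ _) (primitive0 _ _).
- lia.
- by rewrite A0 linear0 addr0.
- by rewrite addr0.
Qed.

Let BE : [set del_plus (k - 1) (del_minus k A) | A in primitive k] = B.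
Proof.
apply/seteqP; split=> A /=.
  by move=> [F pF <-]; exists F => //; rewrite ext_d_del_minus.
by move=> [F pF ->]; exists F => //; rewrite ext_d_del_minus.
Qed.

Let SZ : is_subspace Z.
Proof.
split; first by split; [exact: primitive0|exact: ext_d0].
move=> a A A' [pA dA] [pA' dA']; split; first exact: (is_subspace_primitive M k).2.
by rewrite (ext_d_linear a (primitive_forms pA) (primitive_forms pA')) dA dA' scaler0 addr0.
Qed.

Let SB : is_subspace B.
Proof.
split; first by exists 0; [exact: primitive0|rewrite (del0 M k).2 ext_d0].
move=> a _ _ [F pF ->] [F' pF' ->]; exists (a *: F + F').
  exact: (is_subspace_primitive M k).2.
rewrite (del_linear a pF pF').2.
by rewrite (ext_d_linear a (forms_del_minus pF) (forms_del_minus pF')).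
Qed.

Lemma PH_d_plus_dLambda_split : PH_d_plus_dLambda M k ≅
  kerL M q.+1 k (l + 2) ⊕ cokerL M q.+1 (k - 1) (l + 1).
Proof.
rewrite /PH_d_plus_dLambda ZE BE.
(* P^k is the kernel of L^(q+1) on Omega^k: as before, [f] is an inclusion up to exact forms and [g]
   the connecting map, now lifting through the bijection on Omega^(k-1). *)
pose f A C := forms k A /\ exists2 E, forms (k - 1) E & C = A + ext_d E.
pose g D A := exists E, [/\ forms (k - 1) E, D = Lpow q.+1 E & A = ext_d E].
have surj1 D : forms (l + 1) D -> exists2 E, forms (k - 1) E & D = Lpow q.+1 E.
  move=> fD; have [|E fE ->] := Lpow_surj (q := q.+1) fD; first by rewrite /l; lia.
  by exists E => //; apply: eq_forms fE; rewrite /l; lia.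
apply: (@cohomology_split _ _ M q.+1 _ _ _ _ Z B f g _ _ SZ SB).
- by rewrite /l; lia.
- by rewrite /l; lia.
- move=> a A A' C C' [fA [E fE ->]] [fA' [E' fE' ->]]; split; first exact: forms_linear.
  exists (a *: E + E'); first exact: forms_linear.
  rewrite (ext_d_linear a fE fE'); exact: scalerDACA.
- move=> a D D' A A' [E [fE -> ->]] [E' [fE' -> ->]].
  exists (a *: E + E'); split; [exact: forms_linear|by rewrite Lpow_linear|].
  by rewrite (ext_d_linear a fE fE').
- move=> A [pA dA]; have fA := primitive_forms pA; exists A; split=> //.
  + split=> //; exists 0; first exact: forms0.
    by rewrite ext_d0 addr0.
  + by rewrite (primitive_Lpow pA); [exact: exact0|lia].
- move=> A C [pA dA] [F pF AE] [_ [E fE ->]] _; rewrite AE.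
  rewrite -(ext_dD (forms_del_minus pF) fE).
  by apply: exact_ext_d (formsD (forms_del_minus pF) fE) _.
- move=> C [fC dC] [D fD ED].
  have [|E fE DE] := surj1 D; first by apply: eq_forms fD; lia.
  have fCE : forms k (C - ext_d E) by exact/formsB/fdk.
  exists (C - ext_d E).
    split.
      apply: (@primitive_intro _ _ _ _ _ q.+1) => //; first by lia.
      rewrite LpowB -ED DE (ext_d_Lpow _ fE); exact: subrr.
    by rewrite (ext_dB fC (fdk fE)) dC (ext_d_ext_d fE) subrr.
  by split=> //; exists E => //; rewrite subrK.
- move=> D [fD dD]; have [E fE DE] := surj1 D fD.
  exists (ext_d E); last by exists E.
  split; last exact: ext_d_ext_d fE.
  apply: (@primitive_intro _ _ _ _ _ q.+1); [exact: fdk|lia|].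
  by rewrite -(ext_d_Lpow _ fE) -DE.
- move=> D A [fD dD] ZA [E [fE DE AE]]; split.
    move=> [F pF AF]; have fF := forms_del_minus pF.
    exists (E - del_minus k F), (ext_d (Lpow q F)); split.
    + split; first exact: formsB.
      by rewrite (ext_dB fE fF) -AE -AF subrr.
    + apply: exact_ext_d (forms_Lpow q (primitive_forms pF)) _; rewrite /l; lia.
    + by rewrite LpowB -(Lpow_del_minus pF kq) -DE addrC subrK.
  move=> [G [_ [[fG dG] [F fF <-] DE']]].
  have [|F0 [F1 [pF0 fF1 FE]]] := @surj F.
    by apply: eq_forms fF; lia.
  have fF0 := primitive_forms pF0; have fm := forms_del_minus pF0.
  have fF1' : forms (k - 1) (ext_d F1) by apply: eq_forms (forms_ext_d fF1); lia.
  have fLF0 : forms l (Lpow q F0).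
    by apply: eq_forms (forms_Lpow q fF0); rewrite /l; lia.
  have fLF1 : forms l (Lpow q.+1 F1).
    by apply: eq_forms (forms_Lpow q.+1 fF1); rewrite /l; lia.
  (* With F = L^q F0 + L^(q+1) F1, the form d F is L^(q+1) of del_- F0 + d F1. Injectivity
     determines E, and applying d leaves only d del_- F0. *)
  exists F0 => //; have EE : E = del_minus k F0 + ext_d F1 + G.
    apply: injk => //; first exact: formsD (formsD fm fF1') fG.
    rewrite -DE DE' FE (ext_dD fLF0 fLF1) -(Lpow_del_minus pF0 kq).
    by rewrite (ext_d_Lpow _ fF1) !LpowDr.
  rewrite AE EE (ext_dD (formsD fm fF1') fG) (ext_dD fm fF1') dG.
  by rewrite (ext_d_ext_d fF1) !addr0.
- move=> A C ZA [fA [E fE ->]] [E'' fE'' EE].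
  have AE : A = ext_d (E'' - E) by rewrite (ext_dB fE'' fE) EE addrK.
  have fEE := formsB fE'' fE.
  exists (Lpow q.+1 (E'' - E)), A; split=> //.
  + split; first by apply: eq_forms (forms_Lpow q.+1 fEE); rewrite /l; lia.
    by rewrite (ext_d_Lpow _ fEE) -AE (primitive_Lpow ZA.1)//; lia.
  + by exists (E'' - E).
  + by rewrite subrr; case: SB.
- move=> D A [fD dD] ZA [E [fE DE AE]]; exists 0; first exact: exact0.
  split; first exact: primitive_forms ZA.1.
  exists (- E); first exact: formsN.
  by rewrite (ext_dN fE) AE subrr.
Qed.

End DPlusDLambda.

Section DDLambda.

Let Z : set (cochain M) := [set A | primitive k A /\ ext_d (del_minus k A) = 0].
Let B : set (cochain M) := [set A | exists F0 F1,
  [/\ primitive (k - 1) F0, primitive (k + 1) F1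
    & A = del_plus (k - 1) F0 + del_minus (k + 1) F1]].

Let ZE : [set A | primitive k A /\ del_plus (k - 1) (del_minus k A) = 0] = Z.
Proof.
by apply/seteqP; split=> A /= [pA]; rewrite ?ext_d_del_minus// => A0; split=> //;
  rewrite ext_d_del_minus.
Qed.

Let SZ : is_subspace Z.
Proof.
split; first by split; [exact: primitive0|rewrite (del0 M k).2 ext_d0].
move=> a A A' [pA dA] [pA' dA']; split; first exact: (is_subspace_primitive M k).2.
rewrite (del_linear a pA pA').2 (ext_d_linear a (forms_del_minus pA) (forms_del_minus pA')).
rewrite dA dA' scaler0; exact: addr0.
Qed.

Let SB : is_subspace B.
Proof.
split.
  by exists 0, 0; rewrite (del0 M (k - 1)).1 (del0 M (k + 1)).2 addr0; split=> //;
    exact: primitive0.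
move=> a _ _ [F0 [F1 [p0 p1 ->]]] [F0' [F1' [p0' p1' ->]]].
exists (a *: F0 + F0'), (a *: F1 + F1'); split.
- exact: (is_subspace_primitive M _).2.
- exact: (is_subspace_primitive M _).2.
rewrite (del_linear a p0 p0').1 (del_linear a p1 p1').2; exact: scalerDACA.
Qed.

Let primitive_plus F : primitive (k - 1) F -> primitive k (del_plus (k - 1) F).
Proof. by move=> /del_spec[+ _ _]; rewrite subrK. Qed.

Let primitive_minus F : primitive (k + 1) F -> primitive k (del_minus (k + 1) F).
Proof. by move=> /del_spec[_ + _]; rewrite addrK. Qed.

Let Lpow_del_plus F : primitive (k - 1) F ->
  Lpow q (del_plus (k - 1) F) =
  ext_d (Lpow q F) - Lpow q.+1 (del_minus (k - 1) F).
Proof.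
move=> pF; have [_ _ dF] := del_spec pF.
rewrite (ext_d_Lpow _ (primitive_forms pF)) dF LpowDr Lpow_Lop; exact/esym/addrK.
Qed.

Let fm2 F : primitive (k - 1) F -> forms (k - 2) (del_minus (k - 1) F).
Proof. by move=> /forms_del_minus fF; apply: eq_forms fF; lia. Qed.

Let fd1 E : forms (k - 2) E -> forms (k - 1) (ext_d E).
Proof. by move=> fE; apply: eq_forms (forms_ext_d fE); lia. Qed.

Let fL E : forms (k - 2) E -> forms l (Lpow q.+1 E).
Proof. by move=> fE; apply: eq_forms (forms_Lpow q.+1 fE); rewrite /l; lia. Qed.

Let fLq A : forms k A -> forms l (Lpow q A).
Proof. by move=> fA; apply: eq_forms (forms_Lpow q fA); rewrite /l; lia. Qed.

(** Apply d to L^q del_+ F = d (L^q F) - L^(q+1) del_- F and cancel L^(q+1). *)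
Let del_minus_del_plus F : primitive (k - 1) F ->
  del_minus k (del_plus (k - 1) F) = - ext_d (del_minus (k - 1) F).
Proof.
move=> pF; have pX := primitive_plus pF.
apply: injk; [exact: forms_del_minus|exact/formsN/fd1/fm2|].
have fLF := forms_Lpow q (primitive_forms pF); have fdLF := forms_ext_d fLF.
have fLm : forms (k - 1 + 2 * q%:Z + 1) (Lpow q.+1 (del_minus (k - 1) F)).
  by apply: eq_forms (fL (fm2 pF)); rewrite /l; lia.
rewrite (Lpow_del_minus pX kq) (Lpow_del_plus pF).
by rewrite (ext_dB fdLF fLm) (ext_d_ext_d fLF) sub0r (ext_d_Lpow _ (fm2 pF)) LpowN.
Qed.

(** This identifies the denominator of the dd^Lambda cohomology: P^k-components of exact forms of
    degree l are exactly of the type del_+ F0 + del_- F1. *)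
Let exact_component F : forms (l - 1) F -> exists F0 F1 E,
  [/\ primitive (k - 1) F0, primitive (k + 1) F1, forms (k - 2) E &
    ext_d F = Lpow q (del_plus (k - 1) F0 + del_minus (k + 1) F1) + Lpow q.+1 E].
Proof.
move=> fF; have component s G : q = s -> forms (k - 1) G -> exists F0 E,
    [/\ primitive (k - 1) F0, forms (k - 2) E &
     Lpow s (ext_d G) = Lpow q (del_plus (k - 1) F0) + Lpow q.+1 E].
  move=> <- fG; have [|f0 [f1 [p0 ff1 ->]]] := primitive_split fG; first by lia.
  have [_ _ df0] := del_spec p0.
  have ff1' : forms (k - 1) (Lop f1) by apply: eq_forms (forms_Lop ff1); lia.
  exists f0, (del_minus (k - 1) f0 + ext_d f1); split=> //.
    by apply: formsD; [exact: fm2|apply: eq_forms (forms_ext_d ff1); lia].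
  rewrite (ext_dD (primitive_forms p0) ff1') df0 (ext_d_Lop ff1) !LpowDr !Lpow_Lop.
  exact/esym/addrA.
(* For q = 0 the degree of F is k - 1 = n - 1 and only F0 occurs. For q > 0, F is L^(q-1) of a form
   F1 + L G of degree k + 1, and d (L^(q-1) F1) = L^q del_- F1. *)
case: (posnP q) => [q0|q0].
  have [|F0 [E [p0 fE E0]]] := component 0%N F q0.
    by apply: eq_forms fF; rewrite /l; lia.
  exists F0, 0, E; split=> //; first exact: primitive0.
  by rewrite (del0 M (k + 1)).2 addr0 -E0.
have [|F' fF' ->] := Lpow_surj (q := q.-1) fF; first by rewrite /l; lia.
have fF'' : forms (k + 1) F' by apply: eq_forms fF'; rewrite /l; lia.
have [|F1 [G [p1 fG FE]]] := primitive_split fF''; first by lia.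
have fG' : forms (k - 1) G by apply: eq_forms fG; lia.
have [F0 [E [p0 fE E0]]] := component q G erefl fG'.
exists F0, F1, E; split=> //.
have qE : q.-1.+1 = q by lia.
have f1 := primitive_forms p1.
rewrite FE LpowDr Lpow_Lop qE.
have fLF1 := forms_Lpow q.-1 f1.
have fLG' : forms (k + 1 + 2 * (q.-1)%:Z) (Lpow q G).
  by apply: eq_forms (forms_Lpow q fG'); lia.
rewrite (ext_dD fLF1 fLG') -(Lpow_del_minus p1); last by lia.
rewrite qE (ext_d_Lpow _ fG') E0 LpowDr addrA; congr (_ + _); exact: addrC.
Qed.

(** L^q is injective on Omega^k, where P^k and L Omega^(k-2) are independent. *)
Let component_unique A C E F : primitive k A -> primitive k C -> forms (k - 2) E ->
  forms (k - 2) F -> Lpow q A + Lpow q.+1 E = Lpow q C + Lpow q.+1 F -> A = C.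
Proof.
move=> pA pC fE fF AC.
have pAC : primitive k (A - C) by apply: is_subspaceB => //; exact: is_subspace_primitive.
have fEF := formsB fE fF.
have fLEF : forms k (Lop (E - F)) by apply: eq_forms (forms_Lop fEF); lia.
apply/subr0_eq; apply: (primitive_split_eq0 _ pAC fEF _).1; first by lia.
apply: (Lpow_inj (q := q) (formsD (primitive_forms pAC) fLEF)); first by lia.
rewrite LpowDr Lpow_Lop !LpowB addrACA AC -opprD; exact: subrr.
Qed.

Lemma PH_ddLambda_split : PH_ddLambda M k ≅
  kerL M q.+1 (k - 1) (l + 1) ⊕ cokerL M q.+1 (k - 2) l.
Proof.
rewrite /PH_ddLambda ZE -/B.
(* P^k now represents a cokernel: [g] takes the P^k-component of D, and [f] is the connecting map, d
   (L^q A) = L^(q+1) del_- A being divided by L^(q+1). *)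
pose f A C := primitive k A /\
  exists2 E, forms (k - 2) E & C = del_minus k A + ext_d E.
pose g D A := primitive k A /\
  exists2 E, forms (k - 2) E & D = Lpow q A + Lpow q.+1 E.
have dg A E : primitive k A -> forms (k - 2) E ->
    ext_d (Lpow q A + Lpow q.+1 E) = Lpow q.+1 (del_minus k A + ext_d E).
  move=> pA fE; rewrite (ext_dD (fLq (primitive_forms pA)) (fL fE)).
  by rewrite -(Lpow_del_minus pA kq) (ext_d_Lpow _ fE) LpowDr.
have dg0 A E : primitive k A -> forms (k - 2) E ->
    ext_d (Lpow q A + Lpow q.+1 E) = 0 -> del_minus k A + ext_d E = 0.
  move=> pA fE; rewrite dg// => L0.
  apply: injk; rewrite ?Lpow0r//; last exact: forms0.
  exact: formsD (forms_del_minus pA) (fd1 fE).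
apply: (@cohomology_split _ _ M q.+1 _ _ _ _ Z B f g _ _ SZ SB).
- by rewrite /l; lia.
- by rewrite /l; lia.
- move=> a A A' C C' [pA [E fE ->]] [pA' [E' fE' ->]].
  split; first exact: (is_subspace_primitive M k).2.
  exists (a *: E + E'); first exact: forms_linear.
  rewrite (ext_d_linear a fE fE') (del_linear a pA pA').2; exact: scalerDACA.
- move=> a D D' A A' [pA [E fE ->]] [pA' [E' fE' ->]].
  split; first exact: (is_subspace_primitive M k).2.
  exists (a *: E + E'); first exact: forms_linear.
  rewrite !Lpow_linear; exact: scalerDACA.
- move=> A [pA dA]; have fA := primitive_forms pA; exists (del_minus k A); split.
  + split=> //; exists 0; first exact: forms0.
    by rewrite ext_d0 addr0.
  + by split=> //; exact: forms_del_minus.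
  + rewrite (Lpow_del_minus pA kq).
    by apply: exact_ext_d (forms_Lpow q fA) _; rewrite /l; lia.
- move=> A C [pA dA] [F0 [F1 [p0 p1 AE]]] [_ [E fE ->]] _; rewrite AE.
  (* On del_+ F0 + del_- F1, the operator del_- kills the second term and sends the first to an
     exact form. *)
  have [_] := del_linear 1 (primitive_plus p0) (primitive_minus p1).
  rewrite !scale1r => ->; rewrite (del_minus_del_plus p0).
  have := del_minus_del_minus p1; rewrite addrK => ->.
  rewrite addr0 -(ext_dN (fm2 p0)) -(ext_dD (formsN (fm2 p0)) fE).
  by apply: exact_ext_d (formsD (formsN (fm2 p0)) fE) _; lia.
- move=> C [fC dC] [D fD ED].
  have [|A [E [pA fE DE]]] := @surj D; first by apply: eq_forms fD; lia.
  have CE : C = del_minus k A + ext_d E.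
    apply: injk => //; first exact: formsD (forms_del_minus pA) (fd1 fE).
    by rewrite -ED DE dg.
  exists A; last by split=> //; exists E.
  split=> //; have -> : del_minus k A = C - ext_d E by rewrite CE addrK.
  by rewrite (ext_dB fC (fd1 fE)) dC (ext_d_ext_d fE) subrr.
- move=> D [fD dD]; have [A [E [pA fE DE]]] := surj fD.
  exists A; last by split=> //; exists E.
  rewrite DE in dD; have := dg0 A E pA fE dD => /eqP; rewrite addr_eq0 => /eqP mE.
  by split=> //; rewrite mE (ext_dN (fd1 fE)) (ext_d_ext_d fE) oppr0.
- move=> D A [fD dD] ZA [pA [E fE DE]]; split.
    move=> [F0 [F1 [p0 p1 AE]]].
    have [F fF FE] : exists2 F, forms (l - 1) F & Lpow q (del_minus (k + 1) F1) = ext_d F.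
      case: (posnP q) => [q0|q0].
        (* For q = 0 the degree of F1 is n + 1, where P vanishes. *)
        exists 0; first exact: forms0.
        by rewrite (primitive_out p1) ?(del0 M (k + 1)).2 ?Lpow0r ?ext_d0//; lia.
      have qE : q.-1.+1 = q by lia.
      exists (Lpow q.-1 F1); last by rewrite -(Lpow_del_minus p1) ?qE//; lia.
      by apply: eq_forms (forms_Lpow q.-1 (primitive_forms p1)); rewrite /l; lia.
    have fLF0 : forms (l - 1) (Lpow q F0).
      by apply: eq_forms (forms_Lpow q (primitive_forms p0)); rewrite /l; lia.
    have fEm := formsB fE (fm2 p0).
    have fS := formsD fLF0 fF.
    have DE' : D = ext_d (Lpow q F0 + F) + Lpow q.+1 (E - del_minus (k - 1) F0).
      rewrite DE AE LpowDr FE (Lpow_del_plus p0) LpowB (ext_dD fLF0 fF).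
      rewrite [X in X + _ = _]addrAC -!addrA; congr (_ + (_ + _)); exact: addrC.
    exists (E - del_minus (k - 1) F0), (ext_d (Lpow q F0 + F)); split=> //.
      split; first by apply: eq_forms fEm; lia.
      apply: injk; [exact: fd1|exact: forms0|].
      rewrite Lpow0r -(ext_d_Lpow _ fEm).
      have fdS : forms l (ext_d (Lpow q F0 + F)).
        by apply: eq_forms (forms_ext_d fS); lia.
      have := dD; rewrite DE' (ext_dD fdS (fL fEm)) (ext_d_ext_d fS).
      by rewrite add0r.
    exact: exact_ext_d fS _.
  move=> [G [_ [[fG dG] [F fF <-] DE']]].
  have [F0 [F1 [E' [p0 p1 fE' dF]]]] := exact_component fF.
  exists F0, F1; split=> //.
  apply: (component_unique (E := E) (F := E' + G)) => //.
  - apply: is_subspaceD; [exact: is_subspace_primitive|exact: primitive_plus|].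
    exact: primitive_minus.
  - exact: formsD.
  rewrite -DE DE' dF (LpowDr q.+1 E' G); exact/esym/addrA.
- move=> A C [pA dA] [_ [E fE CE]] [E'' fE'' EE].
  have fE''' : forms (k - 2) E'' by apply: eq_forms fE''; lia.
  have fEE := formsB fE fE'''.
  exists (Lpow q A + Lpow q.+1 (E - E'')), A; split=> //.
  + split; first by apply: formsD; [exact/fLq/primitive_forms|exact: fL].
    rewrite dg// (ext_dB fE fE''') EE CE opprD [- _ - _]addrC addrA addrA.
    by rewrite addrK subrr Lpow0r.
  + by split=> //; exists (E - E'').
  + by rewrite subrr; case: SB.
- move=> D A [fD dD] ZA [pA [E fE DE]]; exists 0; first exact: exact0.
  by split=> //; exists E => //; rewrite dg0// -DE.
Qed.

End DDLambda.

End PrimitiveCohomologies.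

(** * The case p = 0 *)

Section ZeroFiltration.
Context (R : realType) (n : nat) (M : symplectic_manifold R n).
Local Notation primitive := (@Defs.primitive R n M).

Lemma primitive_filtered s : 0 <= s <= n%:Z -> primitive s = filtered 0 s.
Proof.
move=> sn; have s1 : s <= n%:Z + 0%:Z + 1 by lia.
apply/seteqP; split=> A.
  move=> pA; apply/(filteredE _ (leq0n n) s1); split; first exact: primitive_forms.
  by move=> r rn; apply: primitive_Lpow pA _; lia.
move=> /(filteredE _ (leq0n n) s1)[fA LA].
by apply: (@primitive_intro _ _ _ _ _ (absz (n%:Z + 1 - s)%R)) => //; [lia|apply: LA; lia].
Qed.

(** The projection to F^0 removes the term L del_- A of dA. *)
Lemma d_plus_primitive s A : 0 <= s < n%:Z -> primitive s A ->
  d_plus 0 s A = del_plus s A.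
Proof.
move=> sn pA; have [p1 p2 dA] := del_spec pA; rewrite /d_plus dA.
apply: (@Pi_eq _ _ M 0 (s + 1) (del_plus s A) (del_minus s A)); [by []|lia| |].
  split; first exact: primitive_forms.
  by move=> r rn; apply: primitive_Lpow p1 _; lia.
by apply: eq_forms (primitive_forms p2); lia.
Qed.

(** On primitive forms [star_r] is a power of L, and d (L^(n-s) A) = L^(n-s+1) del_- A is the image
    of del_- A under it. *)
Lemma d_minus_primitive s A : 0 < s <= n%:Z -> primitive s A ->
  d_minus s A = del_minus s A.
Proof.
move=> sn pA; have [p1 p2 dA] := del_spec pA; rewrite /d_minus.
have qE : (absz (n%:Z - s)%R)%:Z = n%:Z - s by lia.
rewrite (star_primitive qE _ pA); last by lia.
rewrite -(Lpow_del_minus pA qE) -(star_primitive _ _ p2); [|lia|lia].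
by apply: star_starE (primitive_forms p2) _; lia.
Qed.

Lemma PH_del_plusE k : 0 < k < n%:Z -> PH_del_plus M k = FH_plus M 0 k.
Proof.
move=> kn; have k1 : 0 <= k - 1 < n%:Z by lia.
rewrite /PH_del_plus /FH_plus -!primitive_filtered; [|lia|lia].
congr subquotient; apply/seteqP; split=> A /=.
- by move=> [pA dA]; split=> //; rewrite d_plus_primitive//; lia.
- by move=> [pA]; rewrite d_plus_primitive//; lia.
- by move=> [F pF <-]; exists F; rewrite // d_plus_primitive.
- by move=> [F pF <-]; exists F; rewrite // d_plus_primitive.
Qed.

Lemma PH_del_minusE k : 0 < k < n%:Z -> PH_del_minus M k = FH_minus M 0 k.
Proof.
move=> kn; have k1 : 0 < k + 1 <= n%:Z by lia.
rewrite /PH_del_minus /FH_minus -!primitive_filtered; [|lia|lia].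
congr subquotient; apply/seteqP; split=> A /=.
- by move=> [pA dA]; split=> //; rewrite d_minus_primitive//; lia.
- by move=> [pA]; rewrite d_minus_primitive//; lia.
- by move=> [F pF <-]; exists F; rewrite // d_minus_primitive.
- by move=> [F pF <-]; exists F; rewrite // d_minus_primitive.
Qed.

End ZeroFiltration.

Theorem corollary4p3 (R : realType) (n : nat) (M : symplectic_manifold R n) :
  (forall k : nat, (k <= n)%N ->
    PH_ddLambda M k%:Z
      ≅ kerL M (n - k + 1)%N (k%:Z - 1) (2 * n%:Z - k%:Z + 1)
        ⊕ cokerL M (n - k + 1)%N (k%:Z - 2) (2 * n%:Z - k%:Z) /\
    PH_d_plus_dLambda M k%:Z
      ≅ kerL M (n - k + 1)%N k%:Z (2 * n%:Z - k%:Z + 2)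
        ⊕ cokerL M (n - k + 1)%N (k%:Z - 1) (2 * n%:Z - k%:Z + 1)) /\
  (forall p k : nat, (p <= n)%N -> (2 * p < k)%N -> (k < n + p)%N ->
    FH_plus M p k%:Z
      ≅ kerL M (p + 1)%N (k%:Z - 2 * p%:Z - 1) (k%:Z + 1)
        ⊕ cokerL M (p + 1)%N (k%:Z - 2 * p%:Z - 2) k%:Z /\
    FH_minus M p k%:Z
      ≅ kerL M (p + 1)%N (2 * n%:Z - k%:Z) (2 * n%:Z - k%:Z + 2 * p%:Z + 2)
        ⊕ cokerL M (p + 1)%N (2 * n%:Z - k%:Z - 1)
            (2 * n%:Z + 2 * p%:Z - k%:Z + 1)) /\
  (forall k : nat, (0 < k)%N -> (k < n)%N ->
    PH_del_plus M k%:Z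
      ≅ kerL M 1 (k%:Z - 1) (k%:Z + 1) ⊕ cokerL M 1 (k%:Z - 2) k%:Z /\
    PH_del_minus M k%:Z
      ≅ kerL M 1 (2 * n%:Z - k%:Z) (2 * n%:Z - k%:Z + 2)
        ⊕ cokerL M 1 (2 * n%:Z - k%:Z - 1) (2 * n%:Z - k%:Z + 1)).
Proof.
split; [|split].
- move=> k kn; have kq : (n - k)%N%:Z = n%:Z - k%:Z by lia.
  by rewrite addn1; split; [exact: PH_ddLambda_split|exact: PH_d_plus_dLambda_split].
- move=> p k pn _ knp; have kp : k%:Z < n%:Z + p%:Z by lia.
  rewrite addn1; split; first exact: FH_plus_split.
  have -> : 2 * n%:Z + 2 * p%:Z - k%:Z + 1 = 2 * n%:Z - k%:Z + 2 * p%:Z + 1 by lia.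
  exact: FH_minus_split.
- move=> k k0 kn; have kn' : 0 < k%:Z < n%:Z by lia.
  have kp : k%:Z < n%:Z + 0%:Z by lia.
  rewrite PH_del_plusE// PH_del_minusE//; split.
    by have := FH_plus_split M (leq0n n) kp; rewrite mulr0 subr0.
  by have := FH_minus_split M (leq0n n) kp; rewrite mulr0 addr0.
Qed.
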